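(* Let $k\ge 2$ be an even integer and $n$ an integer with $k<\frac n2$, and let $u:\mathbb{R}^n\to\mathbb{R}$ be a smooth function such that $(\mathcal{M}^n,g)=(\mathbb{R}^n,e^{-2u}\delta)$ is an asymptotically flat CF manifold of decay order $\tau>\frac{n-2k}{k+1}$ with $L_k(g)$ integrable over $(\mathcal{M},g)$. Assume that $(-1)^jL_j(g)\ge 0$ on $\mathcal{M}$ for every $1\le j\le k$. Then the Gauss-Bonnet-Chern mass satisfies $m_k\ge 0$. Moreover, $m_k=0$ if and only if $u\equiv 0$, i.e. $(\mathcal{M},g)$ is the Euclidean space.
   Context: $\delta$ is the Euclidean metric on $\mathbb{R}^n$. The manifold $(\mathbb{R}^n,e^{-2u}\delta)$ is called an asymptotically flat CF (conformally flat) manifold of decay order $\tau$ if $|u|+|x||\nabla u|+|x|^2|\nabla^2u|=O(|x|^{-\tau})$ as $|x|\to\infty$ (Euclidean derivatives and norms). Gauss-Bonnet curvatures: with the summation convention and the generalized Kronecker delta $\delta^{j_1\cdots j_r}_{i_1\cdots i_r}=\det(\delta^{j_b}_{i_a})_{a,b=1}^r$, $$L_k=\frac1{2^k}\delta^{i_1i_2\cdots i_{2k-1}i_{2k}}_{j_1j_2\cdots j_{2k-1}j_{2k}}{R_{i_1i_2}}^{j_1j_2}\cdots{R_{i_{2k-1}i_{2k}}}^{j_{2k-1}j_{2k}},$$ where the Riemann tensor of $g$ has the sign convention for which $L_1$ is the scalar curvature (positive on round spheres). Set $$P_{(k)}^{stlm}=\frac1{2^k}\delta^{i_1\cdots i_{2k-2}\,s\,t}_{j_1\cdots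 j_{2k-2}j_{2k-1}j_{2k}}{R_{i_1i_2}}^{j_1j_2}\cdots{R_{i_{2k-3}i_{2k-2}}}^{j_{2k-3}j_{2k-2}}g^{j_{2k-1}l}g^{j_{2k}m},$$ so that $L_k=P_{(k)}^{ijlm}R_{ijlm}$. The Gauss-Bonnet-Chern mass is $$m_k=m_{GBC}=\frac{(n-2k)!}{2^{k-1}(n-1)!\,\omega_{n-1}}\lim_{r\to\infty}\int_{S_r}P_{(k)}^{ijlm}\,\partial_m g_{jl}\,\nu_i\,dS,$$ where $\omega_{n-1}$ is the volume of the unit sphere $\mathbb{S}^{n-1}$, $S_r$ is the Euclidean coordinate sphere of radius $r$, $dS$ its Euclidean area element, $\nu$ its Euclidean outward unit normal, and $\partial_m$ the ordinary partial derivative in the standard coordinates. The mass is well defined when $\tau>\frac{n-2k}{k+1}$ and $L_k$ is integrable over $\mathcal{M}$ (with respect to $dvol_g$). *)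

(* Defs.v *)
From HB Require Import structures.
From mathcomp Require Import all_boot all_order all_algebra.
From mathcomp Require Import all_classical all_reals all_analysis.

Set Implicit Arguments.
Unset Strict Implicit.
Unset Printing Implicit Defensive.

Import Order.TTheory GRing.Theory Num.Theory.
Import numFieldNormedType.Exports.

Local Open Scope classical_set_scope.
Local Open Scope ring_scope.

(* Lebesgue measure on R^n, on the product sigma-algebra of n.-tuple R, by
   recursion on n: a Dirac mass on R^0, and the image of the product of the
   Lebesgue measures of R and R^n under (x, t) |-> x :: t on R^(n+1). *)
Section lebesgue_tuple.
Context {R : realType}.
Local Notation Rm := (measurableTypeR R).

Definition cons_pair n (p : Rm * n.-tuple Rm) : n.+1.-tuple Rm :=
  [the n.+1.-tuple Rm of p.1 :: p.2].

Lemma measurable_cons_pair n : measurable_fun setT (@cons_pair n).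
Proof. exact: measurable_cons. Qed.

Section step.
Variables (n : nat) (mu : {sigma_finite_measure set (n.-tuple Rm) -> \bar R}).

Definition lebesgue_step : set (n.+1.-tuple Rm) -> \bar R :=
  pushforward (@lebesgue_measure R \x mu)%E (@cons_pair n).

Let step0 : lebesgue_step set0 = 0%E.
Proof. by rewrite /lebesgue_step /pushforward preimage_set0 measure0. Qed.

Let step_ge0 A : (0 <= lebesgue_step A)%E.
Proof. exact: (measure_ge0 (@lebesgue_measure R \x mu)%E). Qed.

Let step_sigma_additive : semi_sigma_additive lebesgue_step.
Proof.
move=> F mF tF mUF; rewrite /lebesgue_step /pushforward preimage_bigcup.
apply: measure_semi_sigma_additive.
- by move=> i; rewrite -[X in measurable X]setTI; exact: measurable_cons_pair.
- apply/trivIsetP => /= i j _ _ ij; rewrite -preimage_setI.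
  by move/trivIsetP : tF => /(_ _ _ _ _ ij) ->//; rewrite preimage_set0.
- rewrite -preimage_bigcup -[X in measurable X]setTI.
  exact: measurable_cons_pair.
Qed.

HB.instance Definition _ := isMeasure.Build _ _ _ lebesgue_step
  step0 step_ge0 step_sigma_additive.

Let step_sigma_finite : sigma_finite setT lebesgue_step.
Proof.
have /sigma_finiteP[F [FT ndF Foo]] := sigma_finiteT (@lebesgue_measure R).
have /sigma_finiteP[G [GT ndG Goo]] := sigma_finiteT mu.
pose un (t : n.+1.-tuple Rm) : Rm * n.-tuple Rm := (thead t, behead_tuple t).
have consK p : un (@cons_pair n p) = p.
  by case: p => x t; congr pair; exact: val_inj.
have mun : measurable_fun setT un.
  apply/measurable_fun_pair => /=; first exact: measurable_tnth.
  exact: measurable_behead.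
exists (fun i => un @^-1` (F i `*` G i)).
  rewrite predeqE => t; split => // _.
  have [i _ Fi] : (\bigcup_i F i) (un t).1 by rewrite -FT.
  have [j _ Gj] : (\bigcup_j G j) (un t).2 by rewrite -GT.
  exists (maxn i j) => //; split.
  - by move: Fi; exact/subsetPset/ndF/leq_maxl.
  - by move: Gj; exact/subsetPset/ndG/leq_maxr.
move=> i; have [mFi Fioo] := Foo i; have [mGi Gioo] := Goo i; split.
  rewrite -[X in measurable X]setTI; apply: mun => //; exact: measurableX.
rewrite /lebesgue_step /pushforward -comp_preimage.
rewrite (_ : un \o _ = id); last by apply/funext => p /=; rewrite consK.
by rewrite preimage_id product_measure1E// lte_mul_pinfty// ge0_fin_numE.
Qed.

HB.instance Definition _ := Measure_isSigmaFinite.Build _ _ _ lebesgue_step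
  step_sigma_finite.

End step.

Fixpoint lebesgue_tuple n : {sigma_finite_measure set (n.-tuple Rm) -> \bar R} :=
  match n with
  | 0 => \d_([tuple] : 0.-tuple Rm)
  | n'.+1 => lebesgue_step (lebesgue_tuple n')
  end.

End lebesgue_tuple.

Section euclidean.
Context {R : realType} {n : nat}.
Implicit Types (x : 'rV[R]_n) (u : 'rV[R]_n -> R) (i : 'I_n).

Definition row_of_tuple (t : n.-tuple (measurableTypeR R)) : 'rV[R]_n :=
  \row_i tnth t i.

(* The norm `|x| of the library on row vectors is the sup norm. *)
Definition eucl_norm x : R := Num.sqrt (\sum_i x 0 i ^+ 2).

Definition pderiv i u x : R := 'D_('e_i) u x.

Definition smooth u : Prop :=
  forall s : seq 'I_n, let v := foldr pderiv u s in
    continuous v /\ forall i x, derivable v x 'e_i.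

Definition grad_norm u x : R := Num.sqrt (\sum_i pderiv i u x ^+ 2).

Definition hess_norm u x : R :=
  Num.sqrt (\sum_i \sum_j pderiv i (pderiv j u) x ^+ 2).

End euclidean.

(* The integral of f over the sphere S_r of R^n against the Euclidean area
   element. Up to the equator, which is negligible, S_r is the union of the
   graphs x_0 = h(y) and x_0 = - h(y) over the ball |y| < r of R^(n-1), where
   h(y) = sqrt (r^2 - |y|^2), and their area element is
   sqrt (1 + |grad h(y)|^2) dy = (r / h(y)) dy. *)
Definition sphere_integral {R : realType} {n : nat} (r : R)
    (f : 'rV[R]_n -> R) : R :=
  let h (y : n.-1.-tuple R) := Num.sqrt (r ^+ 2 - eucl_norm (row_of_tuple y) ^+ 2) in
  let pt (x0 : R) (y : n.-1.-tuple R) : 'rV[R]_n := \row_(i < n) nth 0 (x0 :: y) i in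
  \int[lebesgue_tuple n.-1]_(y in [set y | eucl_norm (row_of_tuple y) < r])
     ((f (pt (h y) y) + f (pt (- h y) y)) * (r / h y)).

Section curvature.
Context {R : realType} {n : nat}.
Variable g : 'rV[R]_n -> 'M[R]_n.
Implicit Types (x : 'rV[R]_n) (i j l m p q s t : 'I_n).

Definition ginv i j x : R := invmx (g x) i j.

(* The Christoffel symbol Gamma^k_(i j). *)
Definition christoffel k i j x : R :=
  2^-1 * \sum_l ginv k l x *
    (pderiv i (fun y => g y j l) x + pderiv j (fun y => g y i l) x
     - pderiv l (fun y => g y i j) x).

(* The component R_(i j)^k_l, with R(d_i, d_j) d_l = R_(i j)^k_l d_k and
   R(X, Y) = [nabla_X, nabla_Y] - nabla_[X, Y]. *)
Definition riemann k l i j x : R :=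
  pderiv i (christoffel k j l) x - pderiv j (christoffel k i l) x
  + \sum_p (christoffel k i p x * christoffel p j l x
            - christoffel k j p x * christoffel p i l x).

(* R_(i j)^(k l); the full contraction R_(i j)^(i j) is the scalar curvature,
   which is positive on round spheres. *)
Definition riemann_up i j k l x : R := \sum_q ginv l q x * riemann k q i j x.

Definition gen_kronecker r (I J : 'I_r -> 'I_n) : R :=
  \det (\matrix_(a < r, b < r) (I a == J b)%:R).

Lemma fst_slot_subproof k (a : 'I_k) : (a.*2 < k.*2)%N.
Proof. by rewrite ltn_double. Qed.

Lemma snd_slot_subproof k (a : 'I_k) : (a.*2.+1 < k.*2)%N.
Proof. by rewrite -doubleS leq_double. Qed.

(* The positions of the two members of the a-th consecutive pair of a
   multi-index of length 2k. *)
Definition fst_slot k (a : 'I_k) : 'I_k.*2 := Ordinal (fst_slot_subproof a).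
Definition snd_slot k (a : 'I_k) : 'I_k.*2 := Ordinal (snd_slot_subproof a).

Definition riemann_prod k (I J : 'I_k.*2 -> 'I_n) x : R :=
  \prod_(a < k) riemann_up (I (fst_slot a)) (I (snd_slot a))
                           (J (fst_slot a)) (J (snd_slot a)) x.

(* The Gauss-Bonnet curvature L_k. *)
Definition gauss_bonnet (k : nat) x : R :=
  2 ^- k * \sum_(I : {ffun 'I_k.*2 -> 'I_n}) \sum_(J : {ffun 'I_k.*2 -> 'I_n})
    gen_kronecker I J * riemann_prod (k := k) I J x.

(* The multi-index (I, s, t). *)
Definition extend2 r (I : 'I_r -> 'I_n) s t (a : 'I_(r + 2)) : 'I_n :=
  match fintype.split a with
  | inl b => I b
  | inr b => if b == ord0 then s else t
  end.

(* P_(k)^(s t l m), for k >= 1. *)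
Definition gb_tensor (k : nat) s t l m x : R :=
  2 ^- k * \sum_(I : {ffun 'I_k.-1.*2 -> 'I_n})
           \sum_(J : {ffun 'I_k.-1.*2 -> 'I_n}) \sum_p \sum_q
    gen_kronecker (extend2 I s t) (extend2 J p q) * riemann_prod (k := k.-1) I J x
    * ginv p l x * ginv q m x.

Definition volume_density x : R := Num.sqrt (\det (g x)).

Definition integrable_gauss_bonnet (k : nat) : Prop :=
  (lebesgue_tuple n).-integrable setT (fun y =>
    (gauss_bonnet k (row_of_tuple y) * volume_density (row_of_tuple y))%:E).

Definition gbc_flux (k : nat) (r : R) : R :=
  sphere_integral r (fun x =>
    \sum_i \sum_j \sum_l \sum_m
      gb_tensor k i j l m x * pderiv m (fun y => g y j l) x
      * (x 0 i / eucl_norm x)).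

Definition gbc_mass (k : nat) : R :=
  let omega := sphere_integral 1 (fun _ : 'rV[R]_n => 1) in
  (n - k.*2)`!%:R / (2 ^+ k.-1 * n.-1`!%:R * omega)
  * lim (gbc_flux k r @[r --> +oo]).

End curvature.

Definition conformally_flat {R : realType} {n : nat} (u : 'rV[R]_n -> R)
    (x : 'rV[R]_n) : 'M[R]_n :=
  (expR (- (2 * u x)))%:M.

Definition asymptotically_flat_CF {R : realType} {n : nat} (tau : R)
    (u : 'rV[R]_n -> R) : Prop :=
  exists C r0 : R, forall x : 'rV[R]_n, r0 <= eucl_norm x ->
    `|u x| + eucl_norm x * grad_norm u x + eucl_norm x ^+ 2 * hess_norm u x
    <= C * eucl_norm x `^ (- tau).

(* Main.v *)
Require Import Defs.
From HB Require Import structures.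
From mathcomp Require Import all_boot all_order all_algebra.
From mathcomp Require Import all_classical all_reals all_analysis.
From mathcomp Require Import measurable_realfun.
From mathcomp Require Import perm ring lra.

Set Implicit Arguments.
Unset Strict Implicit.
Unset Printing Implicit Defensive.

Import Order.TTheory GRing.Theory Num.Theory.
Import numFieldNormedType.Exports.

Local Open Scope classical_set_scope.
Local Open Scope ring_scope.


(** Write [g = e^(-2u) delta] and let [W] be its Schouten matrix in Euclidean coordinates. As [g]
    is conformally flat its curvature is the Kulkarni-Nomizu product of [W] with the metric, and
    every contraction with a generalized Kronecker delta collapses: the Gauss-Bonnet curvature of
    order [j] is a positive multiple of [e^(2ju) sigma_j(W)] ([gauss_bonnetE]), and the integrand
    of the mass of order [k] is a positive multiple of [e^(2ku) (T du) . nu], with [T] the Newton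
    transformation of order [k - 1] of [W] ([fluxE]).

    The Cotton tensor vanishes, so the divergence of [T] can be computed ([div_newton]). With the
    weight [e^(au)], [a = -(n - 2k + 1)], the field [F = e^(au) T du] satisfies
      [div F = e^(au) (k sigma_k - (n - k + 1)/2 |du|^2 sigma_(k-1))]
    ([div_flux_field]). For even [k] the sign hypotheses say [sigma_k >= 0 >= sigma_(k-1)], so the
    divergence is nonnegative. Its first term is integrable because the curvature of order [k] is,
    the second one by the decay of [u] ([flux_div_finite]). Hence the flux of [F] through large
    spheres increases to a limit, the integral of [div F] ([ball_flux_cvg]). The weights [e^(2ku)]
    and [e^(au)] differ by [O(|u|)], which is negligible at infinity ([flux_defect]); thus the mass
    is a positive multiple of the integral of [div F], and is nonnegative.

    If the mass vanishes then [div F = 0], hence [sigma_k = 0] everywhere. Suppose [u] is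
    positive somewhere. As [u] tends to 0 at infinity, [u + e |x|^2] has an interior maximum for
    small [e] ([interior_max]), where [-W] is positive definite and [sigma_k(W) <> 0]. This
    is absurd, so [u <= 0] ([sigma_eq0_nonpos]). In the same way, at an interior minimum of
    [u - e |x|^2] with [u] negative the trace of [W] would be positive, against the sign of the
    scalar curvature ([sigma1_le0_nonneg]).

    In the lemmas the order of the mass is written [k.+1], so that [newton _ k] is [T].

    The surface integrals are given by graphs over the ball of [R^(n-1)]. They are tied to volume
    integrals by polar coordinates ([polar_coordinates]), which rest on Tonelli and on a
    substitution in one variable. The divergence theorem on balls ([divergence_theorem]) then
    follows from the vanishing of integrals of compactly supported derivatives, applied to the
    field times a radial cutoff. *)

(** * Mixed discriminants *)

Section mixed_discriminant.
Context {R : realType} {n : nat}.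
Implicit Types (r : nat) (W : 'M[R]_n) (v w : 'cV[R]_n).

(** Polarization of the elementary symmetric functions: up to [r`!] it is the mixed discriminant
    of the matrices [M a], one for each row of the generalized Kronecker delta. Both the
    curvatures and the mass integrand are sums of this shape. *)
Definition mixed_disc r (M : 'I_r -> 'M[R]_n) : R :=
  \sum_(I : {ffun 'I_r -> 'I_n}) \sum_(J : {ffun 'I_r -> 'I_n})
    gen_kronecker I J * \prod_(a < r) M a (I a) (J a).

(** The sum over [I] is the multilinearity of the determinant in its rows. *)
Lemma mixed_disc_det r (M : 'I_r -> 'M[R]_n) :
  mixed_disc M = \sum_(J : {ffun 'I_r -> 'I_n})
    \det (\matrix_(a, b) M a (J b) (J a)).
Proof.
rewrite /mixed_disc exchange_big /=; apply: eq_bigr => J _.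
under eq_bigr do rewrite /gen_kronecker /determinant mulr_suml.
rewrite exchange_big /=; apply: eq_bigr => s _.
under eq_bigr do rewrite -mulrA -big_split /=.
rewrite -mulr_sumr; congr (_ * _).
transitivity (\sum_(I : {ffun 'I_r -> 'I_n})
    \prod_a ((I a == J (s a))%:R * M a (I a) (J a))).
  by apply: eq_bigr => I _; apply: eq_bigr => a _; rewrite mxE.
rewrite -(bigA_distr_bigA (fun a i => (i == J (s a))%:R * M a i (J a))).
apply: eq_bigr => a _; rewrite mxE (bigD1 (J (s a))) //= eqxx mul1r.
by rewrite big1 ?addr0 // => i /negbTE ->; rewrite mul0r.
Qed.

Lemma mixed_disc_reindex r s (h : 'I_r -> 'I_s) (M : 'I_s -> 'M[R]_n) :
  bijective h -> mixed_disc (M \o h) = mixed_disc M.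
Proof.
move=> hbij; have ers : r = s by move: (bij_eq_card hbij); rewrite !card_ord.
move: h M hbij; rewrite -ers => {s ers} h M hbij.
rewrite !mixed_disc_det.
pose f (J : {ffun 'I_r -> 'I_n}) : {ffun 'I_r -> 'I_n} := [ffun a => J (h a)].
have [g gK hK] := hbij.
rewrite [LHS](reindex f) /=; last first.
  apply: onW_bij; exists (fun J : {ffun 'I_r -> 'I_n} => [ffun a => J (g a)] : {ffun 'I_r -> 'I_n}).
    by move=> J; apply/ffunP => a; rewrite !ffunE hK.
  by move=> J; apply/ffunP => a; rewrite !ffunE gK.
apply: eq_bigr => J _.
have hinj := bij_inj hbij; pose p := perm hinj.
transitivity (\det (row_perm p (col_perm p (\matrix_(a, b) M a (J b) (J a))))).
  by congr (\det _); apply/matrixP => a b; rewrite !mxE !ffunE !permE.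
rewrite row_permE col_permE !det_mulmx !det_perm mulrC -mulrA -signr_addb.
by rewrite odd_permV addbb mulr1.
Qed.

Lemma eq_mixed_disc r (M N : 'I_r -> 'M[R]_n) : M =1 N -> mixed_disc M = mixed_disc N.
Proof. by move=> /funext ->. Qed.

Definition with_slot r (a : 'I_r) (X : 'M[R]_n) (M : 'I_r -> 'M[R]_n) (b : 'I_r) :=
  if b == a then X else M b.

Lemma mixed_disc_slot r (a : 'I_r) X (M : 'I_r -> 'M[R]_n) :
  mixed_disc (with_slot a X M) =
  \sum_(I : {ffun 'I_r -> 'I_n}) \sum_(J : {ffun 'I_r -> 'I_n})
    gen_kronecker I J * (X (I a) (J a) * \prod_(b < r | b != a) M b (I b) (J b)).
Proof.
apply: eq_bigr => I _; apply: eq_bigr => J _; congr (_ * _).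
rewrite (bigD1 a) //= /with_slot eqxx; congr (_ * _).
by apply: eq_bigr => b /negbTE ->.
Qed.

Lemma mixed_disc_slot_sum r (a : 'I_r) (T : finType) (c : T -> R) (X : T -> 'M[R]_n) M :
  mixed_disc (with_slot a (\sum_t c t *: X t) M) =
  \sum_t c t * mixed_disc (with_slot a (X t) M).
Proof.
rewrite mixed_disc_slot.
under [RHS]eq_bigr do rewrite mixed_disc_slot mulr_sumr.
rewrite [RHS]exchange_big /=; apply: eq_bigr => I _.
under [RHS]eq_bigr do rewrite mulr_sumr.
rewrite [RHS]exchange_big /=; apply: eq_bigr => J _.
have -> : (\sum_t c t *: X t) (I a) (J a) = \sum_t c t * X t (I a) (J a).
  by rewrite summxE; apply: eq_bigr => t _; rewrite mxE.
by rewrite mulr_suml mulr_sumr; apply: eq_bigr => t _; ring.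
Qed.

(** Expansion along the first row. A transposition of columns turns the minor of an entry of
    the border into the inner block with one column replaced by the first column. *)
Lemma det_bordered r (A : 'M[R]_r.+1) :
  \det A = A ord0 ord0 * \det (row' ord0 (col' ord0 A))
   - \sum_b A ord0 (lift ord0 b) *
       \det (\matrix_(a, c) A (lift ord0 a) (if c == b then ord0 else lift ord0 c)).
Proof.
have cof (j : 'I_r.+1) (B : 'M[R]_r.+1) : (forall a c, B (lift ord0 a) c = A (lift ord0 a) c) ->
    cofactor B ord0 j = cofactor A ord0 j.
  move=> BA; rewrite /cofactor; congr (_ * \det _).
  by apply/matrixP => a c; rewrite !mxE BA.
rewrite (expand_det_row A ord0) big_ord_recl; congr (_ + _).
  by rewrite /cofactor expr0 mul1r.
rewrite -sumrN; apply: eq_bigr => b _; rewrite -mulrN; congr (_ * _).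
pose B : 'M[R]_r.+1 :=
  \matrix_(i, j) if i == ord0 then (j == lift ord0 b)%:R else A i j.
have -> : cofactor A ord0 (lift ord0 b) = \det B.
  rewrite (expand_det_row B ord0) (bigD1 (lift ord0 b)) //= big1 ?addr0.
    by rewrite !mxE !eqxx mul1r; apply/esym/cof => a c; rewrite mxE.
  by move=> j /negbTE jb; rewrite mxE eqxx jb mul0r.
pose p := tperm ord0 (lift ord0 b).
pose C := col_perm p B.
have -> : \det B = - \det C.
  rewrite /C col_permE det_mulmx det_perm odd_permV odd_tperm.
  by rewrite eqE /= expr1 mulrN1 opprK.
congr (- _); rewrite (expand_det_row C ord0) big_ord_recl big1 ?addr0; last first.
  move=> j _; rewrite 2!mxE eqxx (_ : _ == _ = false) ?mul0r //.
  apply/negbTE/eqP => /(congr1 p); rewrite tpermK tpermR => /eqP.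
  by rewrite eqE.
rewrite 2!mxE eqxx tpermL eqxx mul1r /cofactor expr0 mul1r; congr (\det _).
apply/matrixP => a c; rewrite !mxE eqE /=; congr (A _ _).
case: (eqVneq c b) => [->|cb]; first by rewrite /p tpermR.
by rewrite /p tpermD ?neq_lift // (inj_eq lift_inj) eq_sym.
Qed.

Lemma col_tensorE v w i j : (v *m w^T) i j = v i ord0 * w j ord0.
Proof. by rewrite mxE big_ord1 mxE. Qed.

(** The slot of a rank one matrix borders the determinant, so that its two vectors are
    contracted either with each other or through one of the other matrices. For equal
    matrices this is the recursion of the Newton transformations. *)
Lemma mixed_disc_laplace r v w (M : 'I_r.+1 -> 'M[R]_n) :
  M ord0 = v *m w^T ->
  let N a := M (lift ord0 a) in
  mixed_disc M = (w^T *m v) 0 0 * mixed_disc N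
    - \sum_b mixed_disc (with_slot b (N b *m v *m w^T) N).
Proof.
move=> M0 N.
pose cons (pJ : 'I_n * {ffun 'I_r -> 'I_n}) : {ffun 'I_r.+1 -> 'I_n} :=
  [ffun a => if unlift ord0 a is Some b then pJ.2 b else pJ.1].
pose uncons (J : {ffun 'I_r.+1 -> 'I_n}) := (J ord0, [ffun b => J (lift ord0 b)]).
have consK : cancel cons uncons.
  move=> [p J]; rewrite /uncons /cons ffunE unlift_none; congr pair.
  by apply/ffunP => b; rewrite !ffunE liftK.
have unconsK : cancel uncons cons.
  move=> J; apply/ffunP => a; rewrite ffunE.
  by case: unliftP => [b|] ->; rewrite //= ffunE.
have consE0 p J : cons (p, J) ord0 = p by rewrite ffunE unlift_none.
have consEl p J b : cons (p, J) (lift ord0 b) = J b by rewrite ffunE liftK.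
rewrite mixed_disc_det (reindex cons) /=; last by apply: onW_bij; exists uncons.
rewrite -(pair_big predT predT (fun p J => \det (\matrix_(a, b) M a (cons (p, J) b) (cons (p, J) a)))) /=.
under eq_bigr do under eq_bigr do rewrite det_bordered.
under eq_bigr do rewrite big_split /= sumrN.
rewrite big_split /= sumrN; congr (_ - _).
  rewrite mxE mulr_suml; apply: eq_bigr => p _.
  rewrite mixed_disc_det mulr_sumr; apply: eq_bigr => J _.
  rewrite mxE M0 col_tensorE !consE0 mxE mulrC [RHS]mulrC; congr (_ * _); last by rewrite mulrC.
  by congr (\det _); apply/matrixP => a b; rewrite !mxE !consEl.
transitivity (\sum_b \sum_p \sum_J
    M ord0 (cons (p, J) (lift ord0 b)) p *
    \det (\matrix_(a, c) M (lift ord0 a)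
      (cons (p, J) (if c == b then ord0 else lift ord0 c)) (J a))).
  rewrite [RHS]exchange_big /=; apply: eq_bigr => p _.
  rewrite [RHS]exchange_big /=; apply: eq_bigr => J _.
  apply: eq_bigr => b _; rewrite mxE consE0; congr (_ * \det _).
  by apply/matrixP => a c; rewrite !mxE consEl.
apply: eq_bigr => b _.
rewrite mixed_disc_det.
pose chg p (J : {ffun 'I_r -> 'I_n}) : {ffun 'I_r -> 'I_n} := [ffun c => if c == b then p else J c].
pose F p (J : {ffun 'I_r -> 'I_n}) := v (J b) ord0 * w p ord0 *
  \det (\matrix_(a, c) N a (chg p J c) (J a)).
transitivity (\sum_p \sum_J F p J).
  apply: eq_bigr => p _; apply: eq_bigr => J _; rewrite /F.
  rewrite M0 col_tensorE consEl; congr (_ * \det _).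
  apply/matrixP => a c; rewrite !mxE /chg [in RHS]ffunE.
  by case: eqP => _; rewrite ?consE0 ?consEl.
pose G (J : {ffun 'I_r -> 'I_n}) q := F (J b) (chg q J).
transitivity (\sum_J \sum_q G J q).
  rewrite !pair_big /=.
  rewrite [RHS](reindex (fun x : 'I_n * {ffun 'I_r -> 'I_n} => (chg x.1 x.2, x.2 b))) /=.
    apply: eq_bigr => -[p J] _; rewrite /G /= ffunE eqxx.
    by congr (F _ _); apply/ffunP => c; rewrite !ffunE; case: eqP => // ->.
  apply: onW_bij; exists (fun x : {ffun 'I_r -> 'I_n} * 'I_n => (x.1 b, chg x.2 x.1)).
    move=> [p J] /=; congr pair; first by rewrite ffunE eqxx.
    by apply/ffunP => c; rewrite !ffunE; case: eqP => // ->.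
  move=> [J q] /=; congr pair; last by rewrite ffunE eqxx.
  by apply/ffunP => c; rewrite !ffunE; case: eqP => // ->.
apply: eq_bigr => J _; rewrite (expand_det_row _ b).
transitivity (\sum_q \sum_c v q ord0 * w (J b) ord0 * (N b (J c) q *
   cofactor (\matrix_(a, c) with_slot b (N b *m v *m w^T) N a (J c) (J a)) b c)).
  apply: eq_bigr => q _; rewrite /G /F ffunE eqxx (expand_det_row _ b) mulr_sumr.
  apply: eq_bigr => c _; congr (_ * (_ * _)).
    rewrite mxE !ffunE eqxx; congr (N b _ _).
    by case: eqP => // ->.
  rewrite /cofactor; congr (_ * \det _); apply/matrixP => a d; rewrite !mxE !ffunE.
  rewrite /with_slot [lift b a == b]eq_sym (negbTE (neq_lift _ _)); congr (N _ _ _).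
  by case: eqP => // ->.
rewrite exchange_big /=; apply: eq_bigr => c _.
rewrite [in RHS]mxE {2}/with_slot eqxx col_tensorE mxE !mulr_suml.
by apply: eq_bigr => q _; ring.
Qed.

End mixed_discriminant.

(** * Newton transformations and elementary symmetric functions *)

Section newton.
Context {R : realType} {n : nat}.
Implicit Types (W M : 'M[R]_n) (v w : 'cV[R]_n).

(** The Newton transformations [T_k] and the symmetric functions [sigma_k] by the
    Faddeev-Le Verrier recursion, which needs no eigenvalues. *)
Fixpoint newton W k : 'M[R]_n :=
  match k with
  | 0 => 1%:M
  | j.+1 => (\tr (newton W j *m W) / j.+1%:R)%:M - newton W j *m W
  end.

Definition sigma W k : R :=
  match k with
  | 0 => 1
  | j.+1 => \tr (newton W j *m W) / j.+1%:R
  end.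

#[global] Arguments newton : simpl never.
#[global] Arguments sigma : simpl never.

Lemma newtonS W k : newton W k.+1 = (sigma W k.+1)%:M - newton W k *m W.
Proof. by []. Qed.

Lemma sigmaS W k : k.+1%:R * sigma W k.+1 = \tr (newton W k *m W).
Proof. by rewrite /sigma mulrC divfK. Qed.

Lemma newton_comm W k : newton W k *m W = W *m newton W k.
Proof.
elim: k => [|k IH]; first by rewrite mulmx1 mul1mx.
by rewrite newtonS mulmxBl mulmxBr {1}IH mulmxA scalar_mxC.
Qed.

Lemma tr_newton_sym W k : W^T = W -> (newton W k)^T = newton W k.
Proof.
move=> Ws; elim: k => [|k IH]; first by rewrite trmx1.
by rewrite newtonS linearB /= tr_scalar_mx trmx_mul Ws IH newton_comm.
Qed.

Lemma mxtrace_newton W k : \tr (newton W k) = (n%:R - k%:R) * sigma W k.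
Proof.
case: k => [|k]; first by rewrite mxtrace1 subr0 mulr1.
by rewrite newtonS linearB /= mxtrace_scalar -sigmaS mulrBl !mulr_natl.
Qed.

Definition newton_slots k v w W (a : 'I_k.+1) : 'M[R]_n :=
  if a == ord0 then v *m w^T else W.
Arguments newton_slots : clear implicits.

Lemma sum_col_row W : W = \sum_(q < n) 1 *: (col q W *m (delta_mx q 0 : 'cV[R]_n)^T).
Proof.
apply/matrixP => i j; rewrite summxE (bigD1 j) //= big1 ?addr0 => [|q qj].
  by rewrite !mxE big_ord1 !mxE !eqxx /= !mulr1 mul1r.
by rewrite !mxE big_ord1 !mxE (negbTE (_ : j != q)) 1?eq_sym //= !mulr0.
Qed.

Lemma mixed_disc_newton_step k W :
  (forall v w, mixed_disc (newton_slots k v w W) =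
     k`!%:R * (w^T *m newton W k *m v) 0 0) ->
  mixed_disc (fun _ : 'I_k.+1 => W) = k.+1`!%:R * sigma W k.+1.
Proof.
move=> H.
rewrite (@eq_mixed_disc _ _ _ _ (with_slot ord0 (\sum_(q < n) 1 *: (col q W *m (delta_mx q 0 : 'cV[R]_n)^T)) (fun=> W))); last first.
  by move=> a; rewrite /with_slot -sum_col_row; case: eqP.
rewrite mixed_disc_slot_sum factS mulnC natrM -mulrA sigmaS /mxtrace mulr_sumr.
apply: eq_bigr => q _; rewrite mul1r.
rewrite (@eq_mixed_disc _ _ _ _ (newton_slots k (col q W) (delta_mx q 0) W)) //.
rewrite H; congr (_ * _).
rewrite trmx_delta -rowE !mxE; apply: eq_bigr => p _.
by rewrite !mxE.
Qed.

Lemma mixed_disc_slot_ord0 k W (X : 'M[R]_n) (a : 'I_k.+1) :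
  mixed_disc (with_slot a X (fun=> W)) = mixed_disc (with_slot (ord0 : 'I_k.+1) X (fun=> W)).
Proof.
rewrite -(mixed_disc_reindex _ (injF_bij (@perm_inj _ (tperm ord0 a)))).
apply: eq_mixed_disc => b; rewrite /with_slot /=; congr (if _ then _ else _).
by rewrite -{2}(tpermL ord0 a) (inj_eq perm_inj).
Qed.

(** Identifies the recursive matrices with contracted Kronecker deltas: the bordered
    expansion of the left side is the recursion that defines the right side. *)
Lemma mixed_disc_newton k W v w :
  mixed_disc (newton_slots k v w W) = k`!%:R * (w^T *m newton W k *m v) 0 0.
Proof.
elim: k v w => [|k IH] v w.
  rewrite (@mixed_disc_laplace _ _ _ v w) // big_ord0 subr0.
  rewrite mixed_disc_det (eq_bigr (fun=> 1)); last by move=> J _; rewrite det_mx00.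
  by rewrite sumr_const card_ffun !card_ord expn0 mulr1 mul1r mulmx1.
rewrite (@mixed_disc_laplace _ _ _ v w) //.
rewrite (@eq_mixed_disc _ _ _ _ (fun _ : 'I_k.+1 => W)); last first.
  by move=> a; rewrite /newton_slots eq_sym (negbTE (neq_lift _ _)).
rewrite (mixed_disc_newton_step IH).
rewrite (eq_bigr (fun=> k`!%:R * (w^T *m newton W k *m (W *m v)) 0 0)); last first.
  move=> b _; rewrite -IH -(mixed_disc_slot_ord0 W _ b).
  by apply: eq_mixed_disc => a; rewrite /with_slot /newton_slots !(eq_sym (lift _ _)) !(negbTE (neq_lift _ _)).
have -> : (w^T *m newton W k.+1 *m v) 0 0 = (w^T *m v) 0 0 * sigma W k.+1
    - (w^T *m newton W k *m (W *m v)) 0 0.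
  rewrite newtonS mulmxBr mulmxBl -!mulmxA mul_scalar_mx -scalemxAr.
  by rewrite [LHS]mxE [X in X + _]mxE [X in _ + X]mxE mulrC.
by rewrite sumr_const card_ord -[k.+2.-1]/k.+1 -[X in _ - X]mulr_natl factS natrM; ring.
Qed.

Lemma mixed_disc_const k W : mixed_disc (fun _ : 'I_k => W) = k`!%:R * sigma W k.
Proof.
case: k => [|k]; last by apply: mixed_disc_newton_step => v w; exact: mixed_disc_newton.
rewrite mixed_disc_det (eq_bigr (fun=> 1)); last by move=> J _; rewrite det_mx00.
by rewrite sumr_const card_ffun !card_ord expn0 mulr1.
Qed.

Lemma mixed_disc_slot_const k W (X : 'M[R]_n) (a : 'I_k.+1) :
  mixed_disc (with_slot a X (fun=> W)) = k`!%:R * \tr (newton W k *m X).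
Proof.
rewrite mixed_disc_slot_ord0.
rewrite {1}(sum_col_row X) mixed_disc_slot_sum /mxtrace mulr_sumr.
apply: eq_bigr => q _; rewrite mul1r.
rewrite (@eq_mixed_disc _ _ _ _ (newton_slots k (col q X) (delta_mx q 0) W)) //.
rewrite mixed_disc_newton; congr (_ * _).
rewrite trmx_delta -rowE !mxE; apply: eq_bigr => p _.
by rewrite !mxE.
Qed.

(** A contracted index of the Kronecker delta on [n] letters can take [n - r] values besides
    the [r] others. *)
Lemma mixed_disc_id r (M : 'I_r.+1 -> 'M[R]_n) : M ord0 = 1%:M ->
  mixed_disc M = (n%:R - r%:R) * mixed_disc (fun a => M (lift ord0 a)).
Proof.
move=> M0; set N := fun a => _.
rewrite (@eq_mixed_disc _ _ _ _ (with_slot ord0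
    (\sum_(q < n) 1 *: (col q 1%:M *m (delta_mx q 0 : 'cV[R]_n)^T)) M)); last first.
  by move=> a; rewrite /with_slot -sum_col_row; case: eqP => // ->.
rewrite mixed_disc_slot_sum.
have hN X : (fun a => with_slot ord0 X M (lift ord0 a)) = N.
  by apply/funext => a; rewrite /with_slot eq_sym (negbTE (neq_lift _ _)).
transitivity (\sum_(t < n) (mixed_disc N - \sum_(b < r) mixed_disc (with_slot b
    (N b *m col t 1%:M *m (delta_mx t 0 : 'cV[R]_n)^T) N))).
  apply: eq_bigr => t _.
  rewrite mul1r (@mixed_disc_laplace _ _ _ (col t 1%:M) (delta_mx t 0)) // hN.
  by rewrite trmx_delta -rowE !mxE eqxx mul1r.
rewrite big_split /= sumrN mulrBl; congr (_ - _).
  by rewrite sumr_const card_ord mulr_natl.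
rewrite exchange_big /= (eq_bigr (fun=> mixed_disc N)).
  by rewrite sumr_const card_ord mulr_natl.
move=> b _; rewrite -[in RHS](@eq_mixed_disc _ _ _ (with_slot b (N b) N)); last first.
  by move=> a; rewrite /with_slot; case: eqP => // ->.
rewrite [in RHS](sum_col_row (N b)) mixed_disc_slot_sum; apply: eq_bigr => q _.
rewrite mul1r; apply: eq_mixed_disc => a; rewrite /with_slot.
by case: eqP => [_|//]; rewrite !colE mul1mx.
Qed.

Definition posdef r (M : 'M[R]_r) := forall v : 'rV[R]_r, v != 0 -> 0 < (v *m M *m v^T) 0 0.

Lemma row_sq_gt0 r (v : 'rV[R]_r) : v != 0 -> 0 < (v *m v^T) 0 0.
Proof.
move=> v0; rewrite mxE lt_neqAle sumr_ge0 ?andbT; last first.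
  by move=> i _; rewrite mxE -expr2 sqr_ge0.
apply: contra v0; rewrite eq_sym psumr_eq0; last first.
  by move=> i _; rewrite mxE -expr2 sqr_ge0.
move/allP => H; apply/eqP/rowP => i; rewrite mxE.
by move: (H i (mem_index_enum _)); rewrite /= mxE -expr2 sqrf_eq0 => /eqP.
Qed.

(** Along the segment from the identity to [M] all matrices are positive definite, hence
    invertible, so the determinant cannot change sign. *)
Lemma det_posdef r (M : 'M[R]_r) : posdef M -> 0 < \det M.
Proof.
move=> Mp; rewrite ltNge; apply/negP => detM0.
pose p := \det ((1 - 'X)%:M + 'X *: map_mx polyC M : 'M[{poly R}]_r).
have pE t : p.[t] = \det ((1 - t)%:M + t *: M).
  rewrite /p -horner_evalE -det_map_mx map_mxD map_mxZ map_scalar_mx /= !horner_evalE.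
  rewrite !hornerE -map_mx_comp map_mx_id //.
  by move=> x; rewrite /= horner_evalE hornerC.
have [||t /andP[t0 t1]] := @poly_ivt _ (- p) 0 1.
- by [].
- rewrite 2!hornerN !pE !oppr_le0 oppr_ge0 subr0 scale0r addr0 det1 ler01.
  by rewrite subrr scale1r raddf0 add0r.
rewrite rootN rootE pE => /det0P[v v0 vA]; move: (row_sq_gt0 v0) (Mp v v0) => vv vM.
have : (v *m ((1 - t)%:M + t *: M) *m v^T) 0 0 = 0 by rewrite vA mul0mx mxE.
rewrite mulmxDr mulmxDl mul_mx_scalar -scalemxAl -scalemxAr -scalemxAl.
rewrite [LHS]mxE [X in X + _]mxE [X in _ + X]mxE => /eqP; apply/negP.
by rewrite gt_eqF //; nra.
Qed.

(** The terms are principal minors: positive for injective multi-indices, which exist as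
    [k <= n], and zero for the others. *)
Lemma mixed_disc_posdef k (M : 'M[R]_n) : (k <= n)%N -> posdef M ->
  0 < mixed_disc (fun _ : 'I_k => M).
Proof.
move=> kn Mp; rewrite mixed_disc_det.
have ge0 (J : {ffun 'I_k -> 'I_n}) : 0 <= \det (\matrix_(a, b) M (J b) (J a)) ?= iff ~~ injectiveb J.
  have [Jinj|/injectivePn[a [b ab Jab]]] := boolP (injectiveb J); last first.
    rewrite (_ : \det _ = 0); first by split; rewrite ?eqxx.
    by apply: (determinant_alternate ab) => c; rewrite !mxE Jab.
  suff D0 : 0 < \det (\matrix_(a, b) M (J b) (J a)) by split; [exact: ltW|rewrite lt_eqF].
  rewrite -det_tr; apply: det_posdef => v v0.
  pose v' : 'rV[R]_n := \row_i \sum_(a | J a == i) v 0 a.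
  have v'J a : v' 0 (J a) = v 0 a.
    rewrite mxE (big_pred1 a) // => b.
    by rewrite (inj_eq (injectiveP _ Jinj)).
  have sumJ (F : 'I_n -> R) : \sum_i v' 0 i * F i = \sum_a v 0 a * F (J a).
    transitivity (\sum_i \sum_(a | J a == i) v 0 a * F (J a)).
      apply: eq_bigr => i _; rewrite mxE mulr_suml.
      by apply: eq_bigr => a /eqP ->.
    by rewrite (exchange_big_dep predT) //=; apply: eq_bigr => a _; rewrite (big_pred1 (J a)) // => i; rewrite /= eq_sym.
  have v'0 : v' != 0.
    apply: contra v0 => /eqP v'0; apply/eqP/rowP => a.
    by rewrite -v'J v'0 !mxE.
  have := Mp _ v'0; congr (0 < _).
  rewrite !mxE; under eq_bigr do rewrite [in X in _ * X]mxE mulrC.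
  rewrite sumJ; apply: eq_bigr => a _; rewrite mulrC; congr (_ * _); last by rewrite mxE.
  by rewrite !mxE sumJ; apply: eq_bigr => b _; rewrite !mxE.
rewrite lt_def sumr_ge0 ?andbT; last by move=> J _; rewrite ge0.
rewrite psumr_eq0; last by move=> J _; rewrite ge0.
apply/negP => /allP H.
pose J := [ffun a => widen_ord kn a].
have := H J (mem_index_enum _); rewrite /= eq_sym ge0 => /negP; apply.
by apply/injectiveP => a b; rewrite !ffunE => /(congr1 val) /= /val_inj.
Qed.

(** Both objects are homogeneous of degree [k] in the entries of the matrix. *)
Lemma newton_bound k : exists2 C : R, 0 <= C & forall (W : 'M[R]_n) (e : R), 0 <= e ->
  (forall i j, `|W i j| <= e) ->
  `|sigma W k| <= C * e ^+ k /\ forall i j, `|newton W k i j| <= C * e ^+ k.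
Proof.
elim: k => [|k [C C0 IH]].
  exists 1 => // W e e0 We; rewrite expr0 mulr1; split; first by rewrite normr1.
  by move=> i j; rewrite mxE; case: eqP; rewrite ?normr1 ?normr0.
pose C' := n%:R * C; pose C'' := n%:R * C'.
have C'0 : 0 <= C' by rewrite mulr_ge0.
have C''0 : 0 <= C'' by rewrite mulr_ge0.
exists (C'' + C'); first by rewrite addr_ge0.
move=> W e e0 We; have [_ IHT] := IH W e e0 We.
have Tb i j : `|(newton W k *m W) i j| <= C' * e ^+ k.+1.
  rewrite mxE (le_trans (ler_norm_sum _ _ _)) //.
  apply: (@le_trans _ _ (\sum_(l < n) C * e ^+ k.+1)).
    apply: ler_sum => l _; rewrite normrM exprSr mulrA ler_pM //.
  by rewrite sumr_const card_ord -mulr_natl mulrA.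
have sb : `|sigma W k.+1| <= C'' * e ^+ k.+1.
  rewrite /sigma normrM normfV normr_nat ler_pdivrMr ?ltr0n //.
  apply: (@le_trans _ _ (C'' * e ^+ k.+1)).
    rewrite (le_trans (ler_norm_sum _ _ _)) //.
    apply: (@le_trans _ _ (\sum_(l < n) C' * e ^+ k.+1)).
      by apply: ler_sum => l _.
    by rewrite sumr_const card_ord -mulr_natl mulrA.
  by rewrite ler_peMr ?mulr_ge0 ?exprn_ge0 // ler1n.
have ek : 0 <= C' * e ^+ k.+1 by rewrite mulr_ge0 ?exprn_ge0.
split; first by rewrite mulrDl (le_trans sb) // lerDl.
move=> i j; rewrite newtonS mxE (le_trans (ler_normD _ _)) // mulrDl lerD //; last first.
  by rewrite [X in `|X|]mxE normrN.
rewrite mxE; case: eqP => _; first by rewrite mulr1n.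
by rewrite mulr0n normr0 mulr_ge0 ?exprn_ge0.
Qed.

End newton.

(** * Calculus of smooth functions of several variables *)

Section line_calculus.
Context {R : realType} {n : nat}.
Implicit Types (f g : 'rV[R]_n -> R) (x y v w : 'rV[R]_n) (t h : R).

(** Difference quotients in the direction [v] are those of the function restricted to a line,
    which brings directional derivatives back to one real variable. *)
Lemma line_quotient f x v t :
  (fun h => h^-1 *: (f ((h *: (1 : R^o) + t) *: v + x) - f (t *: v + x))) =
  (fun h => h^-1 *: (f (h *: v + (t *: v + x)) - f (t *: v + x))).
Proof. by apply/funext => h; rewrite [h *: 1]mulr1 scalerDl addrA. Qed.

Lemma is_derive_line f x v t df : is_derive (t *: v + x) v f df ->
  is_derive t (1 : R) (fun s : R => f (s *: v + x)) df.
Proof.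
move=> [fd fE]; split; first by rewrite /derivable line_quotient.
by rewrite -fE /derive line_quotient.
Qed.

Lemma is_derive_of_line f x v df :
  is_derive (0 : R) (1 : R) (fun s : R => f (s *: v + x)) df -> is_derive x v f df.
Proof.
move=> [fd fE]; have := line_quotient f x v 0; rewrite scale0r add0r => E.
split; first by move: fd; rewrite /derivable -E scale0r add0r.
by rewrite -fE /derive -E scale0r add0r.
Qed.

Lemma is_derive_comp1 (g : R -> R) f x v dg df :
  is_derive x v f df -> is_derive (f x) 1 g dg ->
  is_derive x v (fun y => g (f y)) (dg * df).
Proof.
move=> fd gd; apply: is_derive_of_line.
have fl : is_derive (0 : R) (1 : R) (fun s : R => f (s *: v + x)) df.
  by apply: is_derive_line; rewrite scale0r add0r.
have gl : is_derive (f (0 *: v + x)) (1 : R) g dg by rewrite scale0r add0r.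
exact: (@is_derive1_comp _ g (fun s => f (s *: v + x)) 0 dg df).
Qed.

Lemma is_derive_coord x v i : is_derive x v (fun y : 'rV[R]_n => y 0 i) (v 0 i).
Proof.
apply: is_derive_of_line.
rewrite (_ : (fun s : R => _) = (fun s : R => s * v 0 i + x 0 i)); last first.
  by apply/funext => s; rewrite !mxE.
by apply: is_derive_eq; rewrite scaler0 add0r addr0 [_ *: _]mulr1.
Qed.

Lemma derivable_line_continuous f x v :
  (forall y, derivable f y v) -> continuous (fun s : R => f (s *: v + x)).
Proof.
move=> df s; apply/differentiable_continuous/derivable1_diffP.
by have [] := is_derive_line (derivableP (df (s *: v + x))).
Qed.

Lemma line_MVT f x v h : (forall y, derivable f y v) ->
  exists2 c, `|c| <= `|h| & f (h *: v + x) - f x = h * 'D_v f (c *: v + x).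
Proof.
move=> df; set g := fun s : R => f (s *: v + x).
have gd s : is_derive s (1 : R) g ('D_v f (s *: v + x)).
  exact/is_derive_line/derivableP.
have gc := @derivable_line_continuous f x v df.
have g0 : g 0 = f x by rewrite /g scale0r add0r.
have [h0|h0] := leP 0 h.
  have [c + E] := MVT_segment h0 (fun s _ => gd s) (continuous_subspaceT gc).
  rewrite in_itv /= => /andP[c0 ch]; exists c; first by rewrite !ger0_norm.
  by move: E; rewrite g0 subr0 mulrC => <-.
have [c + E] := MVT_segment (ltW h0) (fun s _ => gd s) (continuous_subspaceT gc).
rewrite in_itv /= => /andP[ch c0]; exists c.
  by rewrite !ler0_norm // ?lerN2 // ltW.
move: E; rewrite g0 sub0r mulrN mulrC => /eqP.
by rewrite -eqr_oppLR opprB => /eqP <-.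
Qed.

(** The step of the chain rule for continuously differentiable functions: moving first along
    [v] and then along [w], the second increment is controlled by the mean value theorem. *)
Lemma is_deriveDv f x v w dv : is_derive x v f dv ->
  (forall y, derivable f y w) -> {for x, continuous ('D_w f)} ->
  is_derive x (v + w) f (dv + 'D_w f x).
Proof.
move=> [fv fvE] fw cw.
suff H : (fun h => h^-1 *: (f (h *: (v + w) + x) - f x)) @ 0^' --> dv + 'D_w f x.
  by split; [apply/cvg_ex; eexists; exact: H|exact/cvg_lim].
have H1 : (fun h => h^-1 *: (f (h *: v + x) - f x)) @ 0^' --> dv.
  by rewrite -fvE; exact: fv.
suff H2 : (fun h => h^-1 *: (f (h *: w + (h *: v + x)) - f (h *: v + x))) @ 0^' --> 'D_w f x.
  apply: cvg_trans (cvgD H1 H2); apply: near_eq_cvg; near=> h.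
  transitivity (h^-1 *: (f (h *: v + x) - f x) +
    h^-1 *: (f (h *: w + (h *: v + x)) - f (h *: v + x))) => //.
  by rewrite -scalerDr addrC subrKA [h *: (v + w)]scalerDr -addrA addrCA.
apply/cvgrPdist_le => e e0.
have /cvgrPdist_le/(_ _ e0)/nbhs_ballP[d /= d0 Hd] := cw.
have D0 : 0 < 1 + `|v| + `|w| by rewrite !ltr_wpDr.
near=> h.
have [c ch ->] := line_MVT (h *: v + x) h fw.
have h0 : h != 0 by near: h; exact: nbhs_dnbhs_neq.
rewrite scalerA mulVf // scale1r; apply: Hd.
rewrite mx_norm_ball /ball_ /=.
have -> : x - (c *: w + (h *: v + x)) = - (c *: w + h *: v).
  by rewrite [c *: w + _]addrA [in LHS]opprD [LHS]addrC subrK.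
rewrite normrN.
rewrite (le_lt_trans (ler_normD _ _)) // !normrZ.
have hd : `|h| < d / (1 + `|v| + `|w|).
  by near: h; apply: dnbhs0_lt; rewrite divr_gt0.
move: hd; rewrite ltr_pdivlMr //.
apply: le_lt_trans; rewrite !mulrDr mulr1.
have := ler_wpM2r (normr_ge0 w) ch; have := normr_ge0 h.
by lra.
Unshelve. all: by end_near. Qed.

Lemma is_deriveZv f x v c df : is_derive x v f df -> is_derive x (c *: v) f (c * df).
Proof.
move=> fd; apply: is_derive_of_line.
have fl : is_derive (c * 0) (1 : R) (fun s : R => f (s *: v + x)) df.
  by apply: is_derive_line; rewrite mulr0 scale0r add0r.
have cl : is_derive (0 : R) (1 : R) (fun s : R => c * s) c.
  by apply: is_derive_eq; rewrite [_ *: _]mulr1.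
have := @is_derive1_comp _ (fun s => f (s *: v + x)) (fun s => c * s) 0 df c fl cl.
rewrite mulrC; congr (is_derive _ _ _ _); apply/funext => s /=.
by rewrite scalerA mulrC.
Qed.

End line_calculus.

Section smooth_functions.
Context {R : realType} {n : nat}.
Implicit Types (f g : 'rV[R]_n -> R) (x y v w : 'rV[R]_n) (i j : 'I_n).

Lemma smooth_continuous f : smooth f -> continuous f.
Proof. by move=> sf; have [] := sf [::]. Qed.

Lemma smooth_derivable f i x : smooth f -> derivable f x 'e_i.
Proof. by move=> sf; have [_] := sf [::]. Qed.

Lemma smooth_pderiv f i : smooth f -> smooth (pderiv i f).
Proof. by move=> sf s; have := sf (rcons s i); rewrite foldr_rcons. Qed.

Lemma is_pderiv f i x : smooth f -> is_derive x 'e_i f (pderiv i f x).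
Proof. by move=> sf; apply/derivableP/smooth_derivable. Qed.

(** Closure of the smooth functions under algebra and the exponential. It is stable under partial
    derivatives, which proves all its members smooth without a formula for their
    iterated derivatives. *)
Inductive smooth_algebra : ('rV[R]_n -> R) -> Prop :=
| smooth_algebra_smooth f of smooth f : smooth_algebra f
| smooth_algebra_cst c : smooth_algebra (fun=> c)
| smooth_algebra_coord i : smooth_algebra (fun x => x 0 i)
| smooth_algebraD f g of smooth_algebra f & smooth_algebra g :
    smooth_algebra (fun x => f x + g x)
| smooth_algebraM f g of smooth_algebra f & smooth_algebra g :
    smooth_algebra (fun x => f x * g x)
| smooth_algebra_expR f of smooth_algebra f : smooth_algebra (fun x => expR (f x)).

Lemma is_derive_add f g x v df dg : is_derive x v f df -> is_derive x v g dg ->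
  is_derive x v (fun y => f y + g y) (df + dg).
Proof. by move=> ? ?; exact: is_deriveD. Qed.

Lemma is_derive_mul f g x v df dg : is_derive x v f df -> is_derive x v g dg ->
  is_derive x v (fun y => f y * g y) (f x * dg + df * g x).
Proof. by move=> fd gd; rewrite [df * g x]mulrC; exact: is_deriveM. Qed.

Lemma is_derive_exp f x v df : is_derive x v f df ->
  is_derive x v (fun y => expR (f y)) (expR (f x) * df).
Proof. by move=> fd; exact: is_derive_comp1. Qed.

Lemma smooth_algebra_C1 f : smooth_algebra f -> continuous f /\
  forall i, exists2 df, smooth_algebra df & forall x, is_derive x 'e_i f (df x).
Proof.
elim=> {f} [f sf|c|i|f g _ [cf df] _ [cg dg]|f g sf [cf df] sg [cg dg]|f sf [cf df]].
- split; first exact: smooth_continuous.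
  move=> i; exists (pderiv i f); first exact/smooth_algebra_smooth/smooth_pderiv.
  by move=> x; exact: is_pderiv.
- split; first exact: cst_continuous.
  by move=> i; exists (fun=> 0) => [|x]; [exact: smooth_algebra_cst|exact: is_derive_cst].
- split; first exact: coord_continuous.
  move=> j; exists (fun=> ('e_j : 'rV[R]_n) 0 i); first exact: smooth_algebra_cst.
  by move=> x; exact: is_derive_coord.
- split; first by move=> x; apply: continuousD; [exact: cf|exact: cg].
  move=> i; have [f' sf' fE] := df i; have [g' sg' gE] := dg i.
  by exists (fun x => f' x + g' x) => [|x]; [exact: smooth_algebraD|exact: is_derive_add].
- split; first by move=> x; apply: continuousM; [exact: cf|exact: cg].
  move=> i; have [f' sf' fE] := df i; have [g' sg' gE] := dg i.
  exists (fun x => f x * g' x + f' x * g x) => [|x]; last exact: is_derive_mul.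
  by apply: smooth_algebraD; apply: smooth_algebraM.
- split; first by move=> x; apply: continuous_comp; [exact: cf|exact: continuous_expR].
  move=> i; have [f' sf' fE] := df i.
  exists (fun x => expR (f x) * f' x) => [|x]; last exact: is_derive_exp.
  by apply: smooth_algebraM => //; exact: smooth_algebra_expR.
Qed.

Lemma pderiv_val f i df : (forall x, is_derive x 'e_i f (df x)) -> pderiv i f = df.
Proof. by move=> fE; apply/funext => x; exact: derive_val. Qed.

Lemma smooth_algebraP f : smooth_algebra f -> smooth f.
Proof.
move=> sf s /=; have : smooth_algebra (foldr pderiv f s).
  elim: s => [|i s IH] //=; have [_ /(_ i)[df sdf dfE]] := smooth_algebra_C1 IH.
  by rewrite (pderiv_val dfE).
move=> /smooth_algebra_C1[cs ds]; split=> // i x.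
by have [df _ /(_ x)[]] := ds i.
Qed.

Lemma smooth_cst c : smooth (fun _ : 'rV[R]_n => c).
Proof. exact/smooth_algebraP/smooth_algebra_cst. Qed.


Lemma smoothD f g : smooth f -> smooth g -> smooth (fun x => f x + g x).
Proof. by move=> ? ?; apply/smooth_algebraP/smooth_algebraD; exact: smooth_algebra_smooth. Qed.

Lemma smoothM f g : smooth f -> smooth g -> smooth (fun x => f x * g x).
Proof. by move=> ? ?; apply/smooth_algebraP/smooth_algebraM; exact: smooth_algebra_smooth. Qed.

Lemma smooth_expR f : smooth f -> smooth (fun x => expR (f x)).
Proof. by move=> ?; apply/smooth_algebraP/smooth_algebra_expR; exact: smooth_algebra_smooth. Qed.

Lemma smoothZ c f : smooth f -> smooth (fun x => c * f x).
Proof. by move=> sf; exact: smoothM (smooth_cst c) sf. Qed.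

Lemma smoothN f : smooth f -> smooth (fun x => - f x).
Proof.
move=> sf; rewrite (_ : (fun x => _) = (fun x => -1 * f x)); first exact: smoothZ.
by apply/funext => x; rewrite mulN1r.
Qed.

Lemma smoothB f g : smooth f -> smooth g -> smooth (fun x => f x - g x).
Proof. by move=> sf sg; exact: smoothD sf (smoothN sg). Qed.

Lemma smooth_sum (I : Type) (r : seq I) (P : pred I) (F : I -> 'rV[R]_n -> R) :
  (forall a, smooth (F a)) -> smooth (fun x => \sum_(a <- r | P a) F a x).
Proof.
move=> sF; elim: r => [|a r IH].
  rewrite (_ : (fun x => _) = (fun=> 0)); first exact: smooth_cst.
  by apply/funext => x; rewrite big_nil.
rewrite (_ : (fun x => _) = (fun x => (if P a then F a x else 0) + \sum_(a <- r | P a) F a x)).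
  by apply: smoothD IH; case: (P a); [exact: sF|exact: smooth_cst].
by apply/funext => x; rewrite big_cons; case: (P a); rewrite ?add0r.
Qed.

Lemma pderiv_cst i c : pderiv i (fun _ : 'rV[R]_n => c) = fun=> 0.
Proof. by apply: pderiv_val => x; exact: is_derive_cst. Qed.


Lemma pderivD i f g : smooth f -> smooth g ->
  pderiv i (fun x => f x + g x) = fun x => pderiv i f x + pderiv i g x.
Proof. by move=> ? ?; apply: pderiv_val => x; apply: is_derive_add; exact: is_pderiv. Qed.

Lemma pderivM i f g : smooth f -> smooth g ->
  pderiv i (fun x => f x * g x) = fun x => f x * pderiv i g x + pderiv i f x * g x.
Proof. by move=> ? ?; apply: pderiv_val => x; apply: is_derive_mul; exact: is_pderiv. Qed.

Lemma pderiv_expR i f : smooth f ->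
  pderiv i (fun x => expR (f x)) = fun x => expR (f x) * pderiv i f x.
Proof. by move=> ?; apply: pderiv_val => x; apply: is_derive_exp; exact: is_pderiv. Qed.

Lemma pderivZ i c f : smooth f ->
  pderiv i (fun x => c * f x) = fun x => c * pderiv i f x.
Proof.
move=> sf; rewrite (pderivM _ (smooth_cst c) sf).
by apply/funext => x; rewrite pderiv_cst mul0r addr0.
Qed.

Lemma pderivN i f : smooth f -> pderiv i (fun x => - f x) = fun x => - pderiv i f x.
Proof.
move=> sf; rewrite (_ : (fun x => - f x) = (fun x => -1 * f x)); last first.
  by apply/funext => x; rewrite mulN1r.
by rewrite pderivZ //; apply/funext => x; rewrite mulN1r.
Qed.

Lemma pderivB i f g : smooth f -> smooth g ->
  pderiv i (fun x => f x - g x) = fun x => pderiv i f x - pderiv i g x.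
Proof. by move=> sf sg; rewrite (pderivD _ sf (smoothN sg)) (pderivN _ sg). Qed.

Lemma pderiv_sum i (I : Type) (r : seq I) (P : pred I) (F : I -> 'rV[R]_n -> R) :
  (forall a, smooth (F a)) ->
  pderiv i (fun x => \sum_(a <- r | P a) F a x) = fun x => \sum_(a <- r | P a) pderiv i (F a) x.
Proof.
move=> sF; elim: r => [|a r IH].
  rewrite (_ : (fun x => _) = (fun=> 0)) ?pderiv_cst.
    by apply/funext => x; rewrite big_nil.
  by apply/funext => x; rewrite big_nil.
rewrite (_ : (fun x => \sum_(b <- a :: r | P b) F b x) = (fun x => (if P a then F a x else 0) + \sum_(b <- r | P b) F b x)).
  rewrite pderivD; [|by case: (P a) => //; exact: smooth_cst|exact: smooth_sum].
  apply/funext => x; rewrite IH big_cons; case: (P a) => //.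
  by rewrite pderiv_cst add0r.
by apply/funext => x; rewrite big_cons; case: (P a); rewrite ?add0r.
Qed.

Lemma is_derive_gradient f x v : smooth f ->
  is_derive x v f (\sum_i v 0 i * pderiv i f x).
Proof.
move=> sf; rewrite {1}(row_sum_delta v).
have scale_d i y : is_derive y (v 0 i *: 'e_i) f (v 0 i * pderiv i f y).
  by apply: is_deriveZv; exact: is_pderiv.
elim: (index_enum _) => [|i r IH].
  by rewrite !big_nil; exact: is_derive0.
rewrite !big_cons addrC [X in is_derive _ _ _ X]addrC.
have E : 'D_(v 0 i *: 'e_i) f = fun y => v 0 i * pderiv i f y.
  by apply/funext => y; exact: derive_val.
have <- : 'D_(v 0 i *: 'e_i) f x = v 0 i * pderiv i f x by exact: derive_val.
apply: is_deriveDv IH _ _; first by move=> y; have [] := scale_d i y.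
by rewrite E; exact/smooth_continuous/smoothZ/smooth_pderiv.
Qed.

Lemma is_derive_translate f x v w df : is_derive (w + x) v f df ->
  is_derive x v (fun y => f (w + y)) df.
Proof.
move=> fd; apply: is_derive_of_line.
rewrite (_ : (fun s : R => _) = fun s : R => f (s *: v + (w + x))).
  by apply: is_derive_line; rewrite scale0r add0r.
by apply/funext => s; rewrite addrCA.
Qed.

(** The mean value theorem, once in each direction. The second difference is symmetric in
    [i] and [j], whence the symmetry of second derivatives. *)
Lemma second_difference f i j x (h : R) : smooth f ->
  exists c d, [/\ `|c| <= `|h|, `|d| <= `|h| &
    (f (h *: 'e_j + (h *: 'e_i + x)) - f (h *: 'e_i + x)) - (f (h *: 'e_j + x) - f x) =
    h * (h * pderiv j (pderiv i f) (d *: 'e_j + (c *: 'e_i + x)))].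
Proof.
move=> sf; pose g y := f (h *: 'e_j + y) - f y.
have gd y : is_derive y 'e_i g (pderiv i f (h *: 'e_j + y) - pderiv i f y).
  by apply: is_deriveB; [apply: is_derive_translate|]; exact: is_pderiv.
have [c ch cE] : exists2 c, `|c| <= `|h| & g (h *: 'e_i + x) - g x = h * 'D_('e_i) g (c *: 'e_i + x).
  by apply: line_MVT => y; have [] := gd y.
have [d dh dE] : exists2 d, `|d| <= `|h| &
    pderiv i f (h *: 'e_j + (c *: 'e_i + x)) - pderiv i f (c *: 'e_i + x)
    = h * pderiv j (pderiv i f) (d *: 'e_j + (c *: 'e_i + x)).
  by apply: line_MVT => y; exact/smooth_derivable/smooth_pderiv.
exists c, d; split=> //; rewrite -dE -/(g x) -/(g (h *: 'e_i + x)) cE.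
by congr (_ * _); exact: derive_val.
Qed.

Lemma norm_sub_le_mid (a b c e : R) :
  `|a - c| <= e / 2 -> `|b - c| <= e / 2 -> `|b - a| <= e.
Proof.
move=> ac bc; rewrite (_ : b - a = (b - c) - (a - c)); last by ring.
by rewrite (le_trans (ler_normB _ _)) // [leRHS]splitr lerD.
Qed.

Lemma clairaut f i j : smooth f -> pderiv i (pderiv j f) = pderiv j (pderiv i f).
Proof.
move=> sf; apply/funext => x; apply/eqP; rewrite -subr_eq0 -normr_le0.
apply/ler_addgt0Pl => e e0; rewrite addr0.
pose close a b (h : R) := forall c d, `|c| <= `|h| -> `|d| <= `|h| ->
  `|pderiv b (pderiv a f) x - pderiv b (pderiv a f) (d *: 'e_b + (c *: 'e_a + x))| <= e / 2.
have near_x a b : exists2 r, 0 < r & forall h, 0 < h -> h < r -> close a b h.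
  have /(_ x) /cvgrPdist_le cf := @smooth_continuous _ (smooth_pderiv b (smooth_pderiv a sf)).
  have /cf/nbhs_ballP[r /= r0 Hr] : 0 < e / 2 by rewrite divr_gt0.
  have D0 : 0 < 1 + `|('e_a : 'rV[R]_n)| + `|('e_b : 'rV[R]_n)| by rewrite !ltr_wpDr.
  exists (r / (1 + `|('e_a : 'rV[R]_n)| + `|('e_b : 'rV[R]_n)|)); first by rewrite divr_gt0.
  move=> h h0 hr c d ch dh; apply: Hr; rewrite mx_norm_ball /ball_ /=.
  have -> : x - (d *: 'e_b + (c *: 'e_a + x)) = - (d *: 'e_b + c *: 'e_a).
    by rewrite [d *: _ + _]addrA [in LHS]opprD [LHS]addrC subrK.
  rewrite normrN (le_lt_trans (ler_normD _ _)) // !normrZ.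
  move: hr; rewrite ltr_pdivlMr //; apply: le_lt_trans.
  move: ch dh; rewrite (gtr0_norm h0) => ch dh; rewrite !mulrDr mulr1.
  have := ler_wpM2r (normr_ge0 ('e_a : 'rV[R]_n)) ch.
  have := ler_wpM2r (normr_ge0 ('e_b : 'rV[R]_n)) dh.
  by lra.
have [r1 r10 H1] := near_x i j; have [r2 r20 H2] := near_x j i.
pose h := Num.min r1 r2 / 2.
have h0 : 0 < h by rewrite divr_gt0 // lt_min r10.
have Hij := H1 h h0; have Hji := H2 h h0.
have hr1 : h < r1 by have : Num.min r1 r2 <= r1; [rewrite ge_min lexx|rewrite /h; lra].
have hr2 : h < r2 by have : Num.min r1 r2 <= r2; [rewrite ge_min lexx orbT|rewrite /h; lra].
move: Hij Hji => /(_ hr1) Hij /(_ hr2) Hji.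
have [c1 [d1 [c1h d1h E1]]] := second_difference i j x h sf.
have [c2 [d2 [c2h d2h E2]]] := second_difference j i x h sf.
have := Hij _ _ c1h d1h; have := Hji _ _ c2h d2h.
have key : pderiv j (pderiv i f) (d1 *: 'e_j + (c1 *: 'e_i + x)) =
          pderiv i (pderiv j f) (d2 *: 'e_i + (c2 *: 'e_j + x)).
  move: E1 E2; set X := pderiv j _ (_ + _); set Y := pderiv i _ (_ + _).
  clearbody X Y => E1 E2; have : h * (h * X) = h * (h * Y).
    by rewrite -E1 -E2 [h *: 'e_j + (h *: 'e_i + x)]addrCA; ring.
  by move=> /(mulfI (lt0r_neq0 h0)) /(mulfI (lt0r_neq0 h0)).
by rewrite key => K1 K2; exact: (norm_sub_le_mid K2 K1).
Qed.

(** If [g'' 0] were positive, [g'] would increase near 0 and [g] would exceed its value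
    at the maximum. *)
Lemma second_derivative_test (g g' g'' : R -> R) (d : R) : 0 < d ->
  (forall s, is_derive s (1 : R) g (g' s)) ->
  (forall s, is_derive s (1 : R) g' (g'' s)) ->
  {for 0, continuous g''} -> (forall s, `|s| < d -> g s <= g 0) ->
  g' 0 = 0 /\ g'' 0 <= 0.
Proof.
move=> d0 gd g'd cg'' gmax.
have cont (k k' : R -> R) : (forall s, is_derive s (1 : R) k (k' s)) -> continuous k.
  by move=> kd s; apply/differentiable_continuous/derivable1_diffP; have [] := kd s.
have g'0 : g' 0 = 0.
  have H : is_derive 0 (1 : R) g 0.
    apply: (@derive1_at_max _ g (- d) d).
    - by rewrite ge0_cp // ltW.
    - by move=> t _; have [] := gd t.
    - by rewrite in_itv /= oppr_lt0 d0.
    - by move=> t; rewrite in_itv /= -ltr_norml; exact: gmax.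
  by rewrite -(@derive_val _ _ _ _ _ _ _ (gd 0)) (@derive_val _ _ _ _ _ _ _ H).
split=> //; rewrite leNgt; apply/negP => g''0.
have : \forall s \near 0, 0 < g'' s by apply: cvgr_gt cg'' _ _.
move=> /nbhs_ballP[r /= r0 Hr].
pose s := Num.min d r / 2.
have s0 : 0 < s by rewrite divr_gt0 // lt_min d0.
have sd : s < d by have : Num.min d r <= d; [rewrite ge_min lexx|rewrite /s; lra].
have sr : s < r by have : Num.min d r <= r; [rewrite ge_min lexx orbT|rewrite /s; lra].
have [c] := MVT s0 (fun t _ => gd t) (continuous_subspaceT (cont _ _ gd)).
rewrite in_itv /= => /andP[c0 cs] cE.
have [e] := MVT c0 (fun t _ => g'd t) (continuous_subspaceT (cont _ _ g'd)).
rewrite in_itv /= => /andP[e0 ec] eE.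
have g''e : 0 < g'' e.
  by apply: Hr; rewrite /ball /= sub0r normrN gtr0_norm //; lra.
have := gmax s; rewrite gtr0_norm // => /(_ sd).
rewrite leNgt -subr_gt0 cE; move: eE; rewrite g'0 !subr0 => -> /negP; apply.
by apply: mulr_gt0 => //; apply: mulr_gt0.
Qed.

End smooth_functions.

(** * Contractions of Kulkarni-Nomizu products *)

Section contraction.
Context {R : realType} {n : nat}.
Implicit Types (W : 'M[R]_n).

Lemma gen_kronecker_tpermL r (I J : 'I_r -> 'I_n) a b : a != b ->
  gen_kronecker (I \o tperm a b) J = - gen_kronecker I J :> R.
Proof.
move=> ab; rewrite /gen_kronecker.
rewrite (_ : (\matrix_(c, d) _) = row_perm (tperm a b) (\matrix_(c < r, d < r) (I c == J d)%:R)); last first.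
  by apply/matrixP => c d; rewrite !mxE.
by rewrite row_permE det_mulmx det_perm odd_tperm ab expr1 mulN1r.
Qed.

Lemma gen_kronecker_tr r (I J : 'I_r -> 'I_n) :
  gen_kronecker I J = gen_kronecker J I :> R.
Proof.
rewrite /gen_kronecker -det_tr; congr (\det _); apply/matrixP => a b.
by rewrite !mxE eq_sym.
Qed.

Lemma gen_kronecker_tpermR r (I J : 'I_r -> 'I_n) a b : a != b ->
  gen_kronecker I (J \o tperm a b) = - gen_kronecker I J :> R.
Proof. by move=> ab; rewrite gen_kronecker_tr gen_kronecker_tpermL // gen_kronecker_tr. Qed.

Definition swap_idx r (I : {ffun 'I_r -> 'I_n}) a b : {ffun 'I_r -> 'I_n} :=
  [ffun c => I (tperm a b c)].

Definition kronecker_sum r (F : {ffun 'I_r -> 'I_n} -> {ffun 'I_r -> 'I_n} -> R) : R :=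
  \sum_(I : {ffun 'I_r -> 'I_n}) \sum_(J : {ffun 'I_r -> 'I_n})
    gen_kronecker I J * F I J.

Lemma swap_idxK r a b : involutive (fun I : {ffun 'I_r -> 'I_n} => swap_idx I a b).
Proof. by move=> I; apply/ffunP => c; rewrite !ffunE tpermK. Qed.

Lemma swap_idxE r (I : {ffun 'I_r -> 'I_n}) a b :
  swap_idx I a b = (I : 'I_r -> 'I_n) \o tperm a b :> ('I_r -> 'I_n).
Proof. by apply/funext => c; rewrite ffunE. Qed.

Lemma kronecker_sum_swapL r a b F : a != b ->
  kronecker_sum (fun I J => F (@swap_idx r I a b) J) = - kronecker_sum F.
Proof.
move=> ab; rewrite /kronecker_sum (reindex_inj (inv_inj (@swap_idxK r a b))) /= -sumrN.
apply: eq_bigr => I _; rewrite -sumrN; apply: eq_bigr => J _.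
by rewrite swap_idxK swap_idxE gen_kronecker_tpermL // mulNr.
Qed.

Lemma kronecker_sum_swapR r a b F : a != b ->
  kronecker_sum (fun I J => F I (@swap_idx r J a b)) = - kronecker_sum F.
Proof.
move=> ab; rewrite /kronecker_sum -sumrN; apply: eq_bigr => I _.
rewrite (reindex_inj (inv_inj (@swap_idxK r a b))) /= -sumrN; apply: eq_bigr => J _.
by rewrite swap_idxK swap_idxE gen_kronecker_tpermR // mulNr.
Qed.

Lemma eq_kronecker_sum r (F G : {ffun 'I_r -> 'I_n} -> {ffun 'I_r -> 'I_n} -> R) :
  (forall I J, F I J = G I J) -> kronecker_sum F = kronecker_sum G.
Proof. by move=> FG; apply: eq_bigr => I _; apply: eq_bigr => J _; rewrite FG. Qed.

Lemma kronecker_sumD r (F G : {ffun 'I_r -> 'I_n} -> {ffun 'I_r -> 'I_n} -> R) :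
  kronecker_sum (fun I J => F I J + G I J) = kronecker_sum F + kronecker_sum G.
Proof.
rewrite /kronecker_sum -big_split; apply: eq_bigr => I _ /=.
by rewrite -big_split; apply: eq_bigr => J _ /=; rewrite mulrDr.
Qed.

Lemma kronecker_sumZ r c (F : {ffun 'I_r -> 'I_n} -> {ffun 'I_r -> 'I_n} -> R) :
  kronecker_sum (fun I J => c * F I J) = c * kronecker_sum F.
Proof.
rewrite /kronecker_sum mulr_sumr; apply: eq_bigr => I _ /=.
by rewrite mulr_sumr; apply: eq_bigr => J _ /=; rewrite mulrCA.
Qed.

(** The Kulkarni-Nomizu product of [W] with the identity, the shape of the curvature tensor of a
    conformally flat metric. *)
Definition kn_product W (i j p q : 'I_n) : R :=
  W i p * (j == q)%:R + W j q * (i == p)%:R - W i q * (j == p)%:R - W j p * (i == q)%:R.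

(** By antisymmetry the four terms of the Kulkarni-Nomizu product contribute equally, so
    it may be replaced by four times [W] in one slot and the identity in the other. *)
Lemma kronecker_sum_kn1 r a b W E : a != b ->
  (forall I J, E (@swap_idx r I a b) J = E I J) ->
  (forall I J, E I (@swap_idx r J a b) = E I J) ->
  kronecker_sum (fun I J => kn_product W (I a) (I b) (J a) (J b) * E I J) =
  kronecker_sum (fun I J => 4 * (W (I a) (J a) * (I b == J b)%:R) * E I J).
Proof.
move=> ab El Er.
pose F (I J : {ffun 'I_r -> 'I_n}) : R := W (I a) (J a) * (I b == J b)%:R * E I J.
transitivity (kronecker_sum (fun I J => F I J + (F (swap_idx I a b) (swap_idx J a b)
   + (- 1 * F I (swap_idx J a b) + - 1 * F (swap_idx I a b) J)))).
  apply: eq_kronecker_sum => I J; rewrite /F /kn_product !Er !El !ffunE !tpermL !tpermR.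
  by ring.
rewrite !kronecker_sumD !kronecker_sumZ kronecker_sum_swapR // kronecker_sum_swapL //.
rewrite (kronecker_sum_swapL (fun I J => F I (swap_idx J a b))) // kronecker_sum_swapR //.
transitivity (kronecker_sum (fun I J => 4 * F I J)).
  by rewrite kronecker_sumZ; ring.
by apply: eq_kronecker_sum => I J; rewrite /F; ring.
Qed.

Lemma kronecker_sum_kn r k (f s : 'I_k -> 'I_r) W E :
  injective f -> injective s -> (forall a b, f a != s b) ->
  (forall a I J, E (@swap_idx r I (f a) (s a)) J = E I J) ->
  (forall a I J, E I (@swap_idx r J (f a) (s a)) = E I J) ->
  kronecker_sum (fun I J =>
    \prod_a kn_product W (I (f a)) (I (s a)) (J (f a)) (J (s a)) * E I J) =
  4 ^+ k * kronecker_sum (fun I J =>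
    \prod_a (W (I (f a)) (J (f a)) * (I (s a) == J (s a))%:R) * E I J).
Proof.
move=> finj sinj fs El Er.
pose Q (m : nat) (I J : {ffun 'I_r -> 'I_n}) (a : 'I_k) : R :=
  if (a < m)%N then 4 * (W (I (f a)) (J (f a)) * (I (s a) == J (s a))%:R)
  else kn_product W (I (f a)) (I (s a)) (J (f a)) (J (s a)).
have step m : (m <= k)%N ->
    kronecker_sum (fun I J => \prod_a Q 0 I J a * E I J) =
    kronecker_sum (fun I J => \prod_a Q m I J a * E I J).
  elim: m => [//|m IH mk]; rewrite IH; last exact: ltnW.
  pose a := Ordinal mk.
  pose E' (I J : {ffun 'I_r -> 'I_n}) := \prod_(b < k | b != a) Q m I J b * E I J.
  have sw (g : 'I_k -> 'I_r) (b : 'I_k) : b != a -> (g = f \/ g = s) ->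
      tperm (f a) (s a) (g b) = g b.
    move=> ba [->|->]; rewrite tpermD // ?fs // 1?eq_sym ?fs //.
      by rewrite (inj_eq finj).
    by rewrite (inj_eq sinj).
  transitivity (kronecker_sum (fun I J =>
      kn_product W (I (f a)) (I (s a)) (J (f a)) (J (s a)) * E' I J)).
    apply: eq_kronecker_sum => I J; rewrite (bigD1 a) //= /E' mulrA.
    by rewrite {1}/Q ltnn.
  rewrite kronecker_sum_kn1 //; last 2 first.
  - move=> I J; rewrite /E' El; congr (_ * _); apply: eq_bigr => b ba.
    by rewrite /Q !ffunE (sw f) ?(sw s) //; [right|left].
  - move=> I J; rewrite /E' Er; congr (_ * _); apply: eq_bigr => b ba.
    by rewrite /Q !ffunE (sw f) ?(sw s) //; [right|left].
  apply: eq_kronecker_sum => I J; rewrite [in RHS](bigD1 a) //= /E' mulrA; congr (_ * _ * _).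
    by rewrite /Q ltnSn.
  apply: eq_bigr => b ba; rewrite /Q ltnS [(b <= m)%N]leq_eqVlt.
  by rewrite (_ : (b == m :> nat) = false) //; apply/negbTE; apply: contra ba => /eqP ?; apply/eqP/val_inj.
transitivity (kronecker_sum (fun I J => \prod_a Q k I J a * E I J)).
  by rewrite -step.
rewrite -kronecker_sumZ; apply: eq_kronecker_sum => I J; rewrite mulrA; congr (_ * _).
rewrite (eq_bigr (fun a => 4 * (W (I (f a)) (J (f a)) * (I (s a) == J (s a))%:R))).
  by rewrite big_split /= prodr_const card_ord.
by move=> a _; rewrite /Q ltn_ord.
Qed.

(** The factor produced by contracting [j] identity slots out of [r + j]. *)
Definition id_factor (r j : nat) : R := \prod_(i < j) (n%:R - (r + i)%:R).

Lemma id_factor_gt0 r j : (r + j <= n)%N -> 0 < id_factor r j.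
Proof.
move=> rj; apply: prodr_gt0 => i _; rewrite subr_gt0 ltr_nat.
by apply: leq_trans rj; rewrite ltn_add2l.
Qed.

Lemma mixed_disc_ids j r (M : 'I_(j + r) -> 'M[R]_n) :
  (forall a, M (lshift r a) = 1%:M) ->
  mixed_disc M = id_factor r j * mixed_disc (fun a => M (rshift j a)).
Proof.
elim: j M => [|j IH] M MI.
  by rewrite /id_factor big_ord0 mul1r; apply: eq_mixed_disc => a; congr (M _); apply: val_inj.
have M0 : M (ord0 : 'I_(j + r).+1) = 1%:M.
  by rewrite -(MI ord0); congr (M _); apply: val_inj.
rewrite (@mixed_disc_id _ _ _ M M0) /id_factor big_ord_recr /= [X in _ = X * _]mulrC -mulrA addnC.
congr (_ * _); rewrite IH.
  congr (_ * _); apply: eq_mixed_disc => a; congr (M _); exact: val_inj.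
by move=> a; rewrite -(MI (lift ord0 a)); congr (M _); apply: val_inj.
Qed.

End contraction.

(** * Curvature of a conformally flat metric *)

#[global] Opaque pderiv.

Section conformal_curvature.
Context {R : realType} {n : nat}.
Variable u : 'rV[R]_n -> R.
Hypothesis su : smooth u.
Implicit Types (x : 'rV[R]_n) (i j l m p q : 'I_n).

Local Notation g := (conformally_flat u).
Local Notation du := (fun i => pderiv i u).
Local Notation ddu := (fun i j => pderiv i (pderiv j u)).

Definition grad_sq x : R := \sum_i pderiv i u x ^+ 2.

(** The Schouten tensor of [e^(-2u) delta] in Euclidean coordinates; it carries the whole curvature
    since the Weyl tensor vanishes. *)
Definition schouten x : 'M[R]_n := \matrix_(i, j)
  (pderiv i (pderiv j u) x + pderiv i u x * pderiv j u x
   - 2^-1 * grad_sq x * (i == j)%:R).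

Lemma sum_deltal (F : 'I_n -> R) i : \sum_p (i == p)%:R * F p = F i.
Proof.
rewrite (bigD1 i) //= eqxx mul1r big1 ?addr0 // => p pi.
by rewrite eq_sym (negbTE pi) mul0r.
Qed.

Lemma sum_deltar (F : 'I_n -> R) i : \sum_p (p == i)%:R * F p = F i.
Proof. by under eq_bigr do rewrite eq_sym; exact: sum_deltal. Qed.

Lemma metricE i j : (fun x => g x i j) = fun x => expR (- (2 * u x)) * (i == j)%:R.
Proof. by apply/funext => x; rewrite mxE mulr_natr. Qed.

Lemma ginvE i j x : ginv g i j x = expR (2 * u x) * (i == j)%:R.
Proof. by rewrite /ginv invmx_scalar mxE expRN invrK mulr_natr. Qed.

Lemma smooth2u : smooth (fun x => - (2 * u x)).
Proof. exact/smoothN/smoothZ. Qed.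

Lemma pderiv_metric l i j x :
  pderiv l (fun y => g y i j) x = - 2 * pderiv l u x * expR (- (2 * u x)) * (i == j)%:R.
Proof.
rewrite metricE (pderivM _ (smooth_expR smooth2u) (smooth_cst _)).
rewrite (pderiv_expR _ smooth2u) pderiv_cst (pderivN _ (smoothZ _ su)) (pderivZ _ _ su).
by ring.
Qed.

Lemma christoffelE k i j : christoffel g k i j = fun x =>
  pderiv k u x * (i == j)%:R - pderiv i u x * (j == k)%:R - pderiv j u x * (i == k)%:R.
Proof.
apply/funext => x; rewrite /christoffel.
under eq_bigr do rewrite ginvE !pderiv_metric -mulrA mulrCA.
rewrite sum_deltal expRN.
have : expR (2 * u x) != 0 by rewrite gt_eqF ?expR_gt0.
move: (expR _) ((j == k)%:R : R) ((i == k)%:R : R) ((i == j)%:R : R) => e d1 d2 d3 e0.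
move: (pderiv i u x) (pderiv j u x) (pderiv k u x) => ? ? ?.
by field.
Qed.

Lemma smooth_christoffel_term i (c : R) : smooth (fun x => pderiv i u x * c).
Proof. exact: smoothM (smooth_pderiv i su) (smooth_cst c). Qed.

Lemma pderiv_christoffel l k i j x : pderiv l (christoffel g k i j) x =
  pderiv l (pderiv k u) x * (i == j)%:R - pderiv l (pderiv i u) x * (j == k)%:R
  - pderiv l (pderiv j u) x * (i == k)%:R.
Proof.
have st := smooth_christoffel_term; rewrite christoffelE.
rewrite (pderivB _ (smoothB (st _ _) (st _ _)) (st _ _)) (pderivB _ (st _ _) (st _ _)).
have E a (c : R) : pderiv l (fun y => pderiv a u y * c) x = pderiv l (pderiv a u) x * c.
  by rewrite (pderivM _ (smooth_pderiv a su) (smooth_cst c)) pderiv_cst mulr0 add0r.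
by rewrite !E.
Qed.

Lemma quad_delta (dl : 'I_n -> 'I_n -> R) (a : 'I_n -> R) k l i j :
  (forall F p, \sum_q dl p q * F q = F p) -> (forall p q, dl p q = dl q p) ->
  \sum_p (a k * dl i p - a i * dl p k - a p * dl i k) *
         (a p * dl j l - a j * dl l p - a l * dl j p) =
  - (a k * a j * dl i l) - a k * a l * dl i j + a i * a j * dl k l
  + a i * a l * dl j k - (\sum_p a p ^+ 2) * dl i k * dl j l + 2 * a j * a l * dl i k.
Proof.
move=> dlE dls.
pose F p := a p * dl j l - a j * dl l p - a l * dl j p.
transitivity (\sum_p (dl i p * (a k * F p) - dl k p * (a i * F p)
   - (dl i k * dl j l * a p ^+ 2
      - dl l p * (dl i k * a p * a j) - dl j p * (dl i k * a p * a l)))).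
  by apply: eq_bigr => p _; rewrite /F (dls k p); ring.
rewrite !big_split /= !sumrN !big_split /= !sumrN !dlE -mulr_sumr /F.
by rewrite (dls l i) (dls j i) (dls l k); ring.
Qed.

(** The formula for the Riemann tensor as a polynomial identity in the Hessian [h], the gradient [a]
    and the Kronecker delta [dl], kept apart from the derivatives. *)
Lemma curvature_delta (dl h : 'I_n -> 'I_n -> R) (a : 'I_n -> R) (N : R) k l i j :
  (forall p q, dl p q = dl q p) -> (forall p q, h p q = h q p) ->
  let Q i j := - (a k * a j * dl i l) - a k * a l * dl i j + a i * a j * dl k l
    + a i * a l * dl j k - N * dl i k * dl j l + 2 * a j * a l * dl i k in
  let W i j := h i j + a i * a j - 2^-1 * N * dl i j in
  (h i k * dl j l - h i j * dl l k - h i l * dl j k)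
  - (h j k * dl i l - h j i * dl l k - h j l * dl i k) + (Q i j - Q j i)
  = W i k * dl j l + W j l * dl i k - W i l * dl j k - W j k * dl i l.
Proof. by move=> dls hs Q W; rewrite /Q /W (dls l k) (dls j i) (hs j i); field. Qed.

Lemma riemannE k l i j x : riemann g k l i j x = kn_product (schouten x) i j k l.
Proof.
pose dl (p q : 'I_n) : R := (p == q)%:R.
have dls p q : dl p q = dl q p by rewrite /dl eq_sym.
have hs p q : pderiv p (pderiv q u) x = pderiv q (pderiv p u) x by rewrite clairaut.
have E i' j' : \sum_p christoffel g k i' p x * christoffel g p j' l x = _ :=
  etrans (eq_bigr _ (fun p _ => congr2 *%R (congr1 (@^~ x) (christoffelE k i' p))
                                      (congr1 (@^~ x) (christoffelE p j' l))))
    (quad_delta (fun q => pderiv q u x) k l i' j' (fun F p => sum_deltal F p) dls).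
rewrite /riemann !pderiv_christoffel big_split /= sumrN !E /kn_product !mxE.
exact: (curvature_delta (fun q => pderiv q u x) (grad_sq x) k l i j dls hs).
Qed.

Lemma riemann_upE i j k l x :
  riemann_up g i j k l x = expR (2 * u x) * kn_product (schouten x) i j k l.
Proof.
rewrite /riemann_up; under eq_bigr do rewrite ginvE riemannE -mulrA mulrCA.
by rewrite sum_deltal.
Qed.

End conformal_curvature.

(** * Gauss-Bonnet curvatures and mass integrand in terms of the Schouten matrix *)

Section gauss_bonnet_sigma.
Context {R : realType} {n : nat}.

(** Splits the [2k] positions of a Kronecker delta into the second members of the pairs, which
    will carry identity matrices, followed by the first members, which will carry [W]. *)
Definition pair_slot k (c : 'I_(k + k)) : 'I_k.*2 :=
  match fintype.split c with inl b => snd_slot b | inr b => fst_slot b end.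

Lemma pair_slotl k (b : 'I_k) : pair_slot (lshift k b) = snd_slot b.
Proof. by rewrite /pair_slot (unsplitK (inl b)). Qed.

Lemma pair_slotr k (b : 'I_k) : pair_slot (rshift k b) = fst_slot b.
Proof. by rewrite /pair_slot (unsplitK (inr b)). Qed.

Lemma fst_slot_inj k : injective (@fst_slot k).
Proof. by move=> a b /(congr1 val) /= /double_inj /val_inj. Qed.

Lemma snd_slot_inj k : injective (@snd_slot k).
Proof. by move=> a b /(congr1 val) /= [] /double_inj /val_inj. Qed.

Lemma fst_neq_snd_slot k (a b : 'I_k) : fst_slot a != snd_slot b.
Proof.
apply/eqP => /(congr1 (odd \o val)) /=.
by rewrite !odd_double.
Qed.

Lemma pair_slot_bij k : bijective (@pair_slot k).
Proof.
apply: inj_card_bij; last by rewrite !card_ord addnn.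
move=> c d; rewrite -(splitK c) -(splitK d).
case: (fintype.split c) => a; case: (fintype.split d) => b /=;
  rewrite ?pair_slotl ?pair_slotr.
- by move=> /snd_slot_inj ->.
- by move=> /esym/eqP; rewrite (negbTE (fst_neq_snd_slot _ _)).
- by move=> /eqP; rewrite (negbTE (fst_neq_snd_slot _ _)).
- by move=> /fst_slot_inj ->.
Qed.

Lemma kronecker_sum_reindex r s (h : 'I_r -> 'I_s) (M : 'I_r -> 'M[R]_n) : bijective h ->
  kronecker_sum (fun I J => \prod_c M c (I (h c)) (J (h c))) = mixed_disc M.
Proof.
move=> hb; have [g hK gK] := hb.
rewrite (@eq_mixed_disc _ _ _ M ((M \o g) \o h)); last by move=> a /=; rewrite hK.
rewrite (mixed_disc_reindex _ hb); apply: eq_kronecker_sum => I J.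
rewrite [RHS](reindex h); last exact: onW_bij.
by apply: eq_bigr => c _ /=; rewrite hK.
Qed.

Variable u : 'rV[R]_n -> R.
Hypothesis su : smooth u.
Local Notation g := (conformally_flat u).

Definition gb_coef k : R := 2 ^- k * 4 ^+ k * @id_factor R n k k * k`!%:R.

Lemma gb_coef_gt0 k : (k.*2 <= n)%N -> 0 < gb_coef k.
Proof.
move=> kn; rewrite /gb_coef !mulr_gt0 ?invr_gt0 ?exprn_gt0 ?ltr0n ?fact_gt0 //.
by apply: id_factor_gt0; rewrite addnn.
Qed.

(** Each curvature factor reduces to [W] and an identity; contracting the identities leaves the
    mixed discriminant of [k] copies of [W]. *)
Lemma gauss_bonnetE k x :
  gauss_bonnet g k x = gb_coef k * expR (2 * u x) ^+ k * sigma (schouten u x) k.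
Proof.
rewrite /gauss_bonnet; set e := expR _; set W := schouten u x.
transitivity (2 ^- k * kronecker_sum (fun I J : {ffun 'I_k.*2 -> 'I_n} => e ^+ k *
   (\prod_a kn_product W (I (fst_slot a)) (I (snd_slot a)) (J (fst_slot a)) (J (snd_slot a)) * 1))).
  congr (_ * _); apply: eq_bigr => I _; apply: eq_bigr => J _; congr (_ * _).
  rewrite /riemann_prod (eq_bigr _ (fun a _ => riemann_upE su _ _ _ _ x)).
  by rewrite big_split /= prodr_const card_ord mulr1.
rewrite kronecker_sumZ kronecker_sum_kn //; last first.
- exact: fst_neq_snd_slot.
- exact: snd_slot_inj.
- exact: fst_slot_inj.
pose M (c : 'I_(k + k)) : 'M[R]_n := match fintype.split c with inl _ => 1%:M | inr _ => W end.
have Ml b : M (lshift k b) = 1%:M by rewrite /M (unsplitK (inl b)).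
have Mr b : M (rshift k b) = W by rewrite /M (unsplitK (inr b)).
rewrite (_ : kronecker_sum _ = mixed_disc M).
  rewrite (mixed_disc_ids Ml) (@eq_mixed_disc _ _ _ _ (fun=> W)) ?mixed_disc_const; last exact: Mr.
  by rewrite /gb_coef; ring.
rewrite -(kronecker_sum_reindex _ (@pair_slot_bij k)); apply: eq_kronecker_sum => I J.
rewrite mulr1 big_split_ord /= big_split /= mulrC; congr (_ * _).
  by apply: eq_bigr => b _; rewrite pair_slotl Ml mxE.
by apply: eq_bigr => b _; rewrite pair_slotr Mr.
Qed.

(** Moves the contraction with the metric inside the sums over multi-indices. *)
Lemma contract_sums (Y L : finType) (c : R) (A : Y -> R) (B C : Y -> L -> R) (D : L -> L -> R) :
  \sum_l \sum_m (c * \sum_y A y * B y l * C y m) * D l m =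
  c * \sum_y A y * (\sum_l \sum_m B y l * C y m * D l m).
Proof.
transitivity (\sum_l \sum_m \sum_y c * (A y * (B y l * C y m * D l m))).
  apply: eq_bigr => l _; apply: eq_bigr => m _.
  rewrite mulr_sumr mulr_suml; apply: eq_bigr => y _; ring.
transitivity (\sum_l \sum_y \sum_m c * (A y * (B y l * C y m * D l m))).
  by apply: eq_bigr => l _; exact: exchange_big.
rewrite exchange_big /= mulr_sumr; apply: eq_bigr => y _.
rewrite !mulr_sumr; apply: eq_bigr => l _; rewrite !mulr_sumr.
by apply: eq_bigr => m _.
Qed.

Lemma sum_extend2 r (G : ('I_(r + 2) -> 'I_n) -> R) :
  \sum_(K : {ffun 'I_(r + 2) -> 'I_n}) G K =
  \sum_(I : {ffun 'I_r -> 'I_n}) \sum_s \sum_t G (extend2 I s t).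
Proof.
pose T := ({ffun 'I_r -> 'I_n} * ('I_n * 'I_n))%type.
pose ext (p : T) : {ffun 'I_(r + 2) -> 'I_n} := [ffun a => extend2 p.1 p.2.1 p.2.2 a].
pose res (K : {ffun 'I_(r + 2) -> 'I_n}) : T :=
  ([ffun a => K (lshift 2 a)], (K (rshift r ord0), K (rshift r (lift ord0 ord0)))).
have extK : cancel ext res.
  move=> [I [s t]]; rewrite /res /ext; congr (_, (_, _)).
  - by apply/ffunP => a; rewrite !ffunE /extend2 (unsplitK (inl a)).
  - by rewrite ffunE /extend2 (unsplitK (inr _)).
  - by rewrite ffunE /extend2 (unsplitK (inr _)).
have resK : cancel res ext.
  move=> K; apply/ffunP => a; rewrite ffunE /extend2 -{2}(splitK a).
  case: (fintype.split a) => [b|b] /=; first by rewrite ffunE.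
  case: (eqVneq b ord0) => [->//|b0]; congr (K (rshift r _)).
  by case: (unliftP ord0 b) b0 => [c ->|->]; rewrite ?eqxx // ord1.
rewrite (reindex ext); last by apply: onW_bij; exists res.
under [RHS]eq_bigr do rewrite pair_big.
rewrite pair_big /=; apply: eq_bigr => -[I [s t]] _; congr G.
by apply/funext => a; rewrite ffunE.
Qed.

Definition flux_coef k : R := 2 * 2 ^- k.+1 * 4 ^+ k * @id_factor R n k.+1 k.+1 * k`!%:R.

Lemma flux_coef_gt0 k : (k.+1.*2 <= n)%N -> 0 < flux_coef k.
Proof.
move=> kn; rewrite /flux_coef !mulr_gt0 ?invr_gt0 ?exprn_gt0 ?ltr0n ?fact_gt0 //.
by apply: id_factor_gt0; rewrite addnn.
Qed.

Lemma sum_metric_flux (q p i j : 'I_n) (nu : 'I_n -> R) x :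
  \sum_l \sum_m ginv g p l x * ginv g q m x *
     (pderiv m (fun y => g y j l) x * nu i) =
  - 2 * expR (2 * u x) * (pderiv q u x * nu i * (j == p)%:R).
Proof.
transitivity (\sum_l (p == l)%:R * (\sum_m (q == m)%:R *
    (expR (2 * u x) ^+ 2 * (- 2 * pderiv m u x * expR (- (2 * u x)) * (j == l)%:R * nu i)))).
  apply: eq_bigr => l _; rewrite mulr_sumr; apply: eq_bigr => m _.
  rewrite !ginvE (pderiv_metric su); move: (expR _) (expR _) ((p == l)%:R : R) ((q == m)%:R : R).
  by move=> ? ? ? ?; ring.
rewrite sum_deltal sum_deltal expRN.
have : expR (2 * u x) != 0 by rewrite gt_eqF ?expR_gt0.
move: (expR _) ((j == p)%:R : R) (pderiv q u x) => e d1 d2 e0.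
by field.
Qed.

(** The derivative of the metric is [-2 du] times the metric, so the last two slots carry the rank one
    matrix of [nu] and [du]; contracting the identities gives [T_k] applied to the gradient. *)
Lemma fluxE k (nu : 'I_n -> R) x :
  \sum_i \sum_j \sum_l \sum_m
    gb_tensor g k.+1 i j l m x * pderiv m (fun y => g y j l) x * nu i =
  flux_coef k * expR (2 * u x) ^+ k.+1 *
    \tr (newton (schouten u x) k *m \matrix_(i, q) (nu i * pderiv q u x)).
Proof.
set e := expR _; set W := schouten u x.
pose r := k.*2.
pose E (K L : 'I_(r + 2) -> 'I_n) : R :=
  pderiv (L (rshift r (lift ord0 ord0))) u x * nu (K (rshift r ord0)) *
  (K (rshift r (lift ord0 ord0)) == L (rshift r ord0))%:R.
pose f (a : 'I_k) : 'I_(r + 2) := lshift 2 (fst_slot a).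
pose s (a : 'I_k) : 'I_(r + 2) := lshift 2 (snd_slot a).
pose P (K L : 'I_(r + 2) -> 'I_n) : R :=
  \prod_a kn_product W (K (f a)) (K (s a)) (L (f a)) (L (s a)).
have ext_l (I : 'I_r -> 'I_n) s' t' a : extend2 I s' t' (lshift 2 a) = I a.
  by rewrite /extend2 (unsplitK (inl a)).
have ext_0 (I : 'I_r -> 'I_n) s' t' : extend2 I s' t' (rshift r ord0) = s'.
  by rewrite /extend2 (unsplitK (inr _)).
have ext_1 (I : 'I_r -> 'I_n) s' t' : extend2 I s' t' (rshift r (lift ord0 ord0)) = t'.
  by rewrite /extend2 (unsplitK (inr _)).
transitivity (2 ^- k.+1 * (- 2 * e * (e ^+ k *
    kronecker_sum (fun K L : {ffun 'I_(r + 2) -> 'I_n} => P K L * E K L)))).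
  pose Y := ({ffun 'I_r -> 'I_n} * ({ffun 'I_r -> 'I_n} * ('I_n * 'I_n)))%type.
  transitivity (\sum_i \sum_j 2 ^- k.+1 * \sum_(I : {ffun 'I_r -> 'I_n})
     \sum_(J : {ffun 'I_r -> 'I_n}) \sum_p \sum_q
     (- 2 * e * e ^+ k) * (gen_kronecker (extend2 I i j) (extend2 J p q) *
       (P (extend2 I i j) (extend2 J p q) * E (extend2 I i j) (extend2 J p q)))).
    apply: eq_bigr => i _; apply: eq_bigr => j _.
    pose A (y : Y) : R := gen_kronecker (extend2 y.1 i j) (extend2 y.2.1 y.2.2.1 y.2.2.2) *
      riemann_prod g (k := k) y.1 y.2.1 x.
    pose B (y : Y) l := ginv g y.2.2.1 l x.
    pose C (y : Y) m := ginv g y.2.2.2 m x.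
    pose D l m := pderiv m (fun y => g y j l) x * nu i.
    transitivity (\sum_l \sum_m (2 ^- k.+1 * \sum_y A y * B y l * C y m) * D l m).
      apply: eq_bigr => l _; apply: eq_bigr => m _; rewrite -mulrA; congr (_ * _).
      rewrite /gb_tensor; congr (_ * _).
      rewrite -(pair_big predT predT (fun I z => A (I, z) * B (I, z) l * C (I, z) m)) /=.
      apply: eq_bigr => I _.
      rewrite -(pair_big predT predT (fun J z => A (I, (J, z)) * B (I, (J, z)) l * C (I, (J, z)) m)) /=.
      apply: eq_bigr => J _.
      by rewrite -(pair_big predT predT (fun p q => A (I, (J, (p, q))) * B (I, (J, (p, q))) l * C (I, (J, (p, q))) m)).
    rewrite contract_sums; congr (_ * _).
    rewrite -(pair_big predT predT (fun I z => A (I, z) * (\sum_l \sum_m B (I, z) l * C (I, z) m * D l m))) /=.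
    apply: eq_bigr => I _.
    rewrite -(pair_big predT predT (fun J z => A (I, (J, z)) * (\sum_l \sum_m B (I, (J, z)) l * C (I, (J, z)) m * D l m))) /=.
    apply: eq_bigr => J _.
    rewrite -(pair_big predT predT (fun p q => A (I, (J, (p, q))) * (\sum_l \sum_m B (I, (J, (p, q))) l * C (I, (J, (p, q))) m * D l m))) /=.
    apply: eq_bigr => p _; apply: eq_bigr => q _.
    have PE : P (extend2 I i j) (extend2 J p q) = \prod_(a < k)
        kn_product W (I (fst_slot a)) (I (snd_slot a)) (J (fst_slot a)) (J (snd_slot a)).
      by apply: eq_bigr => a _; rewrite /f /s !ext_l.
    rewrite /B /C /D /= sum_metric_flux /A /= -/e.
    rewrite /riemann_prod (eq_bigr _ (fun a _ => riemann_upE su _ _ _ _ x)) big_split /=.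
    rewrite prodr_const card_ord -/e -PE /E !ext_0 !ext_1.
    by move: (gen_kronecker _ _) (P _ _) ((j == p)%:R : R) (e ^+ k) => ? ? ? ?; ring.
  under eq_bigr do rewrite -mulr_sumr.
  rewrite -mulr_sumr; congr (_ * _).
  rewrite /kronecker_sum (sum_extend2 (fun K => \sum_(L : {ffun 'I_(r + 2) -> 'I_n}) gen_kronecker K L * (P K L * E K L))).
  transitivity (\sum_i \sum_(I : {ffun 'I_r -> 'I_n}) \sum_j
     \sum_(J : {ffun 'I_r -> 'I_n}) \sum_p \sum_q
     (- 2 * e * e ^+ k) * (gen_kronecker (extend2 I i j) (extend2 J p q) *
       (P (extend2 I i j) (extend2 J p q) * E (extend2 I i j) (extend2 J p q)))).
    by apply: eq_bigr => i _; exact: exchange_big.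
  rewrite exchange_big /= mulrA mulr_sumr; apply: eq_bigr => I _.
  rewrite mulr_sumr; apply: eq_bigr => i _.
  rewrite mulr_sumr; apply: eq_bigr => j _.
  rewrite (sum_extend2 (fun L => gen_kronecker (extend2 I i j) L * (P (extend2 I i j) L * E (extend2 I i j) L))).
  rewrite mulr_sumr; apply: eq_bigr => J _.
  rewrite mulr_sumr; apply: eq_bigr => p _.
  by rewrite mulr_sumr; apply: eq_bigr => q _.
pose a0 : 'I_(r + 2) := rshift r ord0.
pose a1 : 'I_(r + 2) := rshift r (lift ord0 ord0).
have a01 : a0 != a1 by rewrite /a0 /a1 (inj_eq (@rshift_inj _ _)).
have low (a : 'I_r) (b : 'I_2) : lshift 2 a != rshift r b.
  by rewrite -val_eqE /= ltn_eqF // (leq_trans (ltn_ord a)) // leq_addr.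
have fs a b : f a != s b by rewrite (inj_eq (@lshift_inj _ _)) fst_neq_snd_slot.
have swap_top (K : {ffun 'I_(r + 2) -> 'I_n}) a b : swap_idx K (f a) (s a) (rshift r b) = K (rshift r b).
  by rewrite ffunE tpermD; [|exact: low|exact: low].
have swap_low (K : {ffun 'I_(r + 2) -> 'I_n}) c : swap_idx K a0 a1 (lshift 2 c) = K (lshift 2 c).
  by rewrite ffunE tpermD; [|rewrite eq_sym; exact: low|rewrite eq_sym; exact: low].
rewrite (@kronecker_sum_kn _ _ _ _ f s W (fun K L => E K L)) //; first last.
- by move=> a K L; rewrite /E !swap_top.
- by move=> a K L; rewrite /E !swap_top.
- by move=> a b /lshift_inj /snd_slot_inj.
- by move=> a b /lshift_inj /fst_slot_inj.
pose X : 'M[R]_n := \matrix_(i, q) (nu i * pderiv q u x).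
pose M (c : 'I_(k.+1 + k.+1)) : 'M[R]_n :=
  match fintype.split c with inl _ => 1%:M | inr b => with_slot ord_max X (fun=> W) b end.
have Ml b : M (lshift k.+1 b) = 1%:M by rewrite /M (unsplitK (inl b)).
have Mr b : M (rshift k.+1 b) = with_slot ord_max X (fun=> W) b by rewrite /M (unsplitK (inr b)).
have er : (k.+1).*2 = (r + 2)%N by rewrite doubleS addn2.
pose h c : 'I_(r + 2) := cast_ord er (@pair_slot k.+1 c).
have hb : bijective h.
  have [h' hK h'K] := @pair_slot_bij k.+1.
  by exists (fun d => h' (cast_ord (esym er) d)) => d; rewrite /h ?cast_ordK ?hK ?h'K ?cast_ordKV.
pose F (K L : {ffun 'I_(r + 2) -> 'I_n}) : R :=
  \prod_a (W (K (f a)) (L (f a)) * (K (s a) == L (s a))%:R) *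
  (pderiv (L a0) u x * nu (K a0) * (K a1 == L a1)%:R).
have -> : kronecker_sum (fun K L : {ffun 'I_(r + 2) -> 'I_n} =>
    \prod_a (W (K (f a)) (L (f a)) * (K (s a) == L (s a))%:R) * E K L) = - mixed_disc M.
  transitivity (kronecker_sum (fun K L => F K (swap_idx L a0 a1))).
    apply: eq_kronecker_sum => K L; rewrite /F /E ![swap_idx _ _ _ a0]ffunE ![swap_idx _ _ _ a1]ffunE.
    rewrite tpermL tpermR; congr (_ * _); apply: eq_bigr => a _.
    by rewrite /f /s !swap_low.
  rewrite kronecker_sum_swapR //; congr (- _).
  rewrite -(kronecker_sum_reindex _ hb); apply: eq_kronecker_sum => K L.
  rewrite /F big_split_ord /= !big_ord_recr /= big_split /=.
  have hl (b : 'I_k) : h (lshift k.+1 (widen_ord (leqnSn k) b)) = s b.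
    by rewrite /h pair_slotl; apply: val_inj.
  have hr (b : 'I_k) : h (rshift k.+1 (widen_ord (leqnSn k) b)) = f b.
    by rewrite /h pair_slotr; apply: val_inj.
  have h0 : h (rshift k.+1 ord_max) = a0.
    by rewrite /h pair_slotr; apply: val_inj; rewrite /= addn0.
  have h1 : h (lshift k.+1 ord_max) = a1.
    by rewrite /h pair_slotl; apply: val_inj; rewrite /= addn1.
  rewrite h0 h1 Ml Mr /with_slot eqxx !mxE.
  rewrite [in RHS](eq_bigr (fun b => (K (s b) == L (s b))%:R)); last first.
    by move=> b _; rewrite hl Ml mxE.
  rewrite [X in _ = _ * (X * _)](eq_bigr (fun b => W (K (f b)) (L (f b)))); last first.
    move=> b _; rewrite hr Mr /with_slot (_ : _ == ord_max = false) //.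
    by apply/negbTE; rewrite -val_eqE /= ltn_eqF.
  by move: ((K a1 == L a1)%:R : R) (\prod_(_ < _) _) (\prod_(_ < _) _) => ? ? ?; ring.
rewrite (mixed_disc_ids Ml) (@eq_mixed_disc _ _ _ _ (with_slot ord_max X (fun=> W))) //.
rewrite mixed_disc_slot_const /flux_coef [e ^+ k.+1]exprS.
by move: (\tr _) (id_factor _ _) (e ^+ k) (2 ^- k.+1) (k`!%:R : R) => ? ? ? ? ?; ring.
Qed.

End gauss_bonnet_sigma.

(** * The divergence identity *)

Section divergence_identity.
Context {R : realType} {n : nat}.
Variable u : 'rV[R]_n -> R.
Hypothesis su : smooth u.
Implicit Types (x : 'rV[R]_n) (i j l m p q : 'I_n).

Local Notation W := (schouten u).

Definition grad x : 'cV[R]_n := \col_i pderiv i u x.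

Lemma smooth_grad_sq : smooth (grad_sq u).
Proof. by apply: smooth_sum => i; apply: smoothM; exact: smooth_pderiv. Qed.

Lemma smooth_schouten i j : smooth (fun x => W x i j).
Proof.
rewrite (_ : (fun x => _) = fun x => (pderiv i (pderiv j u) x + pderiv i u x * pderiv j u x)
   - 2^-1 * grad_sq u x * (i == j)%:R); last by apply/funext => x; rewrite mxE.
apply: smoothB; last exact: smoothM (smoothZ _ smooth_grad_sq) (smooth_cst _).
apply: smoothD; first exact/smooth_pderiv/smooth_pderiv.
by apply: smoothM; exact: smooth_pderiv.
Qed.

Lemma schouten_sym x : (W x)^T = W x.
Proof.
by apply/matrixP => i j; rewrite !mxE (clairaut i j su) eq_sym [pderiv j u x * _]mulrC.
Qed.

Lemma schouten_symE x i j : W x i j = W x j i.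
Proof. by rewrite -{1}schouten_sym mxE. Qed.

Lemma smooth_newton k i j : smooth (fun x => newton (W x) k i j).
Proof.
elim: k i j => [|k IH] i j.
  rewrite (_ : (fun x => _) = fun=> (i == j)%:R); first exact: smooth_cst.
  by apply/funext => x; rewrite mxE.
rewrite (_ : (fun x => _) = fun x =>
  ((\sum_p \sum_q newton (W x) k p q * W x q p) / k.+1%:R * (i == j)%:R)
  - \sum_q newton (W x) k i q * W x q j).
  apply: smoothB; last first.
    by apply: smooth_sum => q; exact: smoothM (IH _ _) (smooth_schouten _ _).
  apply: smoothM (smoothM _ (smooth_cst _)) (smooth_cst _).
  apply: smooth_sum => p; apply: smooth_sum => q.
  exact: smoothM (IH _ _) (smooth_schouten _ _).
apply/funext => x; rewrite !mxE mulr_natr; congr (_ / _ *+ _ - _).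
by apply: eq_bigr => p _; rewrite mxE.
Qed.

Lemma smooth_sigma k : smooth (fun x => sigma (W x) k).
Proof.
case: k => [|k]; first exact: smooth_cst.
rewrite (_ : (fun x => _) = fun x =>
  (\sum_p \sum_q newton (W x) k p q * W x q p) / k.+1%:R).
  apply: smoothM _ (smooth_cst _).
  apply: smooth_sum => p; apply: smooth_sum => q.
  exact: smoothM (smooth_newton _ _ _) (smooth_schouten _ _).
apply/funext => x; congr (_ / _).
by apply: eq_bigr => p _; rewrite mxE.
Qed.

Lemma schouten_algebra (t hqi hqj ai aj S N d : R) :
  t + (ai * hqj + hqi * aj) - (2^-1 * N * 0 + 2^-1 * (2 * S) * d) =
  t + hqi * aj + ai * hqj - S * d.
Proof. by field. Qed.

Lemma pderiv_schouten q i j x : pderiv q (fun y => W y i j) x =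
  pderiv q (pderiv i (pderiv j u)) x + pderiv q (pderiv i u) x * pderiv j u x
  + pderiv i u x * pderiv q (pderiv j u) x
  - (\sum_l pderiv q (pderiv l u) x * pderiv l u x) * (i == j)%:R.
Proof.
rewrite (_ : (fun y => _) = fun x => (pderiv i (pderiv j u) x + pderiv i u x * pderiv j u x)
   - 2^-1 * grad_sq u x * (i == j)%:R); last by apply/funext => y; rewrite mxE.
have s1 a := smooth_pderiv a su.
have s2 a b := smooth_pderiv a (s1 b).
have sg := smoothZ 2^-1 smooth_grad_sq.
rewrite (pderivB _ (smoothD (s2 i j) (smoothM (s1 i) (s1 j))) (smoothM sg (smooth_cst _))).
rewrite (pderivD _ (s2 i j) (smoothM (s1 i) (s1 j))) (pderivM _ (s1 i) (s1 j)).
rewrite (pderivM _ sg (smooth_cst _)) pderiv_cst (pderivZ _ _ smooth_grad_sq).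
have -> : pderiv q (grad_sq u) x = 2 * \sum_l pderiv q (pderiv l u) x * pderiv l u x.
  rewrite (pderiv_sum _ _ _ (fun a => smoothM (s1 a) (s1 a))) mulr_sumr.
  apply: eq_bigr => l _; rewrite (pderivM _ (s1 l) (s1 l)).
  by move: (pderiv q (pderiv l u) x) (pderiv l u x) => ? ?; ring.
exact: schouten_algebra.
Qed.

Lemma cotton_algebra (t t' hqi hiq hql hil ai aq al Sq Si N d1 d2 : R) :
  t = t' -> hqi = hiq ->
  t + hqi * al + ai * hql - Sq * d1 - (t' + hiq * al + aq * hil - Si * d2) =
  ai * (hql + aq * al - 2^-1 * N * d2) - (Sq + 2^-1 * N * aq) * d1
  - aq * (hil + ai * al - 2^-1 * N * d1) + (Si + 2^-1 * N * ai) * d2.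
Proof. by move=> -> ->; field. Qed.

(** Third derivatives cancel because partial derivatives commute: this is the vanishing of the
    Cotton tensor, written with Euclidean derivatives. *)
Lemma cotton_schouten q i l x :
  pderiv q (fun y => W y i l) x - pderiv i (fun y => W y q l) x =
  grad x i 0 * W x q l - (W x *m grad x) q 0 * (i == l)%:R
  - grad x q 0 * W x i l + (W x *m grad x) i 0 * (q == l)%:R.
Proof.
pose N := grad_sq u x.
have Wu m : (W x *m grad x) m 0 =
    \sum_p pderiv m (pderiv p u) x * pderiv p u x + 2^-1 * N * grad x m 0.
  rewrite mxE; transitivity (\sum_p (pderiv m (pderiv p u) x * pderiv p u x
     + (pderiv m u x * pderiv p u x ^+ 2 - (m == p)%:R * (2^-1 * N * pderiv p u x)))).
    apply: eq_bigr => p _; rewrite !mxE -/N; move: (pderiv m (pderiv p u) x) ((m == p)%:R : R).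
    by move: (pderiv m u x) (pderiv p u x) => ? ? ? ?; ring.
  rewrite !big_split /= sumrN sum_deltal -mulr_sumr -/(grad_sq u x) -/N mxE; congr (_ + _).
  by move: (pderiv m u x) => ?; field.
rewrite (pderiv_schouten q i l x) (pderiv_schouten i q l x) (Wu q) (Wu i).
rewrite [grad x i 0]mxE [grad x q 0]mxE [W x q l]mxE [W x i l]mxE.
exact: cotton_algebra (congr1 (@^~ x) (clairaut q i (smooth_pderiv l su)))
  (congr1 (@^~ x) (clairaut q i su)).
Qed.

Lemma smooth_prod r (F : 'I_r -> 'rV[R]_n -> R) :
  (forall a, smooth (F a)) -> smooth (fun y => \prod_a F a y).
Proof.
elim: r F => [|r IH] F sF.
  by rewrite (_ : (fun y => _) = fun=> 1); [exact: smooth_cst|apply/funext => y; rewrite big_ord0].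
rewrite (_ : (fun y => _) = fun y => F ord0 y * \prod_a F (lift ord0 a) y).
  by apply: smoothM (sF _) (IH (fun a => F (lift ord0 a)) _) => a; exact: sF.
by apply/funext => y; rewrite big_ord_recl.
Qed.

Lemma pderiv_prod q r (F : 'I_r -> 'rV[R]_n -> R) x : (forall a, smooth (F a)) ->
  pderiv q (fun y => \prod_a F a y) x =
  \sum_a pderiv q (F a) x * \prod_(b < r | b != a) F b x.
Proof.
elim: r F => [|r IH] F sF.
  rewrite big_ord0 (_ : (fun y => _) = fun=> 1) ?pderiv_cst //.
  by apply/funext => y; rewrite big_ord0.
have sF' a : smooth (F (lift ord0 a)) by exact: sF.
rewrite (_ : (fun y => _) = fun y => F ord0 y * \prod_a F (lift ord0 a) y); last first.
  by apply/funext => y; rewrite big_ord_recl.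
rewrite (pderivM _ (sF _) (smooth_prod sF')) (IH _ sF') [RHS]big_ord_recl addrC; congr (_ + _).
  by congr (_ * _); rewrite [RHS]big_mkcond big_ord_recl /= mul1r.
rewrite mulr_sumr; apply: eq_bigr => a _; rewrite mulrCA; congr (_ * _).
rewrite [RHS]big_mkcond big_ord_recl /= [in LHS]big_mkcond; congr (_ * _).
Qed.

(** [T_k] is the gradient of [sigma_(k+1)]: the Kronecker sum is multilinear in its
    [k+1] equal slots. *)
Lemma pderiv_sigma q k x : pderiv q (fun y => sigma (W y) k.+1) x =
  \sum_i \sum_l newton (W x) k i l * pderiv q (fun y => W y l i) x.
Proof.
pose dW : 'M[R]_n := \matrix_(l, i) pderiv q (fun y => W y l i) x.
have fk : k.+1`!%:R != 0 :> R by rewrite pnatr_eq0 -lt0n fact_gt0.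
have E : (fun y => k.+1`!%:R * sigma (W y) k.+1) = fun y => \sum_(I : {ffun 'I_k.+1 -> 'I_n})
   \sum_(J : {ffun 'I_k.+1 -> 'I_n}) gen_kronecker I J * \prod_a W y (I a) (J a).
  by apply/funext => y; rewrite -mixed_disc_const.
apply: (mulfI fk).
have -> : k.+1`!%:R * pderiv q (fun y => sigma (W y) k.+1) x =
    pderiv q (fun y => k.+1`!%:R * sigma (W y) k.+1) x.
  by rewrite (pderivZ _ _ (smooth_sigma _)).
have sP (I J : {ffun 'I_k.+1 -> 'I_n}) : smooth (fun y => \prod_a W y (I a) (J a)).
  by apply: smooth_prod => a; exact: smooth_schouten.
have sZ (I J : {ffun 'I_k.+1 -> 'I_n}) := smoothZ (gen_kronecker I J) (sP I J).
rewrite E (pderiv_sum _ _ _ (fun I => smooth_sum _ _ (fun J => sZ I J))).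
transitivity (\sum_(I : {ffun 'I_k.+1 -> 'I_n}) \sum_(J : {ffun 'I_k.+1 -> 'I_n}) \sum_a
    gen_kronecker I J * (dW (I a) (J a) * \prod_(b < k.+1 | b != a) W x (I b) (J b))).
  apply: eq_bigr => I _; rewrite (pderiv_sum _ _ _ (fun J => sZ I J)).
  apply: eq_bigr => J _; rewrite (pderivZ _ _ (sP I J)) (pderiv_prod _ _ (fun a => smooth_schouten _ _)).
  by rewrite mulr_sumr; apply: eq_bigr => a _; rewrite [dW _ _]mxE.
transitivity (\sum_(a < k.+1) mixed_disc (with_slot a dW (fun=> W x))).
  under [RHS]eq_bigr do rewrite mixed_disc_slot.
  rewrite [RHS]exchange_big /=; apply: eq_bigr => I _.
  by rewrite [RHS]exchange_big.
rewrite (eq_bigr _ (fun a _ => mixed_disc_slot_const (W x) dW a)) sumr_const card_ord.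
rewrite -[LHS]mulr_natl factS natrM -mulrA; congr (_ * (_ * _)).
apply: eq_bigr => i _; rewrite mxE; apply: eq_bigr => l _.
by rewrite [dW _ _]mxE.
Qed.

Lemma hessian_algebra (t h ai aq N d : R) :
  t * h = t * (h + ai * aq - 2^-1 * N * d) - ai * (t * aq) + d * (2^-1 * N * t).
Proof. by field. Qed.

(** Induction on [k] through the recursion of [T_k]. The derivatives of [W] enter through
    [pderiv_sigma] and an antisymmetrized derivative, which [cotton_schouten] makes algebraic. *)
Lemma div_newton k q x : \sum_i pderiv i (fun y => newton (W y) k i q) x =
  (n%:R - k.*2%:R) * (newton (W x) k *m grad x) q 0 - (n%:R - k%:R) * sigma (W x) k * grad x q 0.
Proof.
elim: k q => [|k IH] q.
  rewrite big1 => [|i _].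
    by rewrite mul1mx subr0 mulr1 subrr.
  rewrite (_ : (fun y => _) = fun=> (i == q)%:R) ?pderiv_cst //.
  by apply/funext => y; rewrite mxE.
set T := newton (W x) k; set a := grad x.
have dT i : pderiv i (fun y => newton (W y) k.+1 i q) x =
    pderiv i (fun y => sigma (W y) k.+1) x * (i == q)%:R
    - \sum_l (T i l * pderiv i (fun y => W y l q) x + pderiv i (fun y => newton (W y) k i l) x * W x l q).
  rewrite (_ : (fun y => newton (W y) k.+1 i q) = fun y => sigma (W y) k.+1 * (i == q)%:R
      - \sum_l newton (W y) k i l * W y l q); last first.
    by apply/funext => y; rewrite newtonS !mxE mulr_natr.
  have s1 := smoothM (smooth_sigma k.+1) (smooth_cst ((i == q)%:R : R)).
  have s2 l := smoothM (smooth_newton k i l) (smooth_schouten l q).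
  rewrite (pderivB _ s1 (smooth_sum _ _ s2)) (pderivM _ (smooth_sigma k.+1) (smooth_cst _)).
  rewrite pderiv_cst mulr0 add0r (pderiv_sum _ _ _ s2); congr (_ - _).
  by apply: eq_bigr => l _; rewrite (pderivM _ (smooth_newton k i l) (smooth_schouten l q)).
rewrite (eq_bigr _ (fun i _ => dT i)) big_split /= sumrN.
have -> : \sum_i pderiv i (fun y => sigma (W y) k.+1) x * (i == q)%:R =
   \sum_i \sum_l T i l * pderiv q (fun y => W y i l) x.
  under eq_bigr do rewrite mulrC.
  rewrite sum_deltar pderiv_sigma; apply: eq_bigr => i _; apply: eq_bigr => l _.
  by congr (_ * pderiv q _ x); apply/funext => y; rewrite schouten_symE.
have -> : \sum_i \sum_l (T i l * pderiv i (fun y => W y l q) x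
      + pderiv i (fun y => newton (W y) k i l) x * W x l q) =
    \sum_i \sum_l T i l * pderiv i (fun y => W y q l) x
    + \sum_l W x q l * ((n%:R - k.*2%:R) * (T *m a) l 0 - (n%:R - k%:R) * sigma (W x) k * a l 0).
  rewrite -[\sum_l W x q l * _](_ : \sum_i \sum_l pderiv i (fun y => newton (W y) k i l) x * W x l q = _).
    rewrite -big_split; apply: eq_bigr => i _; rewrite -big_split; apply: eq_bigr => l _ /=.
    congr (_ * pderiv i _ x + _); apply/funext => y; exact: schouten_symE.
  rewrite exchange_big /=; apply: eq_bigr => l _.
  by rewrite -mulr_suml IH mulrC schouten_symE.
have Tsym i l : T i l = T l i by rewrite /T -{1}(tr_newton_sym k (schouten_sym x)) mxE.
have TWa : W x *m (T *m a) = T *m W x *m a by rewrite mulmxA newton_comm.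
have e1 : \sum_i \sum_l T i l * (a i 0 * W x q l) = (T *m W x *m a) q 0.
  rewrite -TWa [RHS]mxE exchange_big /=; apply: eq_bigr => l _.
  rewrite [(T *m a) l 0]mxE mulr_sumr; apply: eq_bigr => i _; rewrite (Tsym i l).
  by move: (T l i) (a i 0) (W x q l) => ? ? ?; ring.
have e2 : \sum_i \sum_l T i l * ((W x *m a) q 0 * (i == l)%:R) =
    (n%:R - k%:R) * sigma (W x) k * (W x *m a) q 0.
  rewrite -mxtrace_newton mulr_suml; apply: eq_bigr => i _.
  by under eq_bigr do rewrite mulrA mulrC; rewrite sum_deltal.
have e3 : \sum_i \sum_l T i l * (a q 0 * W x i l) = k.+1%:R * sigma (W x) k.+1 * a q 0.
  rewrite sigmaS mulr_suml; apply: eq_bigr => i _; rewrite [(_ *m _) i i]mxE mulr_suml.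
  apply: eq_bigr => l _; rewrite (schouten_symE x i l).
  by rewrite mulrCA mulrC.
have e4 : \sum_i \sum_l T i l * ((W x *m a) i 0 * (q == l)%:R) = (T *m W x *m a) q 0.
  rewrite -mulmxA [RHS]mxE; apply: eq_bigr => i _.
  by under eq_bigr do rewrite mulrA mulrC; rewrite sum_deltal Tsym.
have e5 : \sum_l W x q l * ((n%:R - k.*2%:R) * (T *m a) l 0 - (n%:R - k%:R) * sigma (W x) k * a l 0) =
    (n%:R - k.*2%:R) * (T *m W x *m a) q 0 - (n%:R - k%:R) * sigma (W x) k * (W x *m a) q 0.
  rewrite -TWa [(W x *m (T *m a)) q 0]mxE [(W x *m a) q 0]mxE !mulr_sumr -sumrB.
  apply: eq_bigr => l _; move: (W x q l) ((T *m a) l 0) (a l 0) => ? ? ?.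
  by move: (n%:R - _ : R) (n%:R - _ : R) => ? ?; ring.
have e6 : (newton (W x) k.+1 *m a) q 0 = sigma (W x) k.+1 * a q 0 - (T *m W x *m a) q 0.
  by rewrite newtonS mulmxBl mul_scalar_mx [LHS]mxE [X in X + _]mxE [X in _ + X]mxE.
rewrite e5 e6.
have -> : \sum_i \sum_l T i l * pderiv q (fun y => W y i l) x =
   \sum_i \sum_l T i l * pderiv i (fun y => W y q l) x
   + ((T *m W x *m a) q 0 - (n%:R - k%:R) * sigma (W x) k * (W x *m a) q 0
      - k.+1%:R * sigma (W x) k.+1 * a q 0 + (T *m W x *m a) q 0).
  rewrite -{1}e1 -e2 -e3 -e4 -!sumrB -!big_split; apply: eq_bigr => i _ /=.
  rewrite -!sumrB -!big_split; apply: eq_bigr => l _ /=.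
  have /eqP := cotton_schouten q i l x; rewrite subr_eq => /eqP ->.
  by rewrite mulrDr addrC !mulrDr !mulrN.
have kE : k.+1%:R = k%:R + 1 :> R by rewrite natr1.
have k2 : k.*2%:R = 2 * k%:R :> R by rewrite -mul2n natrM.
have k2E : (k.+1).*2%:R = 2 * (k%:R + 1) :> R by rewrite -mul2n natrM kE.
rewrite kE k2E k2.
move: (\sum_i _) ((T *m W x *m a) q 0) (sigma _ _) (sigma _ _) ((W x *m a) q 0) (a q 0).
by move: (n%:R : R) (k%:R : R) => ? ? ? ? ? ? ? ?; ring.
Qed.

Variable k : nat.

(** The weight for which the quadratic terms [(T_k du) . du] cancel in the divergence. *)
Definition flux_exponent : R := - (n%:R - k.*2%:R - 1).

Definition flux_field i x : R :=
  expR (flux_exponent * u x) * (newton (W x) k *m grad x) i 0.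

Lemma smooth_flux_field i : smooth (flux_field i).
Proof.
apply: smoothM; first exact/smooth_expR/smoothZ.
rewrite (_ : (fun x => _) = fun x => \sum_q newton (W x) k i q * pderiv q u x).
  by apply: smooth_sum => q; exact: smoothM (smooth_newton _ _ _) (smooth_pderiv _ su).
by apply/funext => x; rewrite mxE; apply: eq_bigr => q _; rewrite [grad x q 0]mxE.
Qed.

Definition flux_div x : R := expR (flux_exponent * u x) *
  (k.+1%:R * sigma (W x) k.+1 - 2^-1 * (n%:R - k%:R) * grad_sq u x * sigma (W x) k).

Lemma flux_algebra (e c s1 s0 X N d k2 dk : R) :
  e * (c * s1 - X + 2^-1 * N * (dk * s0) + ((d - k2) * X - dk * s0 * N))
    + e * (- (d - k2 - 1) * X) = e * (c * s1 - 2^-1 * dk * N * s0).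
Proof. by field. Qed.

Lemma div_flux_field x : \sum_i pderiv i (flux_field i) x = flux_div x.
Proof.
set T := newton (W x) k; set a := grad x; set e := expR (flux_exponent * u x).
have sT i q := smoothM (smooth_newton k i q) (smooth_pderiv q su).
have dF i : pderiv i (flux_field i) x =
    e * (\sum_q (T i q * pderiv i (pderiv q u) x + pderiv i (fun y => newton (W y) k i q) x * a q 0))
    + e * (flux_exponent * a i 0) * (T *m a) i 0.
  rewrite (_ : flux_field i = fun x => expR (flux_exponent * u x) *
      \sum_q newton (W x) k i q * pderiv q u x); last first.
    by apply/funext => y; rewrite /flux_field mxE; congr (_ * _); apply: eq_bigr => q _; rewrite [grad y q 0]mxE.
  rewrite (pderivM _ (smooth_expR (smoothZ _ su)) (smooth_sum _ _ (sT i))).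
  rewrite (pderiv_expR _ (smoothZ _ su)) (pderivZ _ _ su) (pderiv_sum _ _ _ (sT i)).
  congr (_ * _ + _ * _ * _).
  - apply: eq_bigr => q _; rewrite (pderivM _ (smooth_newton k i q) (smooth_pderiv q su)).
    by rewrite [a q 0]mxE.
  - by rewrite [a i 0]mxE.
  - by rewrite [RHS]mxE; apply: eq_bigr => q _; rewrite [a q 0]mxE.
rewrite (eq_bigr _ (fun i _ => dF i)) big_split /= -mulr_sumr.
set X := \sum_i a i 0 * (T *m a) i 0.
have -> : \sum_i e * (flux_exponent * a i 0) * (T *m a) i 0 = e * (flux_exponent * X).
  rewrite /X !mulr_sumr; apply: eq_bigr => i _.
  by move: (a i 0) ((T *m a) i 0) => ? ?; ring.
have E1 : \sum_i \sum_q pderiv i (fun y => newton (W y) k i q) x * a q 0 =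
    (n%:R - k.*2%:R) * X - (n%:R - k%:R) * sigma (W x) k * grad_sq u x.
  rewrite exchange_big /= /X /grad_sq !mulr_sumr -sumrB; apply: eq_bigr => q _.
  rewrite -mulr_suml div_newton -/T -/a [a q 0]mxE.
  by move: ((T *m a) q 0) (pderiv q u x) (n%:R - _ : R) (n%:R - _ : R) => ? ? ? ?; ring.
have E2 : \sum_i \sum_q T i q * pderiv i (pderiv q u) x =
    k.+1%:R * sigma (W x) k.+1 - X + 2^-1 * grad_sq u x * ((n%:R - k%:R) * sigma (W x) k).
  rewrite sigmaS -mxtrace_newton -/T /X mulr_sumr -sumrB -big_split.
  apply: eq_bigr => i _ /=; rewrite [(T *m W x) i i]mxE [(T *m a) i 0]mxE mulr_sumr -sumrB.
  rewrite -[2^-1 * _ * T i i](sum_deltal (fun q => 2^-1 * grad_sq u x * T i q)) -big_split.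
  apply: eq_bigr => q _ /=; rewrite (schouten_symE x q i) [W x i q]mxE [a i 0]mxE [a q 0]mxE.
  exact: hessian_algebra.
under eq_bigr do rewrite big_split /=.
rewrite big_split /= E1 E2 /flux_div -/e /flux_exponent.
exact: flux_algebra.
Qed.

End divergence_identity.

(** * Lebesgue measure on the space of row vectors *)

Section lebesgue_Rn.
Context {R : realType}.
Local Notation Rm := (measurableTypeR R).
Local Open Scope ereal_scope.

Lemma row_of_tupleE m (t : m.-tuple Rm) i : (row_of_tuple t) 0%R i = tnth t i.
Proof. by rewrite mxE. Qed.

(** An open set is the union of the boxes with rational center and radius that it contains. *)
Lemma measurable_row_open m (A : set 'rV[R]_m) : open A ->
  measurable ([set t : m.-tuple Rm | A (row_of_tuple t)]).
Proof.
move=> oA.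
pose box (q : {ffun 'I_m -> rat} * rat) : set (m.-tuple Rm) :=
  [set t | (0 < ratr q.2 :> R)%R /\ forall i, `](ratr (q.1 i) - ratr q.2)%R, (ratr (q.1 i) + ratr q.2)%R[%classic (tnth t i)].
have mbox q : measurable (box q).
  have [q0|q0] := pselect (0 < ratr q.2 :> R)%R; last first.
    by rewrite (_ : box q = set0) //; apply/seteqP; split=> t // [].
  rewrite (_ : box q = \bigcap_(i in [set: 'I_m]) [set t | `](ratr (q.1 i) - ratr q.2)%R, (ratr (q.1 i) + ratr q.2)%R[%classic (tnth t i)]).
    apply: fin_bigcap_measurable; first exact: finite_finset.
    move=> i _; rewrite -[X in measurable X]setTI.
    exact: (measurable_tnth i) measurableT _ (measurable_itv _).
  by apply/seteqP; split=> t; [move=> [_ H] i _; exact: H|move=> H; split=> // i; exact: H].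
pose good q := `[< box q `<=` [set t | A (row_of_tuple t)] >].
rewrite (_ : [set t | _] = \bigcup_q (if good q then box q else set0)); last first.
  apply/seteqP; split=> [t /= At|t [q _]]; last first.
    by rewrite /good; case: asboolP => // H /H.
  have /nbhs_ballP[e /= e0 He] : nbhs (row_of_tuple t) A by move: oA; rewrite openE => /(_ _ At).
  have [d] : exists d : rat, ratr d \in `](0:R), (e / 2)%R[%R.
    by apply: rat_in_itvoo; rewrite divr_gt0.
  rewrite in_itv /= => /andP[d0 de].
  have qP i : {q : rat | (ratr q \in `](tnth t i - ratr d)%R, (tnth t i + ratr d)%R[)%R}.
    by apply/cid/rat_in_itvoo; rewrite ltrD2l gtrN.
  pose q := ([ffun i => sval (qP i)], d).
  have tq : box q t.
    split=> // i; have := svalP (qP i); rewrite /= !in_itv /= ffunE => /andP[q1 q2].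
    by apply/andP; split; [rewrite ltrBlDr|rewrite -ltrBlDr].
  exists q => //; rewrite (_ : good q) //; apply/asboolP => s [_ sq]; apply: He.
  split=> // i j; rewrite (ord1 i) !row_of_tupleE.
  have := sq j; have := svalP (qP j); rewrite /= !in_itv /= ffunE => /andP[q1 q2] /andP[q3 q4].
  rewrite /ball /= ltr_distlC; apply/andP; split; lra.
apply: countable_bigcupT_measurable => // q.
by case: (good q).
Qed.

Lemma measurable_row_continuous m (f : 'rV[R]_m -> R) : continuous f ->
  measurable_fun setT (fun t : m.-tuple Rm => f (row_of_tuple t)).
Proof.
move=> cf; apply: (measurability _ (RGenOInfty.measurableE R)) => // _ [_ [x ->] <-].
rewrite setTI; apply: (@measurable_row_open _ [set y | `]x, +oo[%classic (f y)]).
by apply: open_comp => [y _|]; [exact: cf|exact: rray_open].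
Qed.


Section tonelli.
Variables (m : nat) (F : m.+1.-tuple Rm -> \bar R).
Hypotheses (mF : measurable_fun setT F) (F0 : forall t, 0 <= F t).

Let mFc : measurable_fun setT (F \o @cons_pair R m).
Proof. exact: measurableT_comp mF (@measurable_cons_pair R m). Qed.

Lemma lebesgue_tupleS_prod : \int[lebesgue_tuple m.+1]_t F t =
  \int[lebesgue_measure \x lebesgue_tuple m]_p F (cons_pair p).
Proof.
rewrite /= ge0_integral_pushforward //; exact: measurable_cons_pair.
Qed.

Lemma lebesgue_tuple_tonelli1 : \int[lebesgue_tuple m.+1]_t F t =
  \int[lebesgue_measure]_x \int[lebesgue_tuple m]_t F (cons_pair (x, t)).
Proof. by rewrite lebesgue_tupleS_prod (fubini_tonelli1 (F \o @cons_pair R m)) //= => x; exact: F0. Qed.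

Lemma lebesgue_tuple_tonelli2 : \int[lebesgue_tuple m.+1]_t F t =
  \int[lebesgue_tuple m]_t \int[lebesgue_measure]_x F (cons_pair (x, t)).
Proof. by rewrite lebesgue_tupleS_prod (fubini_tonelli2 (F \o @cons_pair R m)) //= => x; exact: F0. Qed.

End tonelli.

Lemma lebesgue_integral_scale (r : R) (f : Rm -> \bar R) : (0 < r)%R ->
  measurable_fun setT f -> (forall x, 0 <= f x) ->
  \int[lebesgue_measure]_x f x = r%:E * \int[lebesgue_measure]_x f (r * x)%R.
Proof.
move=> r0 mf f0.
have r0' : (0 <= r)%R by exact: ltW.
pose phi : Rm -> Rm := fun x => (r * x)%R.
have mphi : measurable_fun setT phi by exact: mulrl_measurable.
pose mu0 := mscale (NngNum r0') (pushforward (@lebesgue_measure R) phi).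
pose mu : {measure set Rm -> \bar R} := mu0 mphi.
have muE A : measurable A -> lebesgue_measure A = mu A.
  apply: lebesgue_measure_unique => X [[a b] /= _ <-].
  rewrite /mu /mu0 /mscale /=.
  have -> : pushforward lebesgue_measure phi `]a, b]%classic =
      lebesgue_measure `](a / r)%R, (b / r)%R]%classic.
    congr (lebesgue_measure _).
    by apply/seteqP; split=> x /=; rewrite !in_itv /= ltr_pdivrMr // ler_pdivlMr // mulrC.
  rewrite !lebesgue_measure_itv /= !lte_fin ltr_pM2r ?invr_gt0 //.
  case: ifP => _; last by rewrite mule0.
  by rewrite -!EFinB -EFinM -mulrBl mulrCA divff ?mulr1 // gt_eqF.
rewrite (eq_measure_integral mu) //; last by move=> A mA _; exact: muE.
by rewrite ge0_integral_mscale // ge0_integral_pushforward // preimage_setT.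
Qed.


Definition tuple_scale (r : R) m (t : m.-tuple Rm) : m.-tuple Rm :=
  [tuple (r * tnth t i)%R | i < m].

Lemma row_tuple_scale r m (t : m.-tuple Rm) :
  row_of_tuple (tuple_scale r t) = (r *: row_of_tuple t)%R.
Proof. by apply/rowP => i; rewrite !mxE tnth_mktuple. Qed.

Lemma measurable_tuple_scale r m : measurable_fun setT (@tuple_scale r m).
Proof.
apply/measurable_fun_tnthP => i.
rewrite (_ : _ \o _ = fun t : m.-tuple Rm => (r * tnth t i)%R : Rm); last first.
  by apply/funext => t /=; rewrite tnth_mktuple.
exact: measurableT_comp (mulrl_measurable r) (measurable_tnth i).
Qed.

Lemma tuple_scale_cons r m (x : Rm) (t : m.-tuple Rm) :
  tuple_scale r (cons_pair (x, t)) = cons_pair ((r * x)%R : Rm, tuple_scale r t).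
Proof.
apply: eq_from_tnth => i; rewrite tnth_mktuple.
by case: (unliftP ord0 i) => [j ->|->]; rewrite ?tnthS ?tnth0 // tnth_mktuple.
Qed.

Lemma measurable_cons_const m (x : Rm) :
  measurable_fun setT (fun t : m.-tuple Rm => cons_pair (x, t)).
Proof. exact: measurableT_comp (@measurable_cons_pair R m) (measurable_pair1 x). Qed.

Lemma lebesgue_tuple_scale r m (F : m.-tuple Rm -> \bar R) : (0 < r)%R ->
  measurable_fun setT F -> (forall t, 0 <= F t) ->
  \int[lebesgue_tuple m]_t F t =
  (r ^+ m)%:E * \int[lebesgue_tuple m]_t F (tuple_scale r t).
Proof.
move=> r0; elim: m F => [|m IH] F mF F0.
  rewrite expr0 mul1e; apply: eq_integral => t _; congr F.
  by apply: eq_from_tnth => -[].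
have mFs : measurable_fun setT (F \o @tuple_scale r m.+1).
  exact: measurableT_comp mF (@measurable_tuple_scale r m.+1).
rewrite lebesgue_tuple_tonelli1 //.
rewrite [in RHS](lebesgue_tuple_tonelli1 mFs) => [|t]; last exact: F0.
have mG : measurable_fun setT (fun x => \int[lebesgue_tuple m]_t F (cons_pair (x, t))).
  apply: (@measurable_fun_fubini_tonelli_F _ _ _ _ _ (lebesgue_tuple m) (F \o @cons_pair R m)).
    exact: measurableT_comp mF (@measurable_cons_pair R m).
  by move=> p; exact: F0.
rewrite (@lebesgue_integral_scale r) //; last by move=> x; exact: integral_ge0.
rewrite exprS EFinM -muleA; congr (_ * _).
have -> : (fun x : Rm => \int[lebesgue_tuple m]_t F (cons_pair ((r * x)%R, t))) =
    fun x => (r ^+ m)%:E * \int[lebesgue_tuple m]_t F (tuple_scale r (cons_pair (x, t))).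
  apply/funext => x; rewrite (IH (fun t => F (cons_pair ((r * x)%R : Rm, t)))) //.
  - by congr (_ * _); apply: eq_integral => t _; rewrite tuple_scale_cons.
  - exact: measurableT_comp mF (measurable_cons_const _).
rewrite ge0_integralZl //.
- apply: (@measurable_fun_fubini_tonelli_F _ _ _ _ _ (lebesgue_tuple m) (F \o @tuple_scale r m.+1 \o @cons_pair R m)).
    exact: measurableT_comp mFs (@measurable_cons_pair R m).
  by move=> p; exact: F0.
- by move=> x _; exact: integral_ge0.
- by rewrite lee_fin exprn_ge0 // ltW.
Qed.

Definition cube m (c : 'I_m -> R) (d : R) : set (m.-tuple Rm) :=
  [set t | forall i, `[(c i - d)%R, (c i + d)%R]%classic (tnth t i)].

Lemma measurable_cube m c d : measurable (@cube m c d).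
Proof.
rewrite (_ : cube c d = \bigcap_(i in [set: 'I_m]) [set t | `[(c i - d)%R, (c i + d)%R]%classic (tnth t i)]).
  apply: fin_bigcap_measurable; first exact: finite_finset.
  move=> i _; rewrite -[X in measurable X]setTI.
  exact: (measurable_tnth i) measurableT _ (measurable_itv _).
by apply/seteqP; split=> t H i; [move=> _|]; exact: H.
Qed.

Lemma lebesgue_cube m c (d : R) : (0 <= d)%R ->
  lebesgue_tuple m (cube c d) = ((d *+ 2) ^+ m)%:E.
Proof.
move=> d0; elim: m c => [|m IH] c /=.
  by rewrite diracE mem_set // => -[].
transitivity ((lebesgue_measure \x lebesgue_tuple m)%E
    (`[(c ord0 - d)%R, (c ord0 + d)%R]%classic `*` cube (fun i => c (lift ord0 i)) d)); last first.
  rewrite product_measure1E //; last exact: measurable_cube.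
  rewrite IH /= lebesgue_measure_itv /= lte_fin exprS EFinM.
  case: ltP => [_|dd]; first by rewrite -EFinD opprB addrC addrA subrK mulr2n.
  by rewrite (_ : d = 0)%R ?mul0rn //; lra.
congr ((_ \x _)%E _); apply/seteqP; split=> [[x t] /= H|[x t] [/= Hx Ht] i].
  by split=> [|i]; [have := H ord0|have := H (lift ord0 i)]; rewrite ?tnthS ?tnth0.
by case: (unliftP ord0 i) => [j ->|->]; rewrite ?tnthS ?tnth0.
Qed.

Lemma cube_norm m (x : 'rV[R]_m) d (t : m.-tuple Rm) : (0 <= d)%R ->
  cube (x 0%R) d t <-> (`|row_of_tuple t - x| <= d)%R.
Proof.
move=> d0; rewrite /Num.norm /= mx_normrE; split=> [H|].
  apply: bigmax_le => // -[i j] _ /=; rewrite (ord1 i) !mxE.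
  by have := H j; rewrite /= in_itv /= ler_distl.
move=> H i; rewrite /= in_itv /= -ler_distl; apply: le_trans H.
have := @le_bigmax _ _ _ (0:R)%R (fun p : 'I_1 * 'I_m => `|(row_of_tuple t - x) p.1 p.2|%R) (0%R, i).
by rewrite /= !mxE.
Qed.

Lemma continuous_bounded_ball m (f : 'rV[R]_m -> R) (B : R) : continuous f ->
  exists M : R, forall x, (`|x| <= B)%R -> (`|f x| <= M)%R.
Proof.
move=> cf; have cK : compact [set x : 'rV[R]_m | (`|x| <= B)%R].
  apply: bounded_closed_compact.
    by exists B; split; [exact: num_real|move=> C BC x /= /le_trans; apply; exact: ltW].
  apply: (@closed_comp _ _ (fun x : 'rV[R]_m => `|x|%R) [set y | (y <= B)%R]); last exact: closed_le.
  by move=> x _; exact: norm_continuous.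
have /compact_bounded[M [_ HM]] := continuous_compact (continuous_subspaceT cf) cK.
exists (M + 1)%R => x xB; apply: (HM (M + 1)%R); first by rewrite ltrDl.
by exists x.
Qed.

Lemma integrable_compact_support m (f : 'rV[R]_m -> R) (B : R) : (0 <= B)%R -> continuous f ->
  (forall x, (B < `|x|)%R -> f x = 0%R) ->
  (lebesgue_tuple m).-integrable setT (fun t => (f (row_of_tuple t))%:E).
Proof.
move=> B0 cf f0; have [M HM] := continuous_bounded_ball B cf.
have M0 : (0 <= M)%R.
  by apply: le_trans (HM 0%R _); rewrite ?normr_ge0 ?normr0.
have mC := @measurable_cube m ((0 : 'rV[R]_m)%R 0%R) B.
apply: (@le_integrable _ _ _ _ _ measurableT _ (fun t => (M * \1_(cube ((0 : 'rV[R]_m)%R 0%R) B) t)%:E)).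
- by apply/measurable_EFinP; exact: measurable_row_continuous.
- move=> t _; rewrite lee_fin indicE; have [tB|/negP tB] := boolP (t \in cube ((0 : 'rV[R]_m)%R 0%R) B).
    rewrite mulr1 [leRHS]ger0_norm //; apply: HM.
    by rewrite -[row_of_tuple t]subr0; apply/cube_norm => //; exact: set_mem.
  rewrite mulr0 normr0 f0 ?normr0 // ltNge; apply/negP => H; apply: tB.
  by rewrite inE; apply/cube_norm; rewrite ?subr0.
- under eq_fun do rewrite EFinM; apply: integrableZl => //.
  apply/integrableP; split; first exact/measurable_EFinP/measurable_indic.
  under eq_integral do rewrite /= ger0_norm ?indicE ?ler0n // -indicE.
  by rewrite integral_indic // setIT [ltLHS]lebesgue_cube // ltry.
Qed.

End lebesgue_Rn.

(** * Integrals of derivatives with compact support *)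

Section weak_divergence.
Context {R : realType}.
Local Notation Rm := (measurableTypeR R).

Definition consr m (x : R) (y : 'rV[R]_m) : 'rV[R]_m.+1 :=
  \row_i (if unlift ord0 i is Some j then y 0 j else x).

Lemma consr0 m x (y : 'rV[R]_m) : consr x y 0 ord0 = x.
Proof. by rewrite mxE unlift_none. Qed.

Lemma consrS m x (y : 'rV[R]_m) j : consr x y 0 (lift ord0 j) = y 0 j.
Proof. by rewrite mxE liftK. Qed.

Lemma row_cons_pair m (x : Rm) (t : m.-tuple Rm) :
  row_of_tuple (cons_pair (x, t)) = consr x (row_of_tuple t).
Proof.
apply/rowP => i; rewrite row_of_tupleE.
by case: (unliftP ord0 i) => [j ->|->]; rewrite ?consr0 ?consrS ?tnthS ?tnth0 ?row_of_tupleE.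
Qed.

Lemma row_map_continuous (T : topologicalType) n (F : T -> 'rV[R]_n) (x : T) :
  (forall i, {for x, continuous (fun y => F y 0 i)}) -> {for x, continuous F}.
Proof.
move=> cF; apply/cvg_ballP => e e0.
have : \forall y \near x, forall i, ball (F x 0 i) e (F y 0 i).
  apply: filter_forall => i; have /cvg_ballP := cF i; exact.
apply: filterS => y H; split=> // a i; rewrite (ord1 a); exact: H.
Qed.

Lemma consr_continuousr m x : continuous (@consr m x).
Proof.
move=> y; apply: row_map_continuous => i.
case: (unliftP ord0 i) => [j ->|->].
  rewrite (_ : (fun y => _) = fun y : 'rV[R]_m => y 0 j); first exact: coord_continuous.
  by apply/funext => z; rewrite consrS.
rewrite (_ : (fun y => _) = fun=> x); first exact: cst_continuous.
by apply/funext => z; rewrite consr0.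
Qed.

Lemma consr_continuousl m (y : 'rV[R]_m) : continuous (fun x => consr x y).
Proof.
move=> x; apply: row_map_continuous => i.
case: (unliftP ord0 i) => [j ->|->].
  rewrite (_ : (fun x => _) = fun=> y 0 j); first exact: cst_continuous.
  by apply/funext => z; rewrite consrS.
rewrite (_ : (fun x => _) = id); first exact: cvg_id.
by apply/funext => z; rewrite consr0.
Qed.

Lemma coord_le_norm m (x : 'rV[R]_m) i : `|x 0 i| <= `|x|.
Proof.
rewrite [leRHS]/Num.norm /= mx_normrE.
exact: (@le_bigmax _ _ _ (0:R) (fun p : 'I_1 * 'I_m => `|x p.1 p.2|) (0, i)).
Qed.

Lemma norm_le_coord m (x : 'rV[R]_m) (B : R) : 0 <= B -> (forall i, `|x 0 i| <= B) -> `|x| <= B.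
Proof.
move=> B0 H; rewrite [leLHS]/Num.norm /= mx_normrE.
by apply: bigmax_le => // -[i j] _ /=; rewrite (ord1 i).
Qed.

Lemma norm_consr_ge m x (y : 'rV[R]_m) : `|y| <= `|consr x y|.
Proof. by apply: norm_le_coord => // i; rewrite -(consrS x) coord_le_norm. Qed.

Lemma norm_consr_ge0 m x (y : 'rV[R]_m) : `|x| <= `|consr x y|.
Proof. by rewrite -[x in leLHS](consr0 x y) coord_le_norm. Qed.

Lemma integral_line_derive (g dg : R -> R) (B : R) : 0 <= B ->
  (forall x, is_derive x (1:R) g (dg x)) -> continuous dg ->
  (forall x, B < `|x| -> g x = 0) -> (forall x, B < `|x| -> dg x = 0) ->
  (\int[lebesgue_measure]_x (dg x)%:E = 0)%E.
Proof.
move=> B0 gd cdg g0 dg0; pose C := B + 1.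
have CC : - C < C by rewrite /C; lra.
have cg : continuous g.
  by move=> x; apply/differentiable_continuous/derivable1_diffP; have [] := gd x.
have BC : B < C by rewrite /C ltrDl.
transitivity (\int[lebesgue_measure]_(x in `[(- C)%R, C]) (dg x)%:E)%E.
  rewrite [RHS]integral_mkcond; apply: eq_integral => x _; rewrite patchE.
  case: ifPn => // /negP xC; rewrite dg0 // ltNge; apply/negP => xB; apply: xC.
  by rewrite inE /= in_itv /= -ler_norml (le_trans xB) // ltW.
rewrite (@continuous_FTC2 _ dg g) //.
- by rewrite !g0 ?sube0 ?normrN ?ger0_norm ?ltW ?(le_lt_trans B0).
- exact: continuous_subspaceT.
- split.
  + by move=> x _; have [] := gd x.
  + by apply: cvg_at_right_filter; exact: cg.
  + by apply: cvg_at_left_filter; exact: cg.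
- by move=> x _; rewrite derive1E; exact: derive_val.
Qed.

Lemma consr_line0 m (s x : R) (y : 'rV[R]_m) :
  s *: 'e_ord0 + consr x y = consr (s + x) y.
Proof.
apply/rowP => i; rewrite !mxE; case: (unliftP ord0 i) => [j ->|->] /=.
  by rewrite mulr0 add0r.
by rewrite mulr1.
Qed.

Lemma consr_lineS m (s x : R) (y : 'rV[R]_m) j :
  s *: 'e_(lift ord0 j) + consr x y = consr x (s *: 'e_j + y).
Proof.
apply/rowP => i; rewrite !mxE; case: (unliftP ord0 i) => [l ->|->] /=.
  by rewrite !mxE (inj_eq lift_inj).
by rewrite mulr0 add0r.
Qed.

Lemma is_derive_consr_0 m (f : 'rV[R]_m.+1 -> R) x (y : 'rV[R]_m) df :
  is_derive (consr x y) 'e_ord0 f df -> is_derive x (1:R) (fun x => f (consr x y)) df.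
Proof.
move=> fd; rewrite (_ : (fun x => _) = fun s : R => f (s *: 'e_ord0 + consr 0 y)).
  by apply: is_derive_line; rewrite consr_line0 addr0.
by apply/funext => s; rewrite consr_line0 addr0.
Qed.

Lemma is_derive_consr_S m (f : 'rV[R]_m.+1 -> R) x (y : 'rV[R]_m) j df :
  is_derive (consr x y) 'e_(lift ord0 j) f df -> is_derive y 'e_j (fun y => f (consr x y)) df.
Proof.
move=> fd; apply: is_derive_of_line.
rewrite (_ : (fun s : R => _) = fun s : R => f (s *: 'e_(lift ord0 j) + consr x y)).
  by apply: is_derive_line; rewrite scale0r add0r.
by apply/funext => s; rewrite consr_lineS.
Qed.

(** Tonelli brings the [i]-th variable inside, where the integral of the derivative of a compactly
    supported function of one variable vanishes. *)
Lemma integral_pderiv0 m (i : 'I_m) (f df : 'rV[R]_m -> R) (B : R) : 0 <= B ->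
  (forall x, is_derive x 'e_i f (df x)) -> continuous df ->
  (forall x, B < `|x| -> f x = 0) -> (forall x, B < `|x| -> df x = 0) ->
  (\int[lebesgue_tuple m]_t (df (row_of_tuple t))%:E = 0)%E.
Proof.
move=> B0; elim: m i f df => [[]//|m IH] i f df fd cdf f0 df0.
have idf := integrable_compact_support B0 cdf df0.
pose G (p : Rm * m.-tuple Rm) := (df (row_of_tuple (cons_pair p)))%:E.
have mdf : measurable_fun setT (fun t : m.+1.-tuple Rm => (df (row_of_tuple t))%:E).
  by have /integrableP[] := idf.
have iG : (@lebesgue_measure R \x lebesgue_tuple m)%E.-integrable setT G.
  have /integrableP[_ H] := idf; apply/integrableP; split.
    exact: measurableT_comp mdf (@measurable_cons_pair R m).
  move: H; rewrite lebesgue_tupleS_prod //.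
  exact: measurableT_comp mdf.
have -> : (\int[lebesgue_tuple m.+1]_t (df (row_of_tuple t))%:E =
   \int[lebesgue_measure \x lebesgue_tuple m]_p G p)%E.
  by rewrite /= integral_pushforward //; exact: measurable_cons_pair.
case: (unliftP ord0 i) fd => [j ->|->] fd.
  rewrite -integral12_prod_meas1 // integral0_eq // => x _; rewrite /fubini_F /G.
  under eq_integral do rewrite row_cons_pair.
  apply: (IH j (fun y => f (consr x y)) (fun y => df (consr x y))).
  - by move=> y; apply: is_derive_consr_S; exact: fd.
  - by move=> y; apply: continuous_comp; [exact: consr_continuousr|exact: cdf].
  - by move=> y By; apply: f0; rewrite (lt_le_trans By) // norm_consr_ge.
  - by move=> y By; apply: df0; rewrite (lt_le_trans By) // norm_consr_ge.
rewrite -integral21_prod_meas1 // integral0_eq // => t _; rewrite /fubini_G /G.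
under eq_integral do rewrite row_cons_pair.
apply: (integral_line_derive (g := fun x => f (consr x (row_of_tuple t)))
  (dg := fun x => df (consr x (row_of_tuple t))) B0).
- by move=> x; apply: is_derive_consr_0; exact: fd.
- by move=> x; apply: continuous_comp; [exact: consr_continuousl|exact: cdf].
- by move=> x Bx; apply: f0; rewrite (lt_le_trans Bx) // norm_consr_ge0.
- by move=> x Bx; apply: df0; rewrite (lt_le_trans Bx) // norm_consr_ge0.
Qed.

End weak_divergence.

(** * Substitution of the radius on a line *)

Section line_substitution.
Context {R : realType}.
Local Notation Rm := (measurableTypeR R).
Local Notation leb := (@lebesgue_measure R).
Local Open Scope ereal_scope.

Lemma lebesgue_integral_opp (f : Rm -> \bar R) :
  measurable_fun setT f -> (forall x, 0 <= f x) ->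
  \int[leb]_x f x = \int[leb]_x f (- x)%R.
Proof.
move=> mf f0.
pose phi : Rm -> Rm := fun x => (- x)%R.
have mphi : measurable_fun setT phi by exact: oppr_measurable.
pose mu0 := mscale (NngNum (@ler01 R)) (pushforward leb phi).
pose mu : {measure set Rm -> \bar R} := mu0 mphi.
have muE A : measurable A -> leb A = mu A.
  apply: lebesgue_measure_unique => X [[a b] /= _ <-].
  rewrite /mu /mu0 /mscale /= mul1e.
  have -> : pushforward leb phi `]a, b]%classic = leb `[(- b)%R, (- a)%R[%classic.
    congr (leb _).
    by apply/seteqP; split=> x /=; rewrite !in_itv /= /phi => /andP[? ?]; apply/andP; split; lra.
  rewrite !lebesgue_measure_itv /= !lte_fin ltrN2; case: ifP => // _.
  by rewrite -!EFinB opprK addrC.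
rewrite (eq_measure_integral mu) //; last by move=> A mA _; exact: muE.
by rewrite ge0_integral_mscale // mul1e ge0_integral_pushforward.
Qed.

Lemma lebesgue_integral_fold (f : R -> R) : continuous f -> (forall x, (0 <= f x)%R) ->
  \int[leb]_x (f x)%:E = \int[leb]_(x in `]0%R, +oo[) (f x + f (- x))%:E.
Proof.
move=> cf f0.
have mf : measurable_fun setT (EFin \o f) by apply/measurable_EFinP; exact: continuous_measurable_fun.
have cfN : continuous (fun x => f (- x)%R).
  by move=> x; apply: continuous_comp; [exact: continuousN|exact: cf].
have mfN : measurable_fun setT (EFin \o (fun x => f (- x)%R)).
  by apply/measurable_EFinP; exact: continuous_measurable_fun.
have lower : \int[leb]_(x in `]-oo, 0%R]) (f x)%:E = \int[leb]_(x in `]0%R, +oo[) (f (- x))%:E.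
  rewrite integral_mkcond lebesgue_integral_opp; last 2 first.
  - by apply/(measurable_restrictT _ _).1 => //; exact: measurable_funTS.
  - by move=> x; rewrite patchE; case: ifP => // _; rewrite lee_fin.
  rewrite integral_itv_obnd_cbnd; last exact: measurable_funTS.
  rewrite [RHS]integral_mkcond; apply: eq_integral => x _; rewrite !patchE.
  congr (if _ then _ else _).
  by apply/idP/idP; rewrite !inE /= !in_itv /= ?andbT oppr_le0.
have -> : [set: R] = `]-oo, 0%R] `|` `]0%R, +oo[.
  by apply/seteqP; split=> // x _ /=; rewrite !in_itv /= andbT; have [|] := leP x 0%R; [left|right].
rewrite ge0_integral_setU //; last 3 first.
- exact: measurable_funTS.
- by move=> x _; rewrite lee_fin.
- apply/disj_setPS => x [] /=; rewrite !in_itv /= andbT => x0 /(le_lt_trans x0).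
  by rewrite ltxx.
rewrite lower -ge0_integralD //; last 4 first.
- by move=> x _; rewrite lee_fin.
- exact: measurable_funTS.
- by move=> x _; rewrite lee_fin.
- exact: measurable_funTS.
by apply: eq_integral => x _; rewrite addeC -EFinD.
Qed.

Definition height (s r : R) : R := Num.sqrt (r ^+ 2 - s ^+ 2).

Lemma height_gt0 (s r : R) : (0 <= s)%R -> (s < r)%R -> (0 < height s r)%R.
Proof. by move=> s0 sr; rewrite sqrtr_gt0 subr_gt0 ltr_pXn2r // nnegrE ltW ?(le_lt_trans s0). Qed.

Lemma is_derive_height (s r : R) : (0 <= s)%R -> (s < r)%R ->
  is_derive r (1:R)%R (height s) (r / height s r)%R.
Proof.
move=> s0 sr; have h0 := height_gt0 s0 sr.
have pos : (0 < r ^+ 2 - s ^+ 2)%R by rewrite -sqrtr_gt0.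
have d1 : is_derive r (1:R)%R (fun r : R => (r ^+ 2 - s ^+ 2)%R) (2 * r)%R.
  have d2 := DeriveDef (@exprn_derivable R 2 r 1) (@exp_derive R 2 r 1).
  have := is_deriveB d2 (is_derive_cst (s ^+ 2)%R r 1%R).
  by rewrite subr0 expr1 [X in is_derive _ _ _ X]mulr1.
have := @is_derive1_comp _ Num.sqrt (fun r : R => r ^+ 2 - s ^+ 2)%R r _ _ (is_derive1_sqrt pos) d1.
rewrite -/(height s r); congr is_derive.
by move: (gt_eqF h0) => /negbT hn; field.
Qed.


Lemma height_continuous s : continuous (height s).
Proof.
move=> r; apply: continuous_comp; last exact: sqrt_continuous.
by apply: cvgB; [exact: exprn_continuous|exact: cvg_cst].
Qed.

Lemma height_quotient_continuous (s r : R) : (0 <= s)%R -> (s < r)%R ->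
  {for r, continuous (fun r : R => r / height s r)%R}.
Proof.
move=> s0 sr; apply: cvgM; first exact: cvg_id.
by apply: cvgV; [rewrite gt_eqF // height_gt0|exact: height_continuous].
Qed.

Lemma height_derive1 (s r : R) : (0 <= s)%R -> (s < r)%R ->
  (height s)^`()%classic r = (r / height s r)%R.
Proof. by move=> s0 sr; have H := is_derive_height s0 sr; rewrite derive1E; exact: derive_val. Qed.

Lemma height_derive1_continuous (s r : R) : (0 <= s)%R -> (s < r)%R ->
  {for r, continuous (height s)^`()%classic}.
Proof.
move=> s0 sr; rewrite /prop_for /continuous_at height_derive1 //.
apply: cvg_trans (height_quotient_continuous s0 sr); apply: near_eq_cvg.
near=> x; rewrite /= height_derive1 //.
by near: x; exact: lt_nbhsr.
Unshelve. all: by end_near. Qed.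

Lemma height_sqrt (s x : R) : (0 <= x)%R -> height s (Num.sqrt (s ^+ 2 + x ^+ 2)) = x.
Proof.
by move=> x0; rewrite /height sqr_sqrtr ?addr_ge0 ?sqr_ge0 // addrAC subrr add0r sqrtr_sqr ger0_norm.
Qed.

Lemma lt_sqrt_sumsq (s x : R) : (0 <= s)%R -> (0 < x)%R -> (s < Num.sqrt (s ^+ 2 + x ^+ 2))%R.
Proof.
move=> s0 x0; rewrite -{1}(ger0_norm s0) -sqrtr_sqr ltr_sqrt.
  by rewrite ltrDl exprn_gt0.
by rewrite ltr_wpDl ?sqr_ge0 // exprn_gt0.
Qed.

Lemma height_substitution_segment (s x y : R) (phi : R -> R) : (0 <= s)%R -> (0 < x)%R -> (x <= y)%R ->
  continuous phi ->
  \int[leb]_(z in `[x, y]) (phi z)%:E =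
  \int[leb]_(r in `[Num.sqrt (s ^+ 2 + x ^+ 2)%R, Num.sqrt (s ^+ 2 + y ^+ 2)%R])
    (phi (height s r) * (r / height s r))%:E.
Proof.
move=> s0 x0 xy cphi; set a := Num.sqrt (s ^+ 2 + x ^+ 2)%R; set b := Num.sqrt (s ^+ 2 + y ^+ 2)%R.
have y0 : (0 < y)%R by exact: lt_le_trans xy.
have sa : (s < a)%R by exact: lt_sqrt_sumsq.
have ab : (a <= b)%R.
  by rewrite /a /b ler_wsqrtr // lerD2l ler_pXn2r ?nnegrE // ltW.
have in_s r : r \in `[a, b]%R -> (s < r)%R by rewrite in_itv /= => /andP[/(lt_le_trans sa)].
have -> : x = height s a by rewrite height_sqrt // ltW.
have -> : y = height s b by rewrite height_sqrt // ltW.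
rewrite integration_by_substitution_increasing //.
- by apply: eq_integral => r; rewrite inE /= => /in_s sr; rewrite fctE /= height_derive1.
- move=> r t /in_s sr /in_s st rt.
  have r0 : (0 <= r)%R by rewrite ltW // (le_lt_trans s0).
  have t0 : (0 <= t)%R by rewrite ltW // (le_lt_trans s0).
  rewrite /height ltr_sqrt; last by rewrite subr_gt0 ltr_pXn2r ?nnegrE.
  by rewrite ltrD2r ltr_pXn2r ?nnegrE.
- move=> r rab; apply: height_derive1_continuous => //; apply: in_s.
  exact: subset_itv_oo_cc.
- apply/cvg_ex; eexists; apply: cvg_at_right_filter.
  exact: height_derive1_continuous.
- apply/cvg_ex; eexists; apply: cvg_at_left_filter.
  by apply: height_derive1_continuous => //; exact: lt_le_trans ab.
- split.
  + move=> r rab; have sr : (s < r)%R by apply: in_s; exact: subset_itv_oo_cc.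
    by have [] := is_derive_height s0 sr.
  + by apply: cvg_at_right_filter; exact: height_continuous.
  + by apply: cvg_at_left_filter; exact: height_continuous.
- exact: continuous_subspaceT.
Qed.

(** With [x = sqrt (r^2 - s^2)] and [dx = (r / x) dr] the half line above a point at distance [s]
    from the origin is swept by the radius [r > s]. The weight [r / x] is the one in the area
    element of a sphere written as a graph. *)
Lemma height_substitution (s : R) (phi : R -> R) : (0 <= s)%R ->
  continuous phi -> (forall x, 0 <= phi x)%R ->
  \int[leb]_(x in `]0%R, +oo[) (phi x)%:E =
  \int[leb]_(r in `]s, +oo[) (phi (height s r) * (r / height s r))%:E.
Proof.
move=> s0 cphi phi0.
pose q (x : R) := Num.sqrt (s ^+ 2 + x ^+ 2)%R.
pose A (j : nat) : set R := `[(j.+1%:R^-1)%R, (j.+1%:R : R)]%classic.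
pose B (j : nat) : set R := `[q (j.+1%:R^-1)%R, q j.+1%:R]%classic.
pose psi r := (phi (height s r) * (r / height s r))%R.
have inv0 j : (0 < j.+1%:R^-1 :> R)%R by rewrite invr_gt0 ltr0n.
have inv1 j : (j.+1%:R^-1 <= j.+1%:R :> R)%R.
  by rewrite (@le_trans _ _ 1%R) ?ler1n // invf_le1 ?ltr0n // ler1n.
have q_mono x y : (0 <= x)%R -> (x <= y)%R -> (q x <= q y)%R.
  move=> x0 xy; have y0 := le_trans x0 xy.
  by rewrite /q ler_wsqrtr // lerD2l ler_pXn2r ?nnegrE.
have B_s j : B j `<=` `]s, +oo[%classic.
  move=> r; rewrite /B /= !in_itv /= andbT => /andP[H _].
  by apply: lt_le_trans H; apply: lt_sqrt_sumsq.
have mpsi : measurable_fun `]s, +oo[ psi.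
  apply: open_continuous_measurable_fun => [|r]; first exact: rray_open.
  rewrite inE /= in_itv /= andbT => sr; apply: cvgM; last exact: height_quotient_continuous.
  by apply: continuous_comp; [exact: height_continuous|exact: cphi].
have cA : \int[leb]_(x in A j) (phi x)%:E @[j --> \oo] --> \int[leb]_(x in \bigcup_j A j) (phi x)%:E.
  apply: ge0_nondecreasing_set_cvg_integral.
  - move=> i j ij; apply/subsetPset => x; rewrite /A /= !in_itv /= => /andP[H1 H2].
    rewrite (le_trans _ H1) ?(le_trans H2) ?ler_nat //.
    by rewrite lef_pV2 ?posrE ?ltr0n // ler_nat.
  - by move=> j; exact: measurable_itv.
  - move=> j; apply/measurable_EFinP; apply: measurable_funTS.
    exact: continuous_measurable_fun.
  - by move=> j x _; rewrite lee_fin.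
have cB : \int[leb]_(x in B j) (psi x)%:E @[j --> \oo] --> \int[leb]_(x in \bigcup_j B j) (psi x)%:E.
  apply: ge0_nondecreasing_set_cvg_integral.
  - move=> i j ij; apply/subsetPset => x; rewrite /B /= !in_itv /= => /andP[H1 H2].
    rewrite (le_trans _ H1) ?(le_trans H2) ?q_mono ?ler_nat //.
    by rewrite lef_pV2 ?posrE ?ltr0n // ler_nat.
  - by move=> j; exact: measurable_itv.
  - move=> j; apply/measurable_EFinP; exact: measurable_funS mpsi.
  - move=> j x /B_s; rewrite /= in_itv /= andbT => sx; rewrite lee_fin mulr_ge0 // divr_ge0 ?sqrtr_ge0 //.
    by rewrite ltW // (le_lt_trans s0).
have AB j : \int[leb]_(x in A j) (phi x)%:E = \int[leb]_(x in B j) (psi x)%:E.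
  exact: height_substitution_segment.
have UA : \bigcup_j A j = `]0%R, +oo[%classic.
  apply/seteqP; split=> [x [j _]|x].
    by rewrite /A /= !in_itv /= andbT => /andP[H _]; exact: lt_le_trans H.
  rewrite /= in_itv /= andbT => x0.
  have [j1 Hj1] : exists j1 : nat, (x <= j1.+1%:R)%R.
    by exists (Num.truncn x); rewrite ltW // truncnS_gt.
  have [j2 Hj2] : exists j2 : nat, (x^-1 <= j2.+1%:R)%R.
    by exists (Num.truncn x^-1); rewrite ltW // truncnS_gt.
  exists (maxn j1 j2) => //; rewrite /A /= in_itv /=; apply/andP; split.
    rewrite -[leRHS]invrK lef_pV2 ?posrE ?ltr0n ?invr_gt0 // (le_trans Hj2) // ler_nat ltnS.
    exact: leq_maxr.
  by rewrite (le_trans Hj1) // ler_nat ltnS leq_maxl.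
have UB : \bigcup_j B j = `]s, +oo[%classic.
  apply/seteqP; split=> [x [j _ /B_s]//|r].
  rewrite /= in_itv /= andbT => sr.
  have : (\bigcup_j A j) (height s r) by rewrite UA /= in_itv /= andbT height_gt0.
  move=> [j _]; rewrite /A /= in_itv /= => /andP[H1 H2]; exists j => //.
  have r0 : (0 <= r)%R by rewrite ltW // (le_lt_trans s0).
  have E : r = q (height s r).
    rewrite /q /height sqr_sqrtr; last by rewrite subr_ge0 ler_pXn2r ?nnegrE // ltW.
    by rewrite addrC subrK sqrtr_sqr ger0_norm.
  by rewrite /B /= in_itv /= E; apply/andP; split; apply: q_mono => //; rewrite ?sqrtr_ge0 ?ltW.
move: cA cB; rewrite UA UB => cA; rewrite -(funext AB) => cB.
exact: (cvg_unique _ cA cB).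
Qed.

End line_substitution.

(** * Polar coordinates *)

Section polar_coordinates.
Context {R : realType}.
Local Notation Rm := (measurableTypeR R).
Local Notation leb := (@lebesgue_measure R).

Section continuous_real_functions.
Variable T : topologicalType.
Implicit Types f g : T -> R.

Lemma continuous_add f g : continuous f -> continuous g -> continuous (fun x => f x + g x).
Proof. by move=> cf cg x; apply: continuousD; [exact: cf|exact: cg]. Qed.

Lemma continuous_sub f g : continuous f -> continuous g -> continuous (fun x => f x - g x).
Proof. by move=> cf cg x; apply: continuousB; [exact: cf|exact: cg]. Qed.

Lemma continuous_mul f g : continuous f -> continuous g -> continuous (fun x => f x * g x).
Proof. by move=> cf cg x; apply: continuousM; [exact: cf|exact: cg]. Qed.

Lemma continuous_maxr f g : continuous f -> continuous g -> continuous (fun x => Num.max (f x) (g x)).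
Proof. by move=> cf cg x; exact: (continuous_max (cf x) (cg x)). Qed.

Lemma continuous_after (h : R -> R) f : continuous h -> continuous f -> continuous (fun x => h (f x)).
Proof. by move=> ch cf x; apply: continuous_comp; [exact: cf|exact: ch]. Qed.

Lemma continuous_sqr f : continuous f -> continuous (fun x => f x ^+ 2).
Proof. by apply: (@continuous_after (fun t => t ^+ 2)); exact: exprn_continuous. Qed.

Lemma continuous_bigsum (I : Type) (s : seq I) (F : I -> T -> R) :
  (forall i, continuous (F i)) -> continuous (fun x => \sum_(i <- s) F i x).
Proof.
move=> cF; elim: s => [|i s IH].
  by rewrite (_ : (fun x => _) = fun=> 0); [exact: cst_continuous|apply/funext => x; rewrite big_nil].
rewrite (_ : (fun x => _) = fun x => F i x + \sum_(j <- s) F j x); first exact: continuous_add.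
by apply/funext => x; rewrite big_cons.
Qed.

End continuous_real_functions.

Lemma eucl_norm_ge0 n (x : 'rV[R]_n) : 0 <= eucl_norm x.
Proof. exact: sqrtr_ge0. Qed.

Lemma sqr_eucl_norm n (x : 'rV[R]_n) : eucl_norm x ^+ 2 = \sum_i x 0 i ^+ 2.
Proof. by rewrite sqr_sqrtr // sumr_ge0 // => i _; exact: sqr_ge0. Qed.

Lemma sumsq_continuous n : continuous (fun x : 'rV[R]_n => \sum_i x 0 i ^+ 2).
Proof. by apply: continuous_bigsum => i; apply: continuous_sqr; exact: coord_continuous. Qed.

Lemma eucl_norm_continuous n : continuous (@eucl_norm R n).
Proof. by apply: continuous_after; [exact: sqrt_continuous|exact: sumsq_continuous]. Qed.

Lemma eucl_normZ n (r : R) (x : 'rV[R]_n) : 0 <= r -> eucl_norm (r *: x) = r * eucl_norm x.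
Proof.
move=> r0; rewrite /eucl_norm -{2}(ger0_norm r0) -sqrtr_sqr -sqrtrM ?sqr_ge0 // mulr_sumr.
by congr Num.sqrt; apply: eq_bigr => i _; rewrite mxE exprMn.
Qed.

Lemma coord_le_eucl_norm n (x : 'rV[R]_n) i : `|x 0 i| <= eucl_norm x.
Proof.
rewrite -sqrtr_sqr ler_wsqrtr // (bigD1 i) //= lerDl sumr_ge0 // => j _.
exact: sqr_ge0.
Qed.

Lemma norm_le_eucl_norm n (x : 'rV[R]_n) : `|x| <= eucl_norm x.
Proof. by apply: norm_le_coord => [|i]; [exact: eucl_norm_ge0|exact: coord_le_eucl_norm]. Qed.

Variable m : nat.
Implicit Types (G : 'rV[R]_m.+1 -> R) (y : 'rV[R]_m) (z : 'rV[R]_m.+1).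

Lemma sqr_eucl_norm_consr x y : eucl_norm (consr x y) ^+ 2 = x ^+ 2 + eucl_norm y ^+ 2.
Proof.
rewrite !sqr_eucl_norm big_ord_recl consr0; congr (_ + _).
by apply: eq_bigr => j _; rewrite consrS.
Qed.

Lemma eucl_norm_sphere_pt r y (e : bool) : 0 <= r -> eucl_norm y <= r ->
  eucl_norm (consr ((-1) ^+ e * height (eucl_norm y) r) y) = r.
Proof.
move=> r0 yr; apply/eqP; rewrite -(eqrXn2 (n := 2)) ?eucl_norm_ge0 //.
rewrite sqr_eucl_norm_consr exprMn sqrr_sign mul1r sqr_sqrtr ?subrK //.
by rewrite subr_ge0 ler_pXn2r ?nnegrE ?eucl_norm_ge0.
Qed.

Definition sphere_integrand G r y : R :=
  (G (consr (height (eucl_norm y) r) y) + G (consr (- height (eucl_norm y) r) y))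
  * (r / height (eucl_norm y) r).

Definition sphere_eintegral (r : R) G : \bar R :=
  (\int[lebesgue_tuple m]_(t in [set t | (eucl_norm (row_of_tuple t) < r)%R])
     (sphere_integrand G r (row_of_tuple t))%:E)%E.

Lemma sphere_integralE (r : R) G : sphere_integral r G = fine (sphere_eintegral r G).
Proof.
rewrite /sphere_integral /Rintegral /sphere_eintegral; congr fine.
have pt x0 (t : m.-tuple Rm) : (\row_(i < m.+1) nth 0 (x0 :: t) i : 'rV[R]_m.+1) = consr x0 (row_of_tuple t).
  apply/rowP => i; rewrite mxE; case: (unliftP ord0 i) => [j ->|->].
    by rewrite consrS row_of_tupleE /= (tnth_nth 0).
  by rewrite consr0.
by apply: eq_integral => t _; rewrite /sphere_integrand !pt.
Qed.

Definition tailr z : 'rV[R]_m := \row_j z 0 (lift ord0 j).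

Lemma tailr_consr x y : tailr (consr x y) = y.
Proof. by apply/rowP => j; rewrite mxE consrS. Qed.

Lemma tailr_continuous : continuous tailr.
Proof.
move=> z; apply: row_map_continuous => j.
rewrite (_ : (fun z => _) = fun z : 'rV[R]_m.+1 => z 0 (lift ord0 j)); first exact: coord_continuous.
by apply/funext => w; rewrite mxE.
Qed.

Lemma tailr_norm_continuous : continuous (fun z => eucl_norm (tailr z)).
Proof.
by move=> z; apply: continuous_comp; [exact: tailr_continuous|exact: eucl_norm_continuous].
Qed.

Lemma joint_height_continuous : continuous (fun z => height (eucl_norm (tailr z)) (z 0 ord0)).
Proof.
apply: continuous_after; first exact: sqrt_continuous.
apply: continuous_sub; apply: continuous_sqr; first exact: coord_continuous.
exact: tailr_norm_continuous.
Qed.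

Lemma sphere_pt_continuous (c : R) :
  continuous (fun z => consr (c * height (eucl_norm (tailr z)) (z 0 ord0)) (tailr z)).
Proof.
move=> z; apply: row_map_continuous => i; case: (unliftP ord0 i) => [j ->|->].
  rewrite (_ : (fun z => _) = fun z : 'rV[R]_m.+1 => z 0 (lift ord0 j)); first exact: coord_continuous.
  by apply/funext => w; rewrite consrS mxE.
rewrite (_ : (fun z => _) = fun z => c * height (eucl_norm (tailr z)) (z 0 ord0)).
  by apply: continuous_mul; [exact: cst_continuous|exact: joint_height_continuous].
by apply/funext => w; rewrite consr0.
Qed.

(** Extending the integrand of polar coordinates by zero off the domain of the graph makes it
    a function of radius and tail on all of [R^(m+1)], to which Tonelli applies in both orders. *)
Definition polar_integrand G z : R :=
  if eucl_norm (tailr z) < z 0 ord0 then sphere_integrand G (z 0 ord0) (tailr z) else 0.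

Lemma measurable_polar_integrand G : continuous G ->
  measurable_fun setT (fun t : m.+1.-tuple Rm => polar_integrand G (row_of_tuple t)).
Proof.
move=> cG; pose D := [set z | eucl_norm (tailr z) < z 0 ord0].
pose h z := height (eucl_norm (tailr z)) (z 0 ord0).
have mD : measurable [set t : m.+1.-tuple Rm | D (row_of_tuple t)].
  apply: measurable_row_open.
  have cD : continuous (fun z => z 0 ord0 - eucl_norm (tailr z)).
    by apply: continuous_sub; [exact: coord_continuous|exact: tailr_norm_continuous].
  rewrite (_ : D = (fun z => z 0 ord0 - eucl_norm (tailr z)) @^-1` [set t | 0 < t]); last first.
    by apply/seteqP; split=> z; rewrite /D /= subr_gt0.
  by apply: open_comp (@open_gt R 0) => z _; exact: cD.
rewrite (_ : (fun t => _) = fun t : m.+1.-tuple Rm =>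
   \1_[set t : m.+1.-tuple Rm | D (row_of_tuple t)] t *
   ((G (consr (1 * h (row_of_tuple t)) (tailr (row_of_tuple t)))
     + G (consr (-1 * h (row_of_tuple t)) (tailr (row_of_tuple t))))
   * ((row_of_tuple t) 0 ord0 * (h (row_of_tuple t)) `^ (-1)))); last first.
  apply/funext => t; rewrite indicE /polar_integrand mul1r mulN1r /sphere_integrand.
  rewrite powR_inv1 ?sqrtr_ge0 //.
  by case: ifPn => H; [rewrite mem_set ?mul1r|rewrite memNset ?mul0r //; apply/negP].
apply: measurable_funM; first exact: measurable_indic.
apply: measurable_funM.
  apply: (measurable_row_continuous (f := fun z => G (consr (1 * h z) (tailr z)) + G (consr (-1 * h z) (tailr z)))).
  by apply: continuous_add => z; apply: continuous_comp; try exact: cG; exact: sphere_pt_continuous.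
apply: measurable_funM.
  apply: (measurable_row_continuous (f := fun z => z 0 ord0)).
  exact: coord_continuous.
apply: (measurableT_comp (measurable_powR (-1))).
apply: (measurable_row_continuous (f := h)).
exact: joint_height_continuous.
Qed.

Lemma polar_integrand_ge0 G z : (forall z, 0 <= G z) -> 0 <= polar_integrand G z.
Proof.
move=> G0; rewrite /polar_integrand; case: ifP => // H.
rewrite mulr_ge0 ?addr_ge0 // divr_ge0 ?sqrtr_ge0 //.
by rewrite ltW // (le_lt_trans _ H) // eucl_norm_ge0.
Qed.

Local Open Scope ereal_scope.

(** Tonelli in the first coordinate, the substitution of the radius on each line, and
    Tonelli again to exchange radius and tail. *)
Lemma polar_coordinates G : continuous G -> (forall z, (0 <= G z)%R) ->
  \int[lebesgue_tuple m.+1]_t (G (row_of_tuple t))%:E =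
  \int[leb]_(r in `]0%R, +oo[) sphere_eintegral r G.
Proof.
move=> cG G0.
have mG : measurable_fun setT (fun t : m.+1.-tuple Rm => (G (row_of_tuple t))%:E).
  by apply/measurable_EFinP; exact: measurable_row_continuous.
have mK : measurable_fun setT (fun t : m.+1.-tuple Rm => (polar_integrand G (row_of_tuple t))%:E).
  by apply/measurable_EFinP; exact: measurable_polar_integrand.
have K0 t : 0 <= (polar_integrand G (row_of_tuple t))%:E by rewrite lee_fin polar_integrand_ge0.
rewrite lebesgue_tuple_tonelli2 // => [|t]; last by rewrite lee_fin.
transitivity (\int[lebesgue_tuple m]_t \int[leb]_r (polar_integrand G (row_of_tuple (cons_pair (r, t))))%:E).
  apply: eq_integral => t _; set y := row_of_tuple t.
  have cx : continuous (fun x => G (consr x y)).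
    by move=> x; apply: continuous_comp; [exact: consr_continuousl|exact: cG].
  transitivity (\int[leb]_x (G (consr x y))%:E).
    by apply: eq_integral => x _; rewrite row_cons_pair.
  rewrite (lebesgue_integral_fold cx) //.
  rewrite (height_substitution (eucl_norm_ge0 y)) /=; last 2 first.
  - apply: (continuous_add cx) => x.
    by apply: (continuous_comp (f := -%R) (g := fun x => G (consr x y))); [exact: continuousN|exact: cx].
  - by move=> x; rewrite addr_ge0.
  rewrite integral_mkcond; apply: eq_integral => r _.
  rewrite patchE row_cons_pair /polar_integrand tailr_consr consr0.
  by rewrite mem_setE in_itv /= andbT -/y; case: ifP.
rewrite -(lebesgue_tuple_tonelli2 mK) // lebesgue_tuple_tonelli1 // [RHS]integral_mkcond.
apply: eq_integral => r _; rewrite patchE; case: ifPn => rpos.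
  rewrite /sphere_eintegral [RHS]integral_mkcond; apply: eq_integral => t _.
  rewrite patchE row_cons_pair /polar_integrand tailr_consr consr0.
  by case: ifPn => H; [rewrite mem_set|rewrite memNset //; apply/negP].
apply: integral0_eq => t _; rewrite row_cons_pair /polar_integrand tailr_consr consr0.
case: ifPn => // H; case/negP: rpos; rewrite inE /= in_itv /= andbT (le_lt_trans _ H) //.
exact: eucl_norm_ge0.
Qed.

End polar_coordinates.

(** * Scaling of integrals over spheres *)

Section sphere_calculus.
Context {R : realType}.
Local Notation Rm := (measurableTypeR R).
Local Notation leb := (@lebesgue_measure R).

(** A positive value persists on a cube, which has positive measure. *)
Lemma integral_eq0_continuous n (f : 'rV[R]_n -> R) : continuous f -> (forall x, 0 <= f x) ->
  (\int[lebesgue_tuple n]_t (f (row_of_tuple t))%:E = 0)%E -> forall x, f x = 0.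
Proof.
move=> cf f0 If x; apply/eqP/negPn/negP => fx0.
have fx : 0 < f x by rewrite lt0r fx0 f0.
have /nbhs_ballP[d /= d0 dP] : \forall y \near x, f x / 2 < f y.
  apply: (cvgr_gt (f x) (cf x)); lra.
have e0 : 0 <= d / 2 by lra.
have : (0 < \int[lebesgue_tuple n]_t (f x / 2 * \1_(cube (x 0) (d / 2)) t)%:E)%E.
  under eq_integral do rewrite EFinM.
  rewrite ge0_integralZl_EFin //; last 2 first.
  - by apply/measurable_EFinP; apply: measurable_indic; exact: measurable_cube.
  - lra.
  rewrite integral_indic ?setIT //; last exact: measurable_cube.
  rewrite [X in (_ * X)%E]lebesgue_cube // -EFinM lte_fin.
  by apply: mulr_gt0; [|apply: exprn_gt0; rewrite pmulrn_rgt0 //]; rewrite divr_gt0.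
rewrite ltNge => /negP; apply; rewrite -If; apply: ge0_le_integral => //.
- by move=> t _; rewrite lee_fin mulr_ge0 ?indicE //; lra.
- apply/measurable_EFinP; apply: measurable_funM => //.
  by apply: measurable_indic; exact: measurable_cube.
- by apply/measurable_EFinP; exact: measurable_row_continuous.
move=> t _; rewrite lee_fin indicE; have [tB|/negP tB] := boolP (t \in _); last by rewrite mulr0.
rewrite mulr1 ltW //; apply: dP; rewrite -ball_normE /ball_ /= distrC.
move: tB; rewrite inE => /(cube_norm _ _ e0) /le_lt_trans; apply; lra.
Qed.

Variable m : nat.
Implicit Types (G H : 'rV[R]_m.+1 -> R) (y : 'rV[R]_m) (z : 'rV[R]_m.+1) (r M : R).

Definition disc r : set (m.-tuple Rm) := [set t | eucl_norm (row_of_tuple t) < r].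

Lemma measurable_disc r : measurable (disc r).
Proof.
apply: (@measurable_row_open _ m [set y | eucl_norm y < r]).
by apply: (@open_comp _ _ (@eucl_norm R m) [set t | t < r]) => [y _|]; [exact: eucl_norm_continuous|exact: open_lt].
Qed.

Lemma height_norm_continuous r : continuous (fun y => height (eucl_norm y) r).
Proof.
apply: continuous_after; first exact: sqrt_continuous.
by apply: continuous_sub; [exact: cst_continuous|apply: continuous_sqr; exact: eucl_norm_continuous].
Qed.

Lemma cap_continuous (c r : R) : continuous (fun y => consr (c * height (eucl_norm y) r) y).
Proof.
move=> y; apply: row_map_continuous => i; case: (unliftP ord0 i) => [j ->|->].
  rewrite [X in {for _, continuous X}](_ : _ = fun z : 'rV[R]_m => z 0 j); first exact: coord_continuous.
  by apply/funext => w; rewrite consrS.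
rewrite [X in {for _, continuous X}](_ : _ = fun z : 'rV[R]_m => c * height (eucl_norm z) r).
  by apply: continuous_mul y; [exact: cst_continuous|exact: height_norm_continuous].
by apply/funext => w; rewrite consr0.
Qed.

Lemma measurable_sphere_integrand G r : continuous G ->
  measurable_fun setT (fun t : m.-tuple Rm => sphere_integrand G r (row_of_tuple t)).
Proof.
move=> cG.
(* The inverse as a real power, which is measurable across zero. *)
rewrite (_ : (fun t => _) = fun t : m.-tuple Rm =>
   (G (consr (1 * height (eucl_norm (row_of_tuple t)) r) (row_of_tuple t))
     + G (consr (-1 * height (eucl_norm (row_of_tuple t)) r) (row_of_tuple t)))
   * (r * (height (eucl_norm (row_of_tuple t)) r) `^ (-1))); last first.
  by apply/funext => t; rewrite mul1r mulN1r powR_inv1 ?sqrtr_ge0.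
apply: measurable_funM.
  apply: (measurable_row_continuous (f := fun y => G (consr (1 * height (eucl_norm y) r) y)
    + G (consr (-1 * height (eucl_norm y) r) y))).
  by apply: continuous_add => z; apply: continuous_comp; try exact: cG; exact: cap_continuous.
apply: measurable_funM; first exact: measurable_cst.
apply: (measurableT_comp (measurable_powR (-1))).
apply: (measurable_row_continuous (f := fun y => height (eucl_norm y) r)).
exact: height_norm_continuous.
Qed.

Lemma sphere_integrand_ge0 G r y : 0 <= r -> (forall z, 0 <= G z) -> 0 <= sphere_integrand G r y.
Proof. by move=> r0 G0; rewrite mulr_ge0 ?addr_ge0 // divr_ge0 // sqrtr_ge0. Qed.

Lemma height_scale (r s : R) : 0 <= r -> height (r * s) r = r * height s 1.
Proof.
move=> r0; rewrite /height -{3}(ger0_norm r0) -sqrtr_sqr -sqrtrM ?sqr_ge0 //; congr Num.sqrt; ring.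
Qed.

Lemma consrZ r (x : R) y : consr (r * x) (r *: y) = r *: consr x y.
Proof.
by apply/rowP => i; rewrite [RHS]mxE; case: (unliftP ord0 i) => [j ->|->]; rewrite ?consrS ?consr0 ?mxE.
Qed.

Lemma sphere_integrand_scale G r y : 0 < r ->
  sphere_integrand G r (r *: y) = sphere_integrand (fun z => G (r *: z)) 1 y.
Proof.
move=> r0; rewrite /sphere_integrand eucl_normZ ?ltW // height_scale ?ltW //.
by rewrite -mulrN !consrZ; congr (_ * _); rewrite invfM mulrA divff ?gt_eqF.
Qed.

(** The area element of the graph is homogeneous of degree [m] in the radius. *)
Lemma sphere_eintegral_scale_ge0 r G : 0 < r -> continuous G -> (forall z, 0 <= G z) ->
  (sphere_eintegral r G = (r ^+ m)%:E * sphere_eintegral 1 (fun z => G (r *: z)))%E.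
Proof.
move=> r0 cG G0; rewrite /sphere_eintegral integral_mkcond (lebesgue_tuple_scale r0); last 2 first.
- apply/(measurable_restrictT _ (measurable_disc r)).
  by apply/measurable_EFinP; apply: measurable_funTS; exact: measurable_sphere_integrand.
- by move=> t; rewrite patchE; case: ifP => // _; rewrite lee_fin sphere_integrand_ge0 // ltW.
congr (_ * _)%E; rewrite [RHS]integral_mkcond; apply: eq_integral => t _.
rewrite !patchE row_tuple_scale sphere_integrand_scale //.
congr (if _ then _ else _); apply/idP/idP; rewrite !inE /= row_tuple_scale eucl_normZ ?ltW // => H.
  by rewrite -(ltr_pM2l r0) mulr1.
by rewrite -[ltRHS]mulr1 ltr_pM2l.
Qed.

Lemma eq_sphere_integrand G H r y : eucl_norm y < r ->
  (forall z, eucl_norm z = r -> G z = H z) -> sphere_integrand G r y = sphere_integrand H r y.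
Proof.
move=> yr GH; have r0 : 0 <= r by rewrite ltW // (le_lt_trans _ yr) // eucl_norm_ge0.
have K (e : bool) := @eucl_norm_sphere_pt R m r y e r0 (ltW yr).
have := K false; have := K true; rewrite /= expr0 expr1 mul1r mulN1r => K1 K2.
by rewrite /sphere_integrand !GH.
Qed.

Lemma eq_sphere_eintegral G H r :
  (forall z, eucl_norm z = r -> G z = H z) -> sphere_eintegral r G = sphere_eintegral r H.
Proof.
move=> GH; apply: eq_integral => t; rewrite inE /= => tr; congr EFin.
exact: eq_sphere_integrand.
Qed.

Lemma eq_sphere_integral G H r :
  (forall z, eucl_norm z = r -> G z = H z) -> sphere_integral r G = sphere_integral r H.
Proof. by move=> GH; rewrite !sphere_integralE (eq_sphere_eintegral GH). Qed.

End sphere_calculus.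

(** * Finiteness and continuity of integrals over spheres *)

Section sphere_integrals.
Context {R : realType} {m : nat}.
Local Notation Rm := (measurableTypeR R).
Local Notation leb := (@lebesgue_measure R).
Implicit Types (G H : 'rV[R]_m.+1 -> R) (y : 'rV[R]_m) (z : 'rV[R]_m.+1) (r M : R).

Lemma sphere_eintegral_cst r (c : R) : 0 < r -> 0 <= c ->
  (sphere_eintegral r (fun _ : 'rV[R]_m.+1 => c) =
   (c * r ^+ m)%:E * sphere_eintegral 1 (fun _ : 'rV[R]_m.+1 => 1%R))%E.
Proof.
move=> r0 c0; rewrite sphere_eintegral_scale_ge0 //; last exact: cst_continuous.
rewrite mulrC EFinM -muleA; congr (_ * _)%E.
rewrite -ge0_integralZl_EFin //; last 3 first.
- exact: (measurable_disc 1).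
- by move=> t _; rewrite lee_fin sphere_integrand_ge0.
- apply/measurable_EFinP; apply: measurable_funTS.
  by apply: measurable_sphere_integrand; exact: cst_continuous.
by apply: eq_integral => t _; rewrite -EFinM /sphere_integrand; congr EFin; ring.
Qed.

(** A bump function compares the area of the unit sphere with the integral of a
    continuous compactly supported function, which is finite and positive. *)
Lemma sphere_eintegral1 :
  exists2 w : R, 0 < w & sphere_eintegral 1 (fun _ : 'rV[R]_m.+1 => 1) = w%:E.
Proof.
set E := sphere_eintegral _ _; pose G z := Num.max 0 (3 - eucl_norm z).
have cG : continuous G.
  apply: continuous_maxr; first exact: cst_continuous.
  by apply: continuous_sub; [exact: cst_continuous|exact: eucl_norm_continuous].
have G0 z : 0 <= G z by rewrite le_max lexx.
have IG : (\int[lebesgue_tuple m.+1]_t (G (row_of_tuple t))%:E =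
   E * \int[leb]_(r in `]0%R, +oo[) (Num.max 0 (3 - r) * r ^+ m)%R%:E)%E.
  rewrite polar_coordinates // -ge0_integralZl //; last 3 first.
  - apply/measurable_EFinP; apply: measurable_funTS; apply: continuous_measurable_fun.
    apply: continuous_mul; last exact: exprn_continuous.
    apply: continuous_maxr; first exact: cst_continuous.
    by apply: continuous_sub => t; [exact: cst_continuous|exact: cvg_id].
  - move=> r /=; rewrite in_itv /= andbT => r0.
    by rewrite lee_fin; apply: mulr_ge0; [rewrite le_max lexx|rewrite exprn_ge0 // ltW].
  - by apply: integral_ge0 => t _; rewrite lee_fin sphere_integrand_ge0.
  apply: eq_integral => r; rewrite inE /= in_itv /= andbT => r0.
  rewrite muleC -sphere_eintegral_cst ?le_max ?lexx //.
  by apply: eq_sphere_eintegral => z zr; rewrite /G zr.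
have fG : (\int[lebesgue_tuple m.+1]_t (G (row_of_tuple t))%:E < +oo)%E.
  have /integrableP[_] : (lebesgue_tuple m.+1).-integrable setT (fun t => (G (row_of_tuple t))%:E).
    apply: (@integrable_compact_support _ _ _ 3) => // z z3; apply/max_idPl.
    by rewrite subr_le0 ltW // (lt_le_trans z3) // norm_le_eucl_norm.
  by under eq_integral do rewrite /= ger0_norm //.
have pG : (\int[lebesgue_tuple m.+1]_t (G (row_of_tuple t))%:E != 0)%E.
  apply/eqP => /(integral_eq0_continuous cG G0)/(_ 0).
  rewrite /G /eucl_norm big1 ?sqrtr0 ?subr0; last by move=> i _; rewrite mxE expr0n.
  by move/eqP; rewrite gt_eqF // lt_max ltr0n orbT.
have E0 : (0 <= E)%E by apply: integral_ge0 => t _; rewrite lee_fin sphere_integrand_ge0.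
have J0 : (0 <= \int[leb]_(r in `]0%R, +oo[) (Num.max 0 (3 - r) * r ^+ m)%R%:E)%E.
  apply: integral_ge0 => r /=; rewrite in_itv /= andbT => r0.
  by rewrite lee_fin; apply: mulr_ge0; [rewrite le_max lexx|rewrite exprn_ge0 // ltW].
move: IG fG pG => ->; case: E E0 => [w| |] // w0.
  move=> _ pG; exists w => //; rewrite lt0r -lee_fin w0 andbT.
  by apply: contra_neq pG => ->; rewrite mul0e.
move=> + pG; rewrite gt0_mulye ?ltxx // lt0e J0 andbT.
by apply: contra_neq pG => ->; rewrite mule0.
Qed.

Lemma sphere_integral1_gt0 : 0 < sphere_integral 1 (fun _ : 'rV[R]_m.+1 => 1).
Proof. by rewrite sphere_integralE; have [w w0 ->] := sphere_eintegral1. Qed.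

Let abs_pair_bound (a b M q : R) : `|a| <= M -> `|b| <= M -> 0 <= q ->
  `|(a + b) * q| <= M * ((1 + 1) * q).
Proof.
move=> aM bM q0; rewrite normrM (ger0_norm q0) mulrA; apply: ler_wpM2r => //.
by rewrite mulrDr mulr1 (le_trans (ler_normD _ _)) // lerD.
Qed.

(** The weight of the graph is unbounded at the equator, but it is integrable because the sphere
    has finite area. *)
Lemma sphere_integrable r G : 0 < r -> continuous G ->
  (lebesgue_tuple m).-integrable (disc r) (EFin \o (fun t => sphere_integrand G r (row_of_tuple t))).
Proof.
move=> r0 cG; have [M HM] := continuous_bounded_ball r cG.
have i1 : (lebesgue_tuple m).-integrable (disc r)
    (EFin \o (fun t => sphere_integrand (fun=> 1) r (row_of_tuple t))).
  apply/integrableP; split.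
    apply/measurable_EFinP; apply: measurable_funTS.
    by apply: measurable_sphere_integrand; exact: cst_continuous.
  under eq_integral do rewrite /= ger0_norm ?(sphere_integrand_ge0 _ (ltW r0)) //.
  rewrite [ltLHS](@sphere_eintegral_cst r 1) //.
  by have [w w0 ->] := sphere_eintegral1; rewrite -EFinM ltry.
apply: (@le_integrable _ _ _ _ _ (measurable_disc r) _ _ _ _ (integrableZl (measurable_disc r) M i1)).
  apply/measurable_EFinP; apply: measurable_funTS; exact: measurable_sphere_integrand.
move=> t tr; have {}HM z : eucl_norm z = r -> `|G z| <= M.
  by move=> zr; apply: HM; rewrite -zr norm_le_eucl_norm.
have K (e : bool) := HM _ (@eucl_norm_sphere_pt R m r (row_of_tuple t) e (ltW r0) (ltW tr)).
have := K false; have := K true; rewrite /= expr0 expr1 mul1r mulN1r => K1 K2.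
rewrite lee_fin; apply: le_trans (ler_norm _); apply: abs_pair_bound => //.
by rewrite divr_ge0 ?sqrtr_ge0 ?ltW.
Qed.

Lemma sphere_integral_fin r G : 0 < r -> continuous G ->
  sphere_eintegral r G = (sphere_integral r G)%:E.
Proof.
move=> r0 cG; rewrite sphere_integralE fineK //.
by apply: integrable_fin_num; [exact: measurable_disc|exact: sphere_integrable].
Qed.

Lemma sphere_integralB r G H : 0 < r -> continuous G -> continuous H ->
  sphere_integral r (fun z => G z - H z) = sphere_integral r G - sphere_integral r H.
Proof.
move=> r0 cG cH; rewrite !sphere_integralE -!/(Rintegral _ _ _) -RintegralB; first last.
- exact: sphere_integrable.
- exact: sphere_integrable.
- exact: measurable_disc.
by apply: eq_Rintegral => t _; rewrite /sphere_integrand; ring.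
Qed.

Lemma sphere_integralZ r (c : R) G : 0 < r -> continuous G ->
  sphere_integral r (fun z => c * G z) = c * sphere_integral r G.
Proof.
move=> r0 cG; rewrite !sphere_integralE -!/(Rintegral _ _ _) -RintegralZl; first last.
- exact: sphere_integrable.
- exact: measurable_disc.
by apply: eq_Rintegral => t _; rewrite /sphere_integrand; ring.
Qed.

Lemma sphere_integral_cst r (c : R) : 0 < r ->
  sphere_integral r (fun _ : 'rV[R]_m.+1 => c) =
  c * (r ^+ m * sphere_integral 1 (fun _ : 'rV[R]_m.+1 => 1)).
Proof.
move=> r0; have -> : (fun _ : 'rV[R]_m.+1 => c) = fun _ => c * 1 by apply/funext => z; rewrite mulr1.
rewrite sphere_integralZ //; last exact: cst_continuous.
congr (_ * _); apply: EFin_inj; rewrite EFinM -!sphere_integral_fin //; try exact: cst_continuous.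
by rewrite (@sphere_eintegral_cst r 1) // mul1r.
Qed.

Lemma le_sphere_integral r G H : 0 < r -> continuous G -> continuous H ->
  (forall z, eucl_norm z = r -> G z <= H z) -> sphere_integral r G <= sphere_integral r H.
Proof.
move=> r0 cG cH GH; rewrite !sphere_integralE -!/(Rintegral _ _ _); apply: le_Rintegral.
- exact: measurable_disc.
- exact: sphere_integrable.
- exact: sphere_integrable.
move=> t tr.
have K (e : bool) := GH _ (@eucl_norm_sphere_pt R m r (row_of_tuple t) e (ltW r0) (ltW tr)).
have := K false; have := K true; rewrite /= expr0 expr1 mul1r mulN1r => K1 K2.
by apply: ler_wpM2r; [rewrite divr_ge0 ?sqrtr_ge0 ?ltW|exact: lerD].
Qed.

Lemma sphere_integral_bound r G M : 0 < r -> continuous G ->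
  (forall z, eucl_norm z = r -> `|G z| <= M) ->
  `|sphere_integral r G| <= M * (r ^+ m * sphere_integral 1 (fun _ : 'rV[R]_m.+1 => 1)).
Proof.
move=> r0 cG GM; rewrite ler_norml -mulNr -!(sphere_integral_cst _ r0).
have cM c : continuous (fun _ : 'rV[R]_m.+1 => c : R) by exact: cst_continuous.
by apply/andP; split; apply: le_sphere_integral => // z /GM; rewrite ler_norml => /andP[].
Qed.

Lemma sphere_integral_scale r G : 0 < r -> continuous G ->
  sphere_integral r G = r ^+ m * sphere_integral 1 (fun z => G (r *: z)).
Proof.
move=> r0 cG.
pose P z := Num.max 0 (G z); pose N z := Num.max 0 (- G z).
have cP : continuous P by apply: continuous_maxr; [exact: cst_continuous|exact: cG].
have cN : continuous N.
  by apply: continuous_maxr; [exact: cst_continuous|move=> z; apply: continuousN; exact: cG].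
have PN z : G z = P z - N z.
  rewrite /P /N /Num.max; case: ltP => H1; case: ltP => H2; lra.
have cZ (F : 'rV[R]_m.+1 -> R) : continuous F -> continuous (fun z : 'rV[R]_m.+1 => F (r *: z)).
  by move=> cF z; apply: (@continuous_comp _ _ _ ( *:%R r : 'rV[R]_m.+1 -> 'rV[R]_m.+1) F z (@scaler_continuous R _ r z) (cF _)).
have sc (F : 'rV[R]_m.+1 -> R) : continuous F -> (forall z, 0 <= F z) ->
    sphere_integral r F = r ^+ m * sphere_integral 1 (fun z => F (r *: z)).
  move=> cF F0; apply: EFin_inj; rewrite EFinM -!sphere_integral_fin //; last exact: cZ.
  exact: sphere_eintegral_scale_ge0.
rewrite (funext PN) sphere_integralB // !sc //; try by move=> z; rewrite le_max lexx.
rewrite -mulrBr -sphere_integralB //; exact: cZ.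
Qed.

(** After scaling to the unit sphere only the bounded factor depends on the radius, and a multiple
    of the weight dominates the integrand. *)
Lemma sphere_integral_continuous G (a : R) : continuous G -> 0 < a ->
  {for a, continuous (fun r => sphere_integral r G)}.
Proof.
move=> cG a0; have [M HM] := continuous_bounded_ball (a + 1) cG.
pose F (r : R) := \int[lebesgue_tuple m]_(t in disc 1)
   sphere_integrand (fun z => G (r *: z)) 1 (row_of_tuple t).
have cZ (r : R) : continuous (fun z : 'rV[R]_m.+1 => G (r *: z)).
  by move=> z; apply: (@continuous_comp _ _ _ ( *:%R r : 'rV[R]_m.+1 -> 'rV[R]_m.+1) G z (@scaler_continuous R _ r z) (cG _)).
have cl z : continuous (fun r : R => G (r *: z)).
  by move=> r; apply: (@continuous_comp _ _ _ ( *:%R ^~ z : R -> 'rV[R]_m.+1) G r (@scalel_continuous R _ z r) (cG _)).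
have cS y : continuous (fun r : R => sphere_integrand (fun z => G (r *: z)) 1 y).
  by apply: continuous_mul; [exact: continuous_add|exact: cst_continuous].
have cF : {for a, continuous F}.
  apply: (@continuity_under_integral R _ _ (lebesgue_tuple m)
    (fun r t => sphere_integrand (fun z => G (r *: z)) 1 (row_of_tuple t)) (disc 1)
    (measurable_disc 1) 0 (a + 1) _ _
    (fun t => M * sphere_integrand (fun=> 1) 1 (row_of_tuple t))).
  - by move=> r _; apply: sphere_integrable.
  - apply: aeW => t _ r _; exact: cS.
  - under [X in integrable _ _ X]funext => t do rewrite /= EFinM.
    apply: integrableZl; first exact: measurable_disc.
    apply: sphere_integrable => //; exact: cst_continuous.
  - move=> r /=; rewrite in_itv /= => /andP[r0 ra]; apply: aeW => t tr.
    have {}HM z : eucl_norm z = 1 -> `|G (r *: z)| <= M.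
      move=> z1; apply: HM; rewrite (le_trans (norm_le_eucl_norm _)) //.
      by rewrite eucl_normZ ?(ltW r0) // z1 mulr1 ltW.
    have K (e : bool) := HM _ (@eucl_norm_sphere_pt R m 1 (row_of_tuple t) e ler01 (ltW tr)).
    have := K false; have := K true; rewrite /= expr0 expr1 mul1r mulN1r => K1 K2.
    by apply: abs_pair_bound => //; rewrite divr_ge0 ?sqrtr_ge0.
  by rewrite inE /= in_itv /= a0 ltrDl ltr01.
have E : \forall r \near a, r ^+ m * F r = sphere_integral r G.
  near=> r; rewrite sphere_integral_scale //; last by near: r; exact: lt_nbhsr.
  by rewrite sphere_integralE.
have c : r ^+ m * F r @[r --> a] --> a ^+ m * F a.
  by apply: (continuousM _ cF); exact: exprn_continuous.
rewrite (nbhs_singleton E) in c; exact: cvg_trans (near_eq_cvg E) c.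
Unshelve. all: by end_near. Qed.

End sphere_integrals.

(** * Radial cutoff functions *)

Section cutoff.
Context {R : realType}.

(** A remainder that is quadratic at one point suffices for differentiability there, which handles
    the corner of [max] without distinguishing one-sided derivatives. *)
Lemma is_derive_quadratic_bound (f : R -> R) (t l : R) :
  (forall h, `|f (h + t) - f t - h * l| <= h ^+ 2) -> is_derive t 1 f l.
Proof.
move=> fl; suff H : (fun h => h^-1 *: (f (h *: 1 + t) - f t)) @ 0^' --> l.
  by split; [apply/cvg_ex; exists l|exact: cvg_lim].
apply/cvgrPdist_le => e e0; near=> h.
have h0 : h != 0 by near: h; exact: nbhs_dnbhs_neq.
have he : `|h| <= e by near: h; exact: dnbhs0_le.
rewrite [h *: 1]mulr1 [_ *: _]mulrC distrC -(ler_pM2l (_ : 0 < `|h|)) ?normr_gt0 // -normrM.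
rewrite mulrBr mulrCA divff // mulr1 (le_trans (fl h)) //.
by rewrite -(real_normK (num_real h)) expr2 ler_wpM2l.
Unshelve. all: by end_near. Qed.

Definition sqpos (t : R) : R := Num.max t 0 ^+ 2.

(** A C^1 cutoff in terms of the squared radius [s], equal to 1 for [s <= a^2]
    and to 0 for [b^2 <= s]: a quadratic spline with one interior knot. *)
Definition cutoff (a b s : R) : R :=
  (sqpos (b ^+ 2 - s) - 2 * sqpos ((a ^+ 2 + b ^+ 2) / 2 - s) + sqpos (a ^+ 2 - s))
  * (2 / (b ^+ 2 - a ^+ 2) ^+ 2).

Definition bump (a b s : R) : R :=
  (Num.max (b ^+ 2 - s) 0 - 2 * Num.max ((a ^+ 2 + b ^+ 2) / 2 - s) 0 + Num.max (a ^+ 2 - s) 0)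
  * (8 / (b ^+ 2 - a ^+ 2) ^+ 2).

Lemma is_derive_sqpos_sub (c s : R) : is_derive s (1 : R) (fun s => sqpos (c - s)) (- (2 * Num.max (c - s) 0)).
Proof.
apply: is_derive_quadratic_bound => h; rewrite /sqpos ler_norml /Num.max.
by case: (ltP (c - (h + s)) 0) => H1; case: (ltP (c - s) 0) => H2; apply/andP; split; nra.
Qed.

Lemma is_derive_cutoff (a b s : R) : is_derive s (1 : R) (cutoff a b) (- 2^-1 * bump a b s).
Proof.
have d c := is_derive_sqpos_sub c s.
have d2 := is_deriveZ 2 (d ((a ^+ 2 + b ^+ 2) / 2)).
have d3 := is_deriveZ (2 / (b ^+ 2 - a ^+ 2) ^+ 2)
  (is_deriveD (is_deriveB (d (b ^+ 2)) d2) (d (a ^+ 2))).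
have E : cutoff a b = (2 / (b ^+ 2 - a ^+ 2) ^+ 2) \*:
  ((fun s => sqpos (b ^+ 2 - s)) - 2 \*: (fun s => sqpos ((a ^+ 2 + b ^+ 2) / 2 - s))
   + (fun s => sqpos (a ^+ 2 - s))) by apply/funext => t; exact: mulrC.
rewrite E; apply: (is_derive_eq d3); rewrite /bump /GRing.scale /=.
move: (Num.max _ _) (Num.max _ _) (Num.max _ _) (_^-1) => u v w z; lra.
Qed.

Lemma bump_continuous a b : continuous (bump a b).
Proof.
have d c : continuous (fun s : R => Num.max (c - s) 0).
  apply: continuous_maxr; last exact: cst_continuous.
  by apply: continuous_sub => t; [exact: cst_continuous|exact: cvg_id].
apply: continuous_mul; last exact: cst_continuous.
apply: continuous_add; last exact: d.
apply: continuous_sub; first exact: d.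
by apply: continuous_mul; [exact: cst_continuous|exact: d].
Qed.

Lemma cutoff_continuous a b : continuous (cutoff a b).
Proof.
move=> s; apply/differentiable_continuous/derivable1_diffP.
by have [] := is_derive_cutoff a b s.
Qed.

Variables (a b : R).
Hypothesis ab : a ^+ 2 < b ^+ 2.

Let denom_gt0 : 0 < (b ^+ 2 - a ^+ 2) ^+ 2.
Proof. by rewrite exprn_gt0 // subr_gt0. Qed.

Let maxB0 (c s : R) : c <= s -> Num.max (c - s) 0 = 0.
Proof. by move=> cs; apply/max_idPr; rewrite subr_le0. Qed.

Let maxBp (c s : R) : s <= c -> Num.max (c - s) 0 = c - s.
Proof. by move=> cs; apply/max_idPl; rewrite subr_ge0. Qed.

Lemma bump_ge0 s : 0 <= bump a b s.
Proof.
apply: mulr_ge0; last by rewrite divr_ge0 // ltW.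
rewrite /Num.max; by case: (ltP (b ^+ 2 - s) 0) => H1; case: (ltP ((a ^+ 2 + b ^+ 2) / 2 - s) 0) => H2; case: (ltP (a ^+ 2 - s) 0) => H3; lra.
Qed.

Lemma bump_out s : b ^+ 2 <= s -> bump a b s = 0.
Proof.
move=> bs; rewrite /bump !maxB0; first by rewrite mulr0 subr0 addr0 mul0r.
all: move: (ab) bs; move: (a ^+ 2) (b ^+ 2) => A B; lra.
Qed.

Lemma bump_in s : s <= a ^+ 2 -> bump a b s = 0.
Proof.
move=> sa; rewrite /bump !maxBp; try by (move: (ab) sa; move: (a ^+ 2) (b ^+ 2) => A B; lra).
Qed.

Lemma cutoff_out s : b ^+ 2 <= s -> cutoff a b s = 0.
Proof.
move=> bs; rewrite /cutoff /sqpos !maxB0; first by rewrite expr0n mulr0 subr0 addr0 mul0r.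
all: move: (ab) bs; move: (a ^+ 2) (b ^+ 2) => A B; lra.
Qed.

Lemma cutoff_in s : s <= a ^+ 2 -> cutoff a b s = 1.
Proof.
move=> sa; have d0 := lt0r_neq0 denom_gt0.
rewrite /cutoff /sqpos !maxBp; try by (move: (ab) sa; move: (a ^+ 2) (b ^+ 2) => A B; lra).
rewrite [X in X * _](_ : _ = (b ^+ 2 - a ^+ 2) ^+ 2 / 2); last by field.
by rewrite -[2 / _]invf_div divff // mulf_neq0 // invr_eq0 pnatr_eq0.
Qed.

Lemma cutoff_range s : 0 <= cutoff a b s <= 1.
Proof.
have H : 0 <= sqpos (b ^+ 2 - s) - 2 * sqpos ((a ^+ 2 + b ^+ 2) / 2 - s) + sqpos (a ^+ 2 - s)
    <= (b ^+ 2 - a ^+ 2) ^+ 2 / 2.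
  move: ab; rewrite /sqpos /Num.max; move: (a ^+ 2) (b ^+ 2) => A B AB.
  by case: (ltP (B - s) 0) => H1; case: (ltP ((A + B) / 2 - s) 0) => H2; case: (ltP (A - s) 0) => H3; apply/andP; split; nra.
rewrite /cutoff; case/andP: H => H1 H2; apply/andP; split.
  by rewrite mulr_ge0 // divr_ge0 // ltW.
by rewrite -[2 / _]invf_div ler_pdivrMr ?mul1r // divr_gt0.
Qed.

End cutoff.

(** * Fluxes against a radial cutoff *)

Section divergence.
Context {R : realType} {m : nat}.
Local Notation Rm := (measurableTypeR R).
Local Notation leb := (@lebesgue_measure R).

Definition sumsq (x : 'rV[R]_m.+1) : R := \sum_i x 0 i ^+ 2.

Lemma is_derive_sumsq x i : is_derive x 'e_i sumsq (2 * x 0 i).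
Proof.
apply: is_derive_of_line; apply: is_derive_quadratic_bound => h.
have E s : sumsq (s *: 'e_i + x) = sumsq x + s * (2 * x 0 i) + s ^+ 2.
  rewrite /sumsq (bigD1 i) //= [in RHS](bigD1 i) //= !mxE !eqxx mulr1.
  rewrite (eq_bigr (fun j => x 0 j ^+ 2)) => [|j ji]; first by ring.
  by rewrite !mxE (negPf ji) andbF mulr0 add0r.
rewrite addr0 !E (_ : _ - _ = h ^+ 2) ?ger0_norm ?sqr_ge0 //; ring.
Qed.

Lemma sumsq_out (b : R) (x : 'rV[R]_m.+1) : 0 <= b -> b < `|x| -> b ^+ 2 <= sumsq x.
Proof.
move=> b0 bx; rewrite /sumsq -sqr_eucl_norm ler_pXn2r ?nnegrE ?eucl_norm_ge0 //.
by rewrite (le_trans (ltW bx)) // norm_le_eucl_norm.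
Qed.

Definition radial (f : R -> R) (G : 'rV[R]_m.+1 -> R) (x : 'rV[R]_m.+1) : R := f (sumsq x) * G x.

Lemma radial_continuous f G : continuous f -> continuous G -> continuous (radial f G).
Proof.
by move=> cf cG; apply: continuous_mul => //; apply: continuous_after => //; exact: sumsq_continuous.
Qed.

Definition total (G : 'rV[R]_m.+1 -> R) : R := \int[lebesgue_tuple m.+1]_t G (row_of_tuple t).

Definition supported (b : R) (G : 'rV[R]_m.+1 -> R) := forall x, b < `|x| -> G x = 0.

Lemma totalE b G : 0 <= b -> continuous G -> supported b G ->
  (\int[lebesgue_tuple m.+1]_t (G (row_of_tuple t))%:E)%E = (total G)%:E.
Proof.
move=> b0 cG sG; rewrite fineK //; apply: integrable_fin_num => //.
exact: integrable_compact_support b0 cG sG.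
Qed.

Lemma totalD b G K : 0 <= b -> continuous G -> continuous K -> supported b G -> supported b K ->
  total (fun x => G x + K x) = total G + total K.
Proof.
move=> b0 cG cK sG sK; apply: RintegralD => //.
  exact: integrable_compact_support b0 cG sG.
exact: integrable_compact_support b0 cK sK.
Qed.

Lemma totalB b G K : 0 <= b -> continuous G -> continuous K -> supported b G -> supported b K ->
  total (fun x => G x - K x) = total G - total K.
Proof.
move=> b0 cG cK sG sK; apply: RintegralB => //.
  exact: integrable_compact_support b0 cG sG.
exact: integrable_compact_support b0 cK sK.
Qed.

Lemma radial_supported (f : R -> R) b G : 0 <= b -> (forall s, b ^+ 2 <= s -> f s = 0) ->
  supported b (radial f G).
Proof. by move=> b0 f0 x bx; rewrite /radial f0 ?mul0r // sumsq_out. Qed.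

Section vector_field.
Variables (F dF : 'I_m.+1 -> 'rV[R]_m.+1 -> R).
Hypothesis F_derive : forall i x, is_derive x 'e_i (F i) (dF i x).
Hypothesis F_continuous : forall i, continuous (F i).
Hypothesis dF_continuous : forall i, continuous (dF i).

Definition divergence x := \sum_i dF i x.
Definition outward x := \sum_i F i x * x 0 i.

Lemma divergence_continuous : continuous divergence.
Proof. by apply: continuous_bigsum. Qed.

Lemma outward_continuous : continuous outward.
Proof. by apply: continuous_bigsum => i; apply: continuous_mul => //; exact: coord_continuous. Qed.

(** The difference of the two sides is the integral of the divergence of the cutoff times the
    field, which has compact support; [bump] is [-2] times the derivative of the cutoff. *)
Lemma cutoff_divergence (a b : R) : 0 <= b -> a ^+ 2 < b ^+ 2 ->
  total (radial (cutoff a b) divergence) = total (radial (bump a b) outward).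
Proof.
move=> b0 ab.
pose df i x := cutoff a b (sumsq x) * dF i x - bump a b (sumsq x) * (F i x * x 0 i).
have cc := @cutoff_continuous R a b; have cb := @bump_continuous R a b.
have cdf i : continuous (df i).
  apply: continuous_sub; apply: continuous_mul => //.
  - by apply: continuous_after => //; exact: sumsq_continuous.
  - by apply: continuous_after => //; exact: sumsq_continuous.
  - by apply: continuous_mul => //; exact: coord_continuous.
have sdf i : supported b (df i).
  by move=> x bx; rewrite /df cutoff_out ?bump_out ?mul0r ?subr0 //; exact: sumsq_out.
have tdf i : total (df i) = 0.
  apply: EFin_inj; rewrite -(totalE b0) //.
  apply: (@integral_pderiv0 R _ i (radial (cutoff a b) (F i)) (df i) b) => //.
    move=> x; have dc := is_derive_comp1 (is_derive_sumsq x i) (is_derive_cutoff a b (sumsq x)).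
    apply: (is_derive_eq (is_derive_mul dc (F_derive i x))); rewrite /df; lra.
    by apply: radial_supported => // s; exact: cutoff_out.
  exact: sdf.
have t0 (s : seq 'I_m.+1) : total (fun x => \sum_(i <- s) df i x) = 0.
  elim: s => [|i0 s IH].
    rewrite (_ : (fun x => _) = fun=> 0); last by apply/funext => x; rewrite big_nil.
    by rewrite /total Rintegral_cst // mul0r.
  rewrite (_ : (fun x => _) = fun x => df i0 x + \sum_(j <- s) df j x); last first.
    by apply/funext => x; rewrite big_cons.
  have sS : supported b (fun x => \sum_(j <- s) df j x).
    by move=> x bx; rewrite big1 // => j _; exact: sdf.
  by rewrite (totalD b0 (cdf i0) (continuous_bigsum cdf) (sdf i0) sS) tdf IH addr0.
apply/eqP; rewrite -subr_eq0 -(totalB b0); first last.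
- by apply: radial_supported => // s; exact: bump_out.
- by apply: radial_supported => // s; exact: cutoff_out.
- by apply: radial_continuous => //; exact: outward_continuous.
- by apply: radial_continuous => //; exact: divergence_continuous.
apply/eqP; rewrite -[RHS](t0 (index_enum _)); congr total; apply/funext => x.
by rewrite /radial /divergence /outward !mulr_sumr -sumrB.
Qed.

End vector_field.
End divergence.

(** * Weighted averages of fluxes *)

Section divergence_theorem.
Context {R : realType} {m : nat}.
Local Notation Rm := (measurableTypeR R).
Local Notation leb := (@lebesgue_measure R).

(** [bump] integrates to 1 against [r dr], as the cutoff drops from 1 to 0. *)
Lemma bump_weight (a b : R) : 0 <= b -> a ^+ 2 < b ^+ 2 ->
  (\int[leb]_(r in `]0%R, +oo[) (bump a b (r ^+ 2) * r)%R%:E = 1)%E.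
Proof.
move=> b0 ab; pose F (r : R) : R := - cutoff a b (r ^+ 2).
have csq : continuous (fun r : R => r ^+ 2) by exact: exprn_continuous.
have cw : continuous (fun r : R => bump a b (r ^+ 2) * r).
  apply: continuous_mul; last by move=> r; exact: cvg_id.
  by apply: continuous_after => //; exact: bump_continuous.
have cF : continuous F.
  by move=> r; apply: cvgN; apply: (continuous_after (@cutoff_continuous R a b) csq).
have dF (r : R) : is_derive r (1 : R) F (bump a b (r ^+ 2) * r).
  have dsq := DeriveDef (@exprn_derivable R 2 r 1) (@exp_derive R 2 r 1).
  have d := is_deriveN (is_derive1_comp (g := fun r : R => r ^+ 2) (is_derive_cutoff a b (r ^+ 2)) dsq).
  apply: (is_derive_eq d); rewrite /GRing.scale /= expr1.
  by move: (bump _ _ _) => w; field.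
rewrite integral_itv_obnd_cbnd; last by apply/measurable_EFinP; apply: measurable_funTS; exact: continuous_measurable_fun.
rewrite (@ge0_continuous_FTC2y R _ F 0 0).
- by rewrite /F expr0n cutoff_in ?sqr_ge0 // -EFinB opprK add0r.
- by move=> r r0; rewrite mulr_ge0 // bump_ge0.
- exact: continuous_subspaceT.
- apply: cvg_near_cst; near=> r; rewrite /F cutoff_out ?oppr0 //.
  have br : b <= r by near: r; apply: nbhs_pinfty_ge; exact: num_real.
  by rewrite ler_pXn2r ?nnegrE // (le_trans b0 br).
- by move=> r _; have [] := dF r.
- by apply: cvg_at_right_filter; exact: cF.
- by move=> r _; rewrite derive1E; exact: derive_val.
Unshelve. all: by end_near. Qed.

Variable H : 'rV[R]_m.+1 -> R.
Hypothesis cH : continuous H.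

Lemma sphere_integral_radial (f : R -> R) (K : 'rV[R]_m.+1 -> R) (r : R) : 0 < r -> continuous K ->
  sphere_integral r (radial f K) = f (r ^+ 2) * sphere_integral r K.
Proof.
move=> r0 cK; rewrite -sphere_integralZ //; apply: eq_sphere_integral => z zr.
by rewrite /radial /sumsq -sqr_eucl_norm zr.
Qed.

Lemma polar_radial_bump (a b : R) (K : 'rV[R]_m.+1 -> R) : 0 <= b -> a ^+ 2 < b ^+ 2 -> continuous K ->
  (forall z, `|z| <= b -> 0 <= K z) ->
  ((total (radial (bump a b) K))%:E =
   \int[leb]_(r in `]0%R, +oo[) (bump a b (r ^+ 2) * sphere_integral r K)%R%:E)%E.
Proof.
move=> b0 ab cK K0; have cb := @bump_continuous R a b.
have cG := radial_continuous cb cK.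
rewrite -(totalE b0 cG); last by apply: radial_supported => // s; exact: bump_out.
rewrite polar_coordinates //.
  apply: eq_integral => r; rewrite inE /= in_itv /= andbT => r0.
  by rewrite sphere_integral_fin // sphere_integral_radial.
move=> z; have [zb|zb] := leP `|z| b; first by rewrite mulr_ge0 ?bump_ge0 ?K0.
by rewrite /radial bump_out ?mul0r // sumsq_out.
Qed.

(** The total of [radial (bump a b) H] is an average of [r^-1 * sphere_integral r H]
    over [a <= r <= b]. Adding a large constant to [H] makes Tonelli applicable. *)
Lemma bump_average_le (a b c : R) : 0 <= a < b ->
  (forall r, a <= r <= b -> 0 < r -> sphere_integral r H <= c * r) ->
  total (radial (bump a b) H) <= c.
Proof.
move=> /andP[a0 ab] Hc; have b0 : 0 <= b by rewrite ltW // (le_lt_trans a0).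
have ab2 : a ^+ 2 < b ^+ 2 by rewrite ltr_pXn2r ?nnegrE.
have cb := @bump_continuous R a b.
have [M0 HM0] := continuous_bounded_ball b cH.
pose M := Num.max M0 0; have M_ge0 : 0 <= M by rewrite le_max lexx orbT.
have HM z : `|z| <= b -> `|H z| <= M by move=> /HM0 /le_trans; apply; rewrite le_max lexx.
(* [c] is split into its positive and negative parts, so that every integral below
   has a nonnegative integrand. *)
pose c1 := Num.max c 0; pose c2 := Num.max (- c) 0.
have c1_ge0 : 0 <= c1 by rewrite le_max lexx orbT.
have c2_ge0 : 0 <= c2 by rewrite le_max lexx orbT.
have cE : c = c1 - c2 by rewrite /c1 /c2 /Num.max; case: ltP => h1; case: ltP => h2; lra.
have cM (M1 : R) : continuous (fun _ : 'rV[R]_m.+1 => M1) by exact: cst_continuous.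
pose K z := H z - - M.
have cK : continuous K by apply: continuous_sub.
have K0 z : `|z| <= b -> 0 <= K z by move=> /HM; rewrite ler_norml /K opprK -lerBlDr sub0r => /andP[].
have sK (r : R) : 0 < r -> sphere_integral r K =
    sphere_integral r H + M * (r ^+ m * sphere_integral 1 (fun _ : 'rV[R]_m.+1 => 1)).
  by move=> r0; rewrite sphere_integralB // (sphere_integral_cst _ r0) mulNr opprK.
have T : total (radial (bump a b) H) =
    total (radial (bump a b) K) - total (radial (bump a b) (fun _ : 'rV[R]_m.+1 => M)).
  rewrite -(totalB b0); try exact: radial_continuous; last 2 first.
  - by apply: radial_supported => // s; exact: bump_out.
  - by apply: radial_supported => // s; exact: bump_out.
  by congr total; apply/funext => x; rewrite /radial /K; ring.
rewrite T cE lerBlDr addrAC lerBrDr -lee_fin !EFinD.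
rewrite (polar_radial_bump b0 ab2 cK K0) (polar_radial_bump b0 ab2 (cM M)) //.
have w0 (r : R) : 0 < r -> 0 <= bump a b (r ^+ 2) * r by move=> r0; rewrite mulr_ge0 ?bump_ge0 // ltW.
have mw : measurable_fun (`]0%R, +oo[%classic : set Rm) (fun r : Rm => bump a b (r ^+ 2) * r).
  apply: measurable_funTS; apply: continuous_measurable_fun.
  apply: continuous_mul; last by move=> r; exact: cvg_id.
  by apply: continuous_after => //; exact: exprn_continuous.
have mS (L : 'rV[R]_m.+1 -> R) : continuous L ->
    measurable_fun (`]0%R, +oo[%classic : set Rm) (fun r : Rm => bump a b (r ^+ 2) * sphere_integral r L).
  move=> cL; apply: measurable_funM.
    apply: measurable_funTS; apply: continuous_measurable_fun.
    by apply: continuous_after => //; exact: exprn_continuous.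
  apply: open_continuous_measurable_fun; first exact: interval_open.
  move=> r; rewrite inE /= in_itv /= andbT => r0; exact: sphere_integral_continuous.
have S0 (L : 'rV[R]_m.+1 -> R) (r : R) : continuous L -> (forall z, `|z| <= b -> 0 <= L z) -> 0 < r ->
    0 <= bump a b (r ^+ 2) * sphere_integral r L.
  move=> cL L0 r0; have [rb|br] := leP r b; last first.
    by rewrite bump_out ?mul0r // ler_pXn2r ?nnegrE ?(ltW r0) ?(ltW br).
  rewrite mulr_ge0 ?bump_ge0 // -[leLHS](mul0r (r ^+ m * sphere_integral 1 (fun _ : 'rV[R]_m.+1 => 1))).
  rewrite -sphere_integral_cst //; apply: le_sphere_integral => // z zr.
  by apply: L0; rewrite (le_trans (norm_le_eucl_norm _)) // zr.
have W (d : R) : 0 <= d ->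
    (d%:E = \int[leb]_(r in `]0%R, +oo[) (d * (bump a b (r ^+ 2) * r))%R%:E)%E.
  move=> d0; under eq_integral do rewrite EFinM.
  rewrite ge0_integralZl_EFin ?bump_weight ?mule1 //.
  - by move=> r /=; rewrite in_itv /= andbT lee_fin; exact: w0.
  - exact/measurable_EFinP.
rewrite [X in (_ + X <= _)%E](W _ c2_ge0) [X in (_ <= X + _)%E](W _ c1_ge0).
have md d : measurable_fun (`]0%R, +oo[%classic : set Rm) (fun r : Rm => (d * (bump a b (r ^+ 2) * r))%:E).
  by apply/measurable_EFinP; apply: measurable_funM => //; exact: measurable_cst.
have pK (r : R) : `]0%R, +oo[%classic r -> (0 <= (bump a b (r ^+ 2) * sphere_integral r K)%R%:E)%E.
  by rewrite /= in_itv /= andbT => r0; rewrite lee_fin S0.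
have pM (r : R) : `]0%R, +oo[%classic r ->
    (0 <= (bump a b (r ^+ 2) * sphere_integral r (fun _ : 'rV[R]_m.+1 => M))%R%:E)%E.
  by rewrite /= in_itv /= andbT => r0; rewrite lee_fin S0.
have pd (d r : R) : 0 <= d -> `]0%R, +oo[%classic r -> (0 <= (d * (bump a b (r ^+ 2) * r))%R%:E)%E.
  by move=> d0; rewrite /= in_itv /= andbT => r0; rewrite lee_fin mulr_ge0 ?w0.
have mK := mS K cK; have mM := mS _ (cM M).
rewrite -!ge0_integralD //; try exact/measurable_EFinP; try by move=> r; exact: pd.
apply: ge0_le_integral => //.
- by move=> r r0; rewrite adde_ge0 ?pK ?pd.
- by apply: emeasurable_funD => //; exact/measurable_EFinP.
- by apply: emeasurable_funD => //; exact/measurable_EFinP.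
move=> r; rewrite /= in_itv /= andbT => r0; rewrite -!EFinD lee_fin.
have [ra|ar] := leP r a.
  by rewrite bump_in ?mul0r ?mulr0 ?addr0 // ler_pXn2r ?nnegrE ?(ltW r0).
have [rb|br] := leP r b; last first.
  by rewrite bump_out ?mul0r ?mulr0 ?addr0 // ler_pXn2r ?nnegrE ?(ltW r0) ?(ltW br).
have := Hc r; rewrite (ltW ar) rb => /(_ isT r0) sH.
rewrite sK // (sphere_integral_cst _ r0).
have := bump_ge0 ab2 (r ^+ 2); move: sH; rewrite cE; clear.
move: (bump _ _ _) (sphere_integral r H) (M * _) => B s X sH B0.
rewrite -subr_ge0 (_ : _ - _ = B * ((c1 - c2) * r - s)); last by ring.
by rewrite mulr_ge0 // subr_ge0.
Qed.

End divergence_theorem.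

(** * The divergence theorem on balls *)

Section ball_flux.
Context {R : realType} {m : nat}.
Local Notation Rm := (measurableTypeR R).
Variables (F dF : 'I_m.+1 -> 'rV[R]_m.+1 -> R).
Hypothesis F_derive : forall i x, is_derive x 'e_i (F i) (dF i x).
Hypothesis F_continuous : forall i, continuous (F i).
Hypothesis dF_continuous : forall i, continuous (dF i).
Hypothesis dF_ge0 : forall x, 0 <= divergence dF x.

Definition ball_flux (r : R) : R := r^-1 * sphere_integral r (outward F).

Definition closed_ball0 (r : R) : set (m.+1.-tuple Rm) := [set t | eucl_norm (row_of_tuple t) <= r].

Lemma measurable_closed_ball0 r : measurable (closed_ball0 r).
Proof.
rewrite (_ : closed_ball0 r = ~` [set t | [set x | r < eucl_norm x] (row_of_tuple t)]).
  apply: measurableC; apply: measurable_row_open.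
  by apply: (@open_comp _ _ (@eucl_norm R m.+1) [set t | r < t]) => [y _|];
    [exact: eucl_norm_continuous|exact: open_gt].
by apply/seteqP; split=> t; rewrite /closed_ball0 /= leNgt => /negP.
Qed.

Lemma ball_flux_continuous r : 0 < r -> {for r, continuous ball_flux}.
Proof.
move=> r0; apply: continuousM; first by apply: continuousV; [rewrite gt_eqF|exact: cvg_id].
exact: (sphere_integral_continuous (outward_continuous F_continuous) r0).
Qed.

Let mdiv : measurable_fun setT (fun t : m.+1.-tuple Rm => (divergence dF (row_of_tuple t))%:E).
Proof.
apply/measurable_EFinP; apply: measurable_row_continuous; exact: divergence_continuous.
Qed.

Let radial_ball (a b r : R) (t : m.+1.-tuple Rm) : 0 <= r -> eucl_norm (row_of_tuple t) <= r ->
  sumsq (row_of_tuple t) <= r ^+ 2.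
Proof. by move=> r0 tr; rewrite /sumsq -sqr_eucl_norm ler_pXn2r ?nnegrE ?eucl_norm_ge0. Qed.

Let ball_le_cutoff (a b : R) : 0 <= a < b ->
  (\int[lebesgue_tuple m.+1]_(t in closed_ball0 a) (divergence dF (row_of_tuple t))%:E
   <= (total (radial (cutoff a b) (divergence dF)))%:E)%E.
Proof.
move=> /andP[a0 ab]; have b0 : 0 <= b by rewrite ltW // (le_lt_trans a0).
have ab2 : a ^+ 2 < b ^+ 2 by rewrite ltr_pXn2r ?nnegrE.
have cD := divergence_continuous dF_continuous.
have cR := radial_continuous (@cutoff_continuous R a b) cD.
rewrite -(totalE b0 cR); last by apply: radial_supported => // s; exact: cutoff_out.
rewrite integral_mkcond; apply: ge0_le_integral => //.
- by move=> t _; rewrite patchE; case: ifP => // _; rewrite lee_fin.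
- apply/(measurable_restrictT _ (measurable_closed_ball0 a)); exact: measurable_funTS.
- by apply/measurable_EFinP; exact: measurable_row_continuous.
move=> t _; rewrite patchE; case: ifPn => [|_].
  rewrite inE /closed_ball0 /= => ta.
  by rewrite /radial cutoff_in ?mul1r // (radial_ball _ _ a0).
by rewrite lee_fin mulr_ge0 //; have /andP[] := cutoff_range ab2 (sumsq (row_of_tuple t)).
Qed.

Let cutoff_le_ball (a b : R) : 0 <= a < b ->
  ((total (radial (cutoff a b) (divergence dF)))%:E
   <= \int[lebesgue_tuple m.+1]_(t in closed_ball0 b) (divergence dF (row_of_tuple t))%:E)%E.
Proof.
move=> /andP[a0 ab]; have b0 : 0 <= b by rewrite ltW // (le_lt_trans a0).
have ab2 : a ^+ 2 < b ^+ 2 by rewrite ltr_pXn2r ?nnegrE.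
have cD := divergence_continuous dF_continuous.
have cR := radial_continuous (@cutoff_continuous R a b) cD.
rewrite -(totalE b0 cR); last by apply: radial_supported => // s; exact: cutoff_out.
rewrite [leRHS]integral_mkcond; apply: ge0_le_integral => //.
- move=> t _; rewrite lee_fin mulr_ge0 //.
  by have /andP[] := cutoff_range ab2 (sumsq (row_of_tuple t)).
- by apply/measurable_EFinP; exact: measurable_row_continuous.
- apply/(measurable_restrictT _ (measurable_closed_ball0 b)); exact: measurable_funTS.
move=> t _; rewrite patchE; case: ifPn => [_|].
  rewrite lee_fin -[leRHS]mul1r ler_wpM2r //.
  by have /andP[] := cutoff_range ab2 (sumsq (row_of_tuple t)).
rewrite notin_setE /closed_ball0 /= => /negP; rewrite -ltNge => bt.
rewrite /radial cutoff_out ?mul0r // /sumsq -sqr_eucl_norm ler_pXn2r ?nnegrE ?eucl_norm_ge0 //.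
exact: ltW.
Qed.

(** Testing the divergence against a cutoff between two radii gives an average of the
    fluxes through the spheres between them. As the flux depends continuously on the
    radius, letting the cutoff shrink to the ball of radius [r] from outside and from
    inside yields the two inequalities. *)
Theorem divergence_theorem (r : R) : 0 < r ->
  ((ball_flux r)%:E =
   \int[lebesgue_tuple m.+1]_(t in closed_ball0 r) (divergence dF (row_of_tuple t))%:E)%E.
Proof.
move=> r0; have cH := outward_continuous F_continuous; have cf := ball_flux_continuous r0.
have near_r (e : R) : 0 < e -> exists2 d, 0 < d < r &
    forall s, `|r - s| <= d -> ball_flux r - e <= ball_flux s <= ball_flux r + e.
  move=> e0; have /cvgrPdist_le/(_ e e0)/nbhs_ballP[d /= d0 dP] := cf.
  exists (Num.min (d / 2) (r / 2)); first by rewrite lt_min gt_min; apply/andP; split; [|apply/orP; right]; lra.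
  move=> s; rewrite le_min => /andP[sd _]; have /dP /= : ball r d s.
    rewrite -ball_normE /ball_ /=; lra.
  by rewrite ler_distl => /andP[? ?]; apply/andP; split; lra.
have fluxE (s : R) : 0 < s -> sphere_integral s (outward F) = ball_flux s * s.
  by move=> s0; rewrite /ball_flux mulrAC mulVf ?mul1r // gt_eqF.
apply/eqP; rewrite eq_le; apply/andP; split.
  apply/lee_addgt0Pr => e e0; have [d /andP[d0 dr] dP] := near_r e e0.
  have ab : 0 <= r - d < r by apply/andP; split; lra.
  have ab2 : (r - d) ^+ 2 < r ^+ 2 by rewrite ltr_pXn2r ?nnegrE //; lra.
  rewrite -leeBlDr //; apply: le_trans (cutoff_le_ball ab).
  rewrite (cutoff_divergence F_derive) //; last exact: ltW.
  rewrite -EFinB lee_fin -lerN2.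
  have -> : - total (radial (bump (r - d) r) (outward F)) =
      total (radial (bump (r - d) r) (fun x => 0 - outward F x)).
    rewrite -[LHS]mulN1r /total -RintegralZl //.
      by apply: eq_Rintegral => t _; rewrite /radial; ring.
    apply: (integrable_compact_support (ltW r0)).
      by apply: radial_continuous; [exact: bump_continuous|].
    by apply: radial_supported => [|s]; [exact: ltW|exact: bump_out].
  apply: bump_average_le => //; first by apply: continuous_sub => //; exact: cst_continuous.
  move=> s /andP[s1 s2] s0; rewrite sphere_integralB //; last exact: cst_continuous.
  rewrite sphere_integral_cst // mul0r sub0r fluxE // -mulNr ler_wpM2r ?(ltW s0) // lerN2.
  by have /dP/andP[] : `|r - s| <= d by rewrite ler_distl; apply/andP; split; lra.
apply/lee_addgt0Pr => e e0; have [d /andP[d0 dr] dP] := near_r e e0.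
have ab : 0 <= r < r + d by apply/andP; split; lra.
have ab2 : r ^+ 2 < (r + d) ^+ 2 by rewrite ltr_pXn2r ?nnegrE //; lra.
apply: le_trans (ball_le_cutoff ab) _.
rewrite (cutoff_divergence F_derive) //; last lra.
rewrite -EFinD lee_fin; apply: bump_average_le => // s /andP[s1 s2] s0.
rewrite fluxE // ler_wpM2r ?(ltW s0) //.
by have /dP/andP[] : `|r - s| <= d by rewrite ler_distl; apply/andP; split; lra.
Qed.

Lemma ball_flux_ge0 r : 0 < r -> 0 <= ball_flux r.
Proof.
by move=> r0; rewrite -lee_fin divergence_theorem //; apply: integral_ge0 => t _; rewrite lee_fin.
Qed.

Lemma ball_flux_le r s : 0 < r -> r <= s -> ball_flux r <= ball_flux s.
Proof.
move=> r0 rs; rewrite -lee_fin !divergence_theorem // ?(lt_le_trans r0) //.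
apply: ge0_subset_integral; try exact: measurable_closed_ball0.
- exact: measurable_funTS.
- by move=> t _; rewrite lee_fin.
- by move=> t /= /le_trans; apply.
Qed.

(** The fluxes increase with the radius, being integrals of a nonnegative function over
    growing balls, so a vanishing limit forces that continuous function to vanish. *)
Lemma ball_flux_cvg :
  (\int[lebesgue_tuple m.+1]_t (divergence dF (row_of_tuple t))%:E < +oo)%E ->
  exists L, [/\ ball_flux r @[r --> +oo] --> L, 0 <= L & L = 0 -> forall x, divergence dF x = 0].
Proof.
set I := (\int[_]_t _)%E => Ioo.
have I0 : (0 <= I)%E by apply: integral_ge0 => t _; rewrite lee_fin.
pose A := [set ball_flux r | r in [set r | 0 < r]].
have Aub : has_sup A.
  split; first by exists (ball_flux 1), 1 => //=.
  exists (fine I) => _ [r r0 <-]; rewrite -lee_fin fineK ?ge0_fin_numE // divergence_theorem //.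
  rewrite /I; apply: ge0_subset_integral => //; first exact: measurable_closed_ball0.
  by move=> t _; rewrite lee_fin.
have le_sup r : 0 < r -> ball_flux r <= sup A.
  by move=> r0; apply: ub_le_sup; [case: Aub|exists r].
exists (sup A); split.
- apply/cvgrPdist_le => e e0; have [_ [r /= r0 <-] re] := sup_adherent e0 Aub.
  near=> s; have rs : r <= s by near: s; apply: nbhs_pinfty_ge; exact: num_real.
  have s0 : 0 < s by exact: lt_le_trans rs.
  have := le_sup s s0; have := ball_flux_le r0 rs; rewrite ler_norml => h1 h2.
  by apply/andP; split; lra.
- by apply: le_trans (le_sup 1 ltr01); exact: ball_flux_ge0.
move=> A0 x; pose a := eucl_norm x; have a0 : 0 <= a by exact: eucl_norm_ge0.
have ab : 0 <= a < a + 1 by rewrite a0 ltrDl ltr01.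
have b0 : 0 < a + 1 by rewrite ltr_wpDl.
have ab2 : a ^+ 2 < (a + 1) ^+ 2 by rewrite ltr_pXn2r ?nnegrE //; lra.
have cD := divergence_continuous dF_continuous.
have cR := radial_continuous (@cutoff_continuous R a (a + 1)) cD.
have R0 y : 0 <= radial (cutoff a (a + 1)) (divergence dF) y.
  by rewrite mulr_ge0 //; have /andP[] := cutoff_range ab2 (sumsq y).
have T0 : (\int[lebesgue_tuple m.+1]_t (radial (cutoff a (a + 1)) (divergence dF) (row_of_tuple t))%:E = 0)%E.
  apply/eqP; rewrite eq_le; apply/andP; split; last by apply: integral_ge0 => t _; rewrite lee_fin.
  rewrite (totalE (ltW b0) cR); last by apply: radial_supported => [|s]; [exact: ltW|exact: cutoff_out].
  apply: le_trans (cutoff_le_ball ab) _; rewrite -divergence_theorem // lee_fin -A0; exact: le_sup.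
have := integral_eq0_continuous cR R0 T0 x.
by rewrite /radial cutoff_in ?mul1r // /sumsq -sqr_eucl_norm.
Unshelve. all: by end_near. Qed.

End ball_flux.

(** * Decay and integrability *)

Section decay_rates.
Context {R : realType}.
Local Notation Rm := (measurableTypeR R).
Local Notation leb := (@lebesgue_measure R).

Lemma powR_cvg_pinfty (s : R) : 0 < s -> r `^ (- s) @[r --> +oo] --> (0 : R).
Proof.
move=> s0; apply/cvgrPdist_le => e e0; near=> r.
have er : e^-1 `^ s^-1 <= r by near: r; apply: nbhs_pinfty_ge; exact: num_real.
have e'0 : 0 < e^-1 `^ s^-1 by rewrite powR_gt0 ?invr_gt0.
have r0 : 0 < r by exact: lt_le_trans er.
have rs : e^-1 <= r `^ s.
  have <- : (e^-1 `^ s^-1) `^ s = e^-1 by rewrite -powRrM mulVf ?gt_eqF // powRr1 ?invr_ge0 ?ltW.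
  by apply: ge0_ler_powR => //; rewrite ?nnegrE ltW.
rewrite sub0r normrN ger0_norm ?powR_ge0 // powRN -[leRHS]invrK lef_pV2 ?posrE ?powR_gt0 //.
by rewrite invr_gt0.
Unshelve. all: by end_near. Qed.

(** An explicit primitive tends to 0 at infinity. *)
Lemma integral_powR_tail (a q : R) : 0 < a -> 1 < q ->
  (\int[leb]_(r in `[a, +oo[) (r `^ (- q))%:E < +oo)%E.
Proof.
move=> a0 q1; pose F (r : R) : R := - (q - 1)^-1 * r `^ (- (q - 1)).
have q10 : 0 < q - 1 by rewrite subr_gt0.
have dF (r : R) : 0 < r -> is_derive r (1 : R) F (r `^ (- q)).
  move=> r0; have d := is_deriveZ (- (q - 1)^-1) (@is_derive1_powR R (- (q - 1)) r r0).
  apply: (is_derive_eq d); rewrite /GRing.scale /=.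
  rewrite (_ : - (q - 1) - 1 = - q); last by ring.
  by field; rewrite subr_eq0 gt_eqF.
have cF (r : R) : 0 < r -> {for r, continuous F}.
  by move=> r0; apply/differentiable_continuous/derivable1_diffP; have [] := dF r r0.
have cp (r : R) : 0 < r -> {for r, continuous (fun r : R => r `^ (- q))}.
  move=> r0; apply/differentiable_continuous/derivable1_diffP.
  by have [] := @is_derive1_powR R (- q) r r0.
rewrite (@ge0_continuous_FTC2y R _ F a 0) ?ltry //.
- by move=> r _; exact: powR_ge0.
- apply: continuous_in_subspaceT => r; rewrite inE /= in_itv /= andbT => ar.
  by apply: cp; exact: lt_le_trans ar.
- rewrite -(mulr0 (- (q - 1)^-1)); apply: cvgM; first exact: cvg_cst.
  exact: powR_cvg_pinfty.
- by move=> r ar; have [] := dF r (lt_trans a0 ar).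
- by apply: cvg_at_right_filter; exact: cF.
- move=> r; rewrite in_itv /= andbT => ar; rewrite derive1E.
  by have H := dF r (lt_trans a0 ar); rewrite derive_val.
Qed.

(** Integrability at infinity, read off in polar coordinates. *)
Lemma integral_decay m (G : 'rV[R]_m.+1 -> R) (C r0 p : R) :
  continuous G -> (forall x, 0 <= G x) -> 0 <= C -> 1 <= r0 -> m.+1%:R < p ->
  (forall x, r0 <= eucl_norm x -> G x <= C * eucl_norm x `^ (- p)) ->
  (\int[lebesgue_tuple m.+1]_t (G (row_of_tuple t))%:E < +oo)%E.
Proof.
move=> cG G0 C0 r01 mp Gp; have r0_gt0 : 0 < r0 by exact: lt_le_trans r01.
have [M HM] := continuous_bounded_ball r0 cG.
have M0 : 0 <= M by apply: le_trans (HM 0 _); rewrite ?normr_ge0 ?normr0 ?ltW.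
set w := sphere_integral 1 (fun _ : 'rV[R]_m.+1 => 1).
have w0 : 0 < w by exact: sphere_integral1_gt0.
pose S (r : R) : R := sphere_integral r G.
have S0 r : 0 < r -> 0 <= S r.
  move=> rp; rewrite -[leLHS](mul0r (r ^+ m * w)) -sphere_integral_cst //.
  by apply: le_sphere_integral => //; exact: cst_continuous.
have mS (D : set Rm) : measurable D -> D `<=` `]0%R, +oo[%classic ->
    measurable_fun D (fun r : Rm => (S r)%:E).
  move=> mD D0; apply/measurable_EFinP; apply: measurable_funS D0 _ => //.
  apply: open_continuous_measurable_fun; first exact: interval_open.
  move=> r; rewrite inE /= in_itv /= andbT => rp; exact: sphere_integral_continuous.
rewrite polar_coordinates //.
have -> : (\int[leb]_(r in `]0%R, +oo[) sphere_eintegral r G =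
    \int[leb]_(r in `]0%R, r0[ `|` `[r0, +oo[) (S r)%:E)%E.
  rewrite -itv_bndbnd_setU ?bnd_simp //; apply: eq_integral => r.
  by rewrite inE /= in_itv /= andbT => rp; rewrite sphere_integral_fin.
have sub1 : `]0%R, r0[%classic `<=` (`]0%R, +oo[%classic : set R).
  by move=> r; rewrite /= !in_itv /= andbT => /andP[].
have sub2 : `[r0, +oo[%classic `<=` (`]0%R, +oo[%classic : set R).
  by move=> r; rewrite /= !in_itv /= !andbT; exact: lt_le_trans.
rewrite ge0_integral_setU //; last 3 first.
- by apply: mS; [exact: measurableU|rewrite subUset].
- by move=> r [/sub1|/sub2]; rewrite /= in_itv /= andbT lee_fin; exact: S0.
- rewrite disj_set2E; apply/eqP/seteqP; split=> r //= [].
  by rewrite !in_itv /= andbT => /andP[_]; rewrite leNgt => ->.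
apply: lte_add_pinfty.
  apply: (@le_lt_trans _ _ (\int[leb]_(r in `]0%R, r0[) (M * (r0 ^+ m * w))%:E)%E).
    apply: ge0_le_integral => //.
    - by move=> r /sub1; rewrite /= in_itv /= andbT lee_fin; exact: S0.
    - exact: mS.
    move=> r; rewrite /= in_itv /= => /andP[rp rr]; rewrite lee_fin.
    apply: (@le_trans _ _ (M * (r ^+ m * w))).
      rewrite -sphere_integral_cst //; apply: le_sphere_integral => //; first exact: cst_continuous.
      move=> z zr; apply: le_trans (ler_norm _) (HM _ _).
      by rewrite (le_trans (norm_le_eucl_norm _)) // zr ltW.
    by rewrite ler_wpM2l // ler_wpM2r ?(ltW w0) // lerXn2r ?nnegrE ?ltW.
  by rewrite integral_cst //= lebesgue_measure_itv /= lte_fin r0_gt0 -EFinM ltry.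
apply: (@le_lt_trans _ _ (\int[leb]_(r in `[r0, +oo[) (C * w * r `^ (- (p - m%:R)))%R%:E)%E).
  apply: ge0_le_integral => //.
  - by move=> r /sub2; rewrite /= in_itv /= andbT lee_fin; exact: S0.
  - exact: mS.
  - apply/measurable_EFinP; apply: measurable_funM; first exact: measurable_cst.
    by apply: measurable_funTS; exact: measurable_powR.
  move=> r rr; have := sub2 r rr; move: rr; rewrite /= !in_itv /= !andbT => rr rp.
  rewrite lee_fin.
  apply: (@le_trans _ _ (C * r `^ (- p) * (r ^+ m * w))).
    rewrite -sphere_integral_cst //; apply: le_sphere_integral => //; first exact: cst_continuous.
    by move=> z zr; rewrite -zr; apply: Gp; rewrite zr.
  rewrite opprB powRD ?powR_mulrn ?(ltW rp) //; last by rewrite (gt_eqF rp) implybT.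
  by rewrite le_eqVlt; apply/orP; left; apply/eqP; ring.
under eq_integral do rewrite EFinM.
rewrite ge0_integralZl_EFin //.
- apply: lte_mul_pinfty; [by rewrite lee_fin mulr_ge0 ?(ltW w0)|by []|].
  apply: integral_powR_tail => //; rewrite ltrBrDl; move: mp; by rewrite -natr1.
- by move=> r _; rewrite lee_fin powR_ge0.
- by apply/measurable_EFinP; apply: measurable_funTS; exact: measurable_powR.
- by rewrite mulr_ge0 ?(ltW w0).
Qed.

End decay_rates.

(** * Asymptotics of the curvature *)

Section asymptotics.
Context {R : realType} {n : nat}.
Implicit Types (u : 'rV[R]_n -> R) (x : 'rV[R]_n) (i j : 'I_n) (tau : R).

Lemma norm_le_sqrt_sum (I : finType) (f : I -> R) (a : I) : (forall b, 0 <= f b) ->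
  Num.sqrt (f a) <= Num.sqrt (\sum_b f b).
Proof. by move=> f0; rewrite ler_wsqrtr // (bigD1 a) //= lerDl sumr_ge0. Qed.

Lemma pderiv_le_grad_norm u i x : `|pderiv i u x| <= grad_norm u x.
Proof.
rewrite -sqrtr_sqr; apply: (norm_le_sqrt_sum (f := fun i => pderiv i u x ^+ 2)) => j.
exact: sqr_ge0.
Qed.

Lemma pderiv_le_hess_norm u i j x : `|pderiv i (pderiv j u) x| <= hess_norm u x.
Proof.
have sq0 i1 j1 : 0 <= pderiv i1 (pderiv j1 u) x ^+ 2 by exact: sqr_ge0.
rewrite -sqrtr_sqr; apply: (@le_trans _ _ (Num.sqrt (\sum_j pderiv i (pderiv j u) x ^+ 2))).
  exact: (norm_le_sqrt_sum (f := fun j => pderiv i (pderiv j u) x ^+ 2)).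
apply: (norm_le_sqrt_sum (f := fun i => \sum_j pderiv i (pderiv j u) x ^+ 2)) => i1.
exact: sumr_ge0.
Qed.

Lemma decay_split (a b c r s : R) : 0 < r -> 0 <= a -> 0 <= b -> 0 <= c ->
  a + r * b + r ^+ 2 * c <= s -> [/\ a <= s, b <= s / r & c <= s / r ^+ 2].
Proof.
move=> r0 a0 b0 c0 H.
have rb : 0 <= r * b by rewrite mulr_ge0 // ltW.
have rc : 0 <= r ^+ 2 * c by rewrite mulr_ge0 // exprn_ge0 // ltW.
by split; rewrite ?ler_pdivlMr ?exprn_gt0 // 1?[_ * r]mulrC 1?[c * _]mulrC; lra.
Qed.

Lemma AF_decay u tau : 0 < tau -> asymptotically_flat_CF tau u ->
  exists C r0, [/\ 0 <= C, 1 <= r0 & forall x, r0 <= eucl_norm x ->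
    [/\ 0 < eucl_norm x `^ (- tau) <= 1,
        `|u x| <= C * eucl_norm x `^ (- tau),
        forall i, `|pderiv i u x| <= C * (eucl_norm x `^ (- tau) / eucl_norm x) &
        forall i j, `|pderiv i (pderiv j u) x| <= C * (eucl_norm x `^ (- tau) / eucl_norm x ^+ 2)]].
Proof.
move=> tau0 [C [r0 H]]; exists `|C|, (Num.max 1 r0); split=> // [|x]; first by rewrite le_max lexx.
rewrite ge_max => /andP[x1 xr]; have x0 : 0 < eucl_norm x by exact: lt_le_trans x1.
have r_gt0 : 0 < eucl_norm x `^ (- tau) by rewrite powR_gt0.
have := H x xr; set r := eucl_norm x; set rho := r `^ (- tau) => {}H.
have Cr : C * rho <= `|C| * rho by rewrite ler_wpM2r ?(ltW r_gt0) // ler_norm.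
have [H1 H2 H3] := decay_split x0 (normr_ge0 _) (sqrtr_ge0 _) (sqrtr_ge0 _) (le_trans H Cr).
split=> // [|i|i j].
- by rewrite r_gt0 /rho -(powRr0 r) ler_powR // lerNl oppr0 ltW.
- by rewrite mulrA; apply: le_trans (pderiv_le_grad_norm u i x) H2.
- by rewrite mulrA; apply: le_trans (pderiv_le_hess_norm u i j x) H3.
Qed.

Lemma AF_bounded u tau : continuous u -> 0 < tau -> asymptotically_flat_CF tau u ->
  exists B, forall x, `|u x| <= B.
Proof.
move=> cu tau0 /(AF_decay tau0)[C [r0 [C0 _ H]]].
have [M HM] := continuous_bounded_ball r0 cu.
exists (Num.max M C) => x; rewrite le_max; have [xr|rx] := leP (eucl_norm x) r0.
  by rewrite HM // (le_trans (norm_le_eucl_norm _)).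
have [/andP[_ r1] ux _ _] := H x (ltW rx).
by apply/orP; right; rewrite (le_trans ux) // ler_piMr.
Qed.

Let schouten_entry_bound (h a b g s c e d N : R) : 0 <= s -> 0 <= c -> 0 <= e -> 0 <= N ->
  s ^+ 2 <= e -> `|h| <= c * e -> `|a| <= c * s -> `|b| <= c * s -> 0 <= g -> g <= N * (c * s) ^+ 2 ->
  0 <= d <= 1 -> `|h + a * b - 2^-1 * g * d| <= (c + c ^+ 2 + N * c ^+ 2) * e.
Proof.
move=> s0 c0 e0 N0 se hb ab bb g0 gb /andP[d0 d1].
have cs : (c * s) ^+ 2 <= c ^+ 2 * e by rewrite exprMn ler_wpM2l // sqr_ge0.
have H1 : `|a * b| <= c ^+ 2 * e by rewrite normrM (le_trans (ler_pM _ _ ab bb)) -?expr2.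
have H2 : `|2^-1 * g * d| <= N * c ^+ 2 * e.
  rewrite ger0_norm ?mulr_ge0 // (@le_trans _ _ g) //; last first.
    by rewrite (le_trans gb) // -mulrA ler_wpM2l.
  rewrite (@le_trans _ _ (g * d)) //; first by rewrite -mulrA ler_piMl ?mulr_ge0 //; lra.
  by rewrite ler_piMr.
rewrite (le_trans (ler_normB _ _)) // (le_trans (lerD (ler_normD _ _) H2)) //.
by rewrite (le_trans (lerD (lerD hb H1) (lexx _))) // !mulrDl.
Qed.

(** In the Schouten matrix the quadratic gradient terms decay faster than the Hessian, so its
    entries are [O(|x|^(-tau-2))]; homogeneity of [sigma] and [newton] gives the rest. *)
Lemma AF_curvature u tau k : 0 < tau -> asymptotically_flat_CF tau u ->
  exists C r0, [/\ 0 <= C, 1 <= r0 & forall x, r0 <= eucl_norm x ->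
    let r := eucl_norm x in let rho := r `^ (- tau) in
    [/\ `|u x| <= C * rho, rho <= 1, grad_sq u x <= C * (rho / r) ^+ 2,
        `|sigma (schouten u x) k| <= C * (rho / r ^+ 2) ^+ k &
        forall i, `|(newton (schouten u x) k *m grad u x) i 0| <= C * ((rho / r ^+ 2) ^+ k * (rho / r))]].
Proof.
move=> tau0 /(AF_decay tau0)[C [r0 [C0 r01 H]]]; have [D D0 HD] := @newton_bound R n k.
pose N : R := n%:R; have N0 : 0 <= N by exact: ler0n.
pose B := C + C ^+ 2 + N * C ^+ 2; have B0 : 0 <= B by rewrite !addr_ge0 ?mulr_ge0 ?sqr_ge0.
have P1 : 0 <= N * C ^+ 2 by rewrite mulr_ge0 ?sqr_ge0.
have P2 : 0 <= D * B ^+ k by rewrite mulr_ge0 ?exprn_ge0.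
have P3 : 0 <= N * (D * B ^+ k * C) by rewrite !mulr_ge0 ?exprn_ge0.
exists (C + N * C ^+ 2 + D * B ^+ k + N * (D * B ^+ k * C)), r0; split=> //.
  by rewrite !addr_ge0.
move=> x rx r rho; have [/andP[rho0 rho1] ux dux ddux] := H x rx.
have r1 : 1 <= r by exact: le_trans rx.
have r_gt0 : 0 < r by exact: lt_le_trans r1.
have s0 : 0 <= rho / r by rewrite divr_ge0 ?(ltW rho0) ?(ltW r_gt0).
have e0 : 0 <= rho / r ^+ 2 by rewrite divr_ge0 ?exprn_ge0 ?(ltW rho0) ?(ltW r_gt0).
have se : (rho / r) ^+ 2 <= rho / r ^+ 2.
  by rewrite expr_div_n ler_wpM2r ?invr_ge0 ?exprn_ge0 ?(ltW r_gt0) // expr2 ler_piMl ?(ltW rho0).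
have g0 : 0 <= grad_sq u x by apply: sumr_ge0 => i _; exact: sqr_ge0.
have gb : grad_sq u x <= N * (C * (rho / r)) ^+ 2.
  apply: (@le_trans _ _ (\sum_(i < n) (C * (rho / r)) ^+ 2)).
    by apply: ler_sum => i _; rewrite -[leLHS](real_normK (num_real _)); apply: lerXn2r; rewrite ?nnegrE // mulr_ge0.
  by rewrite sumr_const card_ord -mulr_natl.
have WB i j : `|schouten u x i j| <= B * (rho / r ^+ 2).
  rewrite [X in `|X|]mxE; apply: (schouten_entry_bound s0 C0 e0 N0 se (ddux i j) (dux i) (dux j) g0 gb).
  by rewrite ler0n lern1 leq_b1.
have [sB TB] := HD (schouten u x) _ (mulr_ge0 B0 e0) WB.
have e_k : 0 <= (rho / r ^+ 2) ^+ k by rewrite exprn_ge0.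
have le_const (c c' X : R) : 0 <= X -> c <= c' -> forall y, y <= c * X -> y <= c' * X.
  by move=> X0 cc y /le_trans; apply; rewrite ler_wpM2r.
split.
- apply: le_const ux; [exact: ltW|lra].
- by [].
- apply: (le_const (N * C ^+ 2)); [exact: sqr_ge0|lra|].
  by rewrite (le_trans gb) // exprMn mulrA.
- by apply: (le_const (D * B ^+ k)) => //; [lra|rewrite -mulrA -exprMn].
move=> i; apply: (le_const (N * (D * B ^+ k * C))); [by rewrite mulr_ge0|lra|].
rewrite mxE (le_trans (ler_norm_sum _ _ _)) //.
apply: (@le_trans _ _ (\sum_(j < n) D * (B * (rho / r ^+ 2)) ^+ k * (C * (rho / r)))).
  by apply: ler_sum => j _; rewrite normrM; apply: ler_pM => //; rewrite mxE; exact: dux.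
by rewrite sumr_const card_ord -mulr_natl exprMn le_eqVlt; apply/orP; left; apply/eqP; rewrite -/N; ring.
Qed.

Lemma decay_rate_powR (r tau : R) k : 0 < r ->
  (r `^ (- tau) / r) ^+ 2 * (r `^ (- tau) / r ^+ 2) ^+ k = r `^ (- (k.+2%:R * tau + k.*2.+2%:R)).
Proof.
move=> r0; have r0' := ltW r0; have rn0 : r != 0 by rewrite gt_eqF.
have -> : - (k.+2%:R * tau + k.*2.+2%:R) = (- tau) * k.+2%:R + - k.*2.+2%:R by ring.
rewrite powRD ?rn0 ?implybT // powR_invn // powRrM powR_mulrn ?powR_ge0 //.
by rewrite !expr_div_n -exprM mulf_div -!exprD mul2n.
Qed.

End asymptotics.

(** * The mass as a limit of fluxes *)

Section mass_flux.
Context {R : realType} {m : nat}.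
Local Notation Rm := (measurableTypeR R).
Variables (u : 'rV[R]_m.+1 -> R) (tau : R) (k : nat).
Hypothesis su : smooth u.
Hypothesis tau_gt0 : 0 < tau.
Hypothesis u_AF : asymptotically_flat_CF tau u.

Let p : R := k.+2%:R * tau + k.*2.+2%:R.
Hypothesis p_gt : m.+1%:R < p.

Let W := schouten u.
Let V (x : 'rV[R]_m.+1) : 'cV[R]_m.+1 := newton (W x) k *m grad u x.
Let Q x := \sum_i V x i 0 * x 0 i.
Let c : R := @flux_coef R m.+1 k.
Let a : R := @flux_exponent R m.+1 k.

Lemma mxtrace_outer_grad (T : 'M[R]_m.+1) (nu : 'I_m.+1 -> R) x : T^T = T ->
  \tr (T *m \matrix_(i, q) (nu i * pderiv q u x)) = \sum_i (T *m grad u x) i 0 * nu i.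
Proof.
move=> Ts; rewrite /mxtrace.
transitivity (\sum_i \sum_j T i j * (nu j * pderiv i u x)).
  by apply: eq_bigr => i _; rewrite mxE; apply: eq_bigr => j _; rewrite mxE.
rewrite exchange_big; apply: eq_bigr => j _; rewrite mxE mulr_suml; apply: eq_bigr => i _.
rewrite [grad u x i 0]mxE -{1}Ts [T^T i j]mxE -mulrA; congr (_ * _); exact: mulrC.
Qed.

Lemma continuous_newton_grad i : continuous (fun x => V x i 0).
Proof.
rewrite (_ : (fun x => V x i 0) = fun x => \sum_j newton (W x) k i j * pderiv j u x).
  apply: continuous_bigsum => j; apply: continuous_mul => x.
    exact: (smooth_continuous (smooth_newton su k i j)).
  exact: (smooth_continuous (smooth_pderiv j su)).
by apply/funext => x; rewrite mxE; apply: eq_bigr => j _; rewrite [grad u x j 0]mxE.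
Qed.

Let cQ : continuous Q.
Proof.
apply: continuous_bigsum => i; apply: continuous_mul; first exact: continuous_newton_grad.
exact: coord_continuous.
Qed.

Let cexp (b : R) : continuous (fun x => expR (b * u x)).
Proof.
apply: continuous_after; first exact: continuous_expR.
apply: continuous_mul; first exact: cst_continuous.
by move=> x; exact: smooth_continuous su x.
Qed.

Lemma gbc_fluxE r : 0 < r -> gbc_flux (conformally_flat u) k.+1 r =
  sphere_integral r (fun x => c / r * (expR (k.*2.+2%:R * u x) * Q x)).
Proof.
move=> r0; apply: eq_sphere_integral => z zr.
rewrite (fluxE su k (fun i => z 0 i / eucl_norm z)) mxtrace_outer_grad ?zr; last first.
  by apply: tr_newton_sym; exact: schouten_sym.
rewrite -/c -expRM_natl mulrA -natrM mulnC mul2n -mulrA -mulrA; congr (_ * _).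
rewrite mulrCA; congr (_ * _); rewrite /Q mulr_sumr; apply: eq_bigr => i _.
by rewrite mulrA mulrC.
Qed.

Lemma outward_flux_fieldE x : outward (flux_field u k) x = expR (a * u x) * Q x.
Proof. by rewrite /outward /Q mulr_sumr; apply: eq_bigr => i _; rewrite /flux_field -mulrA. Qed.

Lemma expR_lipschitz (M s t : R) : s <= M -> t <= M -> `|expR s - expR t| <= expR M * `|s - t|.
Proof.
wlog ts : s t / t <= s => [H sM tM|sM _].
  by have [/H|/ltW/H] := leP t s; [exact|rewrite distrC [`|s - t|]distrC; exact].
rewrite !ger0_norm ?subr_ge0 ?ler_expR //.
apply: (@le_trans _ _ (expR s * (s - t))); last by rewrite ler_wpM2r ?subr_ge0 // ler_expR.
have -> : expR t = expR s * expR (t - s) by rewrite -expRD addrC subrK.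
rewrite -[X in X - _]mulr1 -mulrBr ler_wpM2l ?expR_ge0 //.
by have := expR_ge1Dx (t - s); lra.
Qed.

(** Replacing [e^(2(k+1)u)] by [e^(au)] changes the flux by a factor [O(|u|)], and
    the extra decay of [u] beats the growth of the area of the sphere. *)
Lemma flux_defect :
  gbc_flux (conformally_flat u) k.+1 r - c * ball_flux (flux_field u k) r @[r --> +oo] --> 0.
Proof.
have [C [r0 [C0 r01 H]]] := AF_curvature k tau_gt0 u_AF.
set w := sphere_integral 1 (fun _ : 'rV[R]_m.+1 => 1).
have w0 : 0 < w by exact: sphere_integral1_gt0.
pose b : R := k.*2.+2%:R; pose M := (`|b| + `|a|) * C.
pose K := `|c| * (expR M * `|b - a| * C * (m.+1%:R * C)) * w.
have bound r : r0 <= r ->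
    `|gbc_flux (conformally_flat u) k.+1 r - c * ball_flux (flux_field u k) r|
    <= K * r `^ (- (p - m.+1%:R)).
  move=> rr; have rp : 0 < r by exact: lt_le_trans (lt_le_trans ltr01 r01) rr.
  have oE : sphere_integral r (outward (flux_field u k)) = sphere_integral r (fun x => expR (a * u x) * Q x).
    by apply: eq_sphere_integral => z _; exact: outward_flux_fieldE.
  rewrite gbc_fluxE // /ball_flux mulrA oE.
  have cb1 := continuous_mul (@cexp b) cQ; have ca1 := continuous_mul (@cexp a) cQ.
  rewrite -sphere_integralZ // -sphere_integralB //; last 2 first.
  - by apply: continuous_mul => //; exact: cst_continuous.
  - by apply: continuous_mul => //; exact: cst_continuous.
  pose rho := r `^ (- tau); pose s := rho / r; pose e := rho / r ^+ 2.
  apply: (le_trans (sphere_integral_bound (M :=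
    `|c| / r * ((expR M * `|b - a| * (C * rho)) * (m.+1%:R * (C * (e ^+ k * s)) * r))) rp _ _)).
  - apply: continuous_sub; apply: continuous_mul => //; exact: cst_continuous.
  - move=> z zr; have [uz rho1 _ _ Vz] := H z (eq_ind_r (fun t => r0 <= t) rr zr).
    move: uz rho1 Vz; rewrite zr -/rho -/s -/e => uz rho1 Vz.
    rewrite -mulrBr -mulrBl normrM normrM normfV (ger0_norm (ltW rp)).
    apply: ler_wpM2l; first by rewrite divr_ge0 // ltW.
    rewrite normrM; apply: ler_pM => //.
      have uC : `|u z| <= C by rewrite (le_trans uz) // ler_piMr.
      have le_M (d : R) : `|d| <= `|b| + `|a| -> d * u z <= M.
        move=> dd; apply: le_trans (ler_norm _) _; rewrite normrM; exact: ler_pM.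
      apply: (le_trans (expR_lipschitz (le_M b _) (le_M a _))); rewrite ?lerDl ?lerDr //.
      by rewrite -mulrBl normrM mulrA ler_wpM2l // mulr_ge0 ?expR_ge0.
    rewrite /Q (le_trans (ler_norm_sum _ _ _)) //.
    apply: (@le_trans _ _ (\sum_(i < m.+1) C * (e ^+ k * s) * r)).
      apply: ler_sum => i _; rewrite normrM; apply: ler_pM => //.
      by rewrite -zr coord_le_eucl_norm.
    by rewrite sumr_const card_ord -[leLHS]mulr_natl -[leRHS]mulrA.
  rewrite opprB powRD; last by rewrite (gt_eqF rp) implybT.
  rewrite powR_mulrn ?(ltW rp) // -(decay_rate_powR tau k rp) -/rho -/s -/e /K -/w.
  rewrite le_eqVlt; apply/orP; left; apply/eqP.
  have srho : rho = s * r by rewrite /s divfK // gt_eqF.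
  rewrite {1}srho exprS; move: (e ^+ k) (expR M) => ek eM.
  by field; rewrite gt_eqF.
have K0 : K * r `^ (- (p - m.+1%:R)) @[r --> +oo] --> 0.
  rewrite -(mulr0 K); apply: cvgM; first exact: cvg_cst.
  by apply: powR_cvg_pinfty; rewrite subr_gt0.
apply/cvgrPdist_le => e e0; move/cvgrPdist_le/(_ e e0) : K0 => K0.
near=> r; rewrite sub0r normrN.
apply: le_trans (bound r _) _; first by near: r; apply: nbhs_pinfty_ge; exact: num_real.
apply: le_trans (ler_norm _) _; rewrite -normrN -sub0r; near: r; exact: K0.
Unshelve. all: by end_near. Qed.

Lemma volume_densityE x : volume_density (conformally_flat u) x = expR (- (m.+1%:R * u x)).
Proof.
rewrite /volume_density /conformally_flat det_scalar -expRM_natl.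
have -> : m.+1%:R * - (2 * u x) = 2%:R * (- (m.+1%:R * u x)) by ring.
by rewrite expRM_natl sqrtr_sqr ger0_norm // expR_ge0.
Qed.

Let prod_bound (d X Y P E C : R) : 0 <= d -> 0 <= X -> 0 <= Y -> X <= C * P -> Y <= C * E ->
  d * X * Y <= d * C * C * (P * E).
Proof.
move=> d0 X0 Y0 XP YE; have -> : d * C * C * (P * E) = d * ((C * P) * (C * E)) by ring.
by rewrite -mulrA ler_wpM2l // ler_pM.
Qed.

(** The term with [sigma (W x) k.+1] is controlled by the Gauss-Bonnet curvature, the
    gradient term by the decay of [u]. *)
Lemma flux_div_finite : (k.+1.*2 <= m.+1)%N ->
  integrable_gauss_bonnet (conformally_flat u) k.+1 ->
  (forall x, 0 <= sigma (W x) k.+1) -> (forall x, sigma (W x) k <= 0) ->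
  (\int[lebesgue_tuple m.+1]_t (flux_div u k (row_of_tuple t))%:E < +oo)%E.
Proof.
move=> kn iL s1 s0; have [B uB] := AF_bounded (smooth_continuous su) tau_gt0 u_AF.
have g0 := gb_coef_gt0 (R := R) kn; set g := @gb_coef R m.+1 k.+1 in g0.
pose G1 x := expR (a * u x) * (k.+1%:R * sigma (W x) k.+1).
pose G2 x := expR (a * u x) * (2^-1 * (m.+1%:R - k%:R) * grad_sq u x * - sigma (W x) k).
have nk : 0 <= m.+1%:R - k%:R :> R.
  by rewrite subr_ge0 ler_nat (leq_trans _ kn) // -addnn addSn leqW // leq_addr.
have gs0 x : 0 <= grad_sq u x by apply: sumr_ge0 => i _; exact: sqr_ge0.
have G1_ge0 x : 0 <= G1 x by rewrite mulr_ge0 ?expR_ge0 // mulr_ge0.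
have G2_ge0 x : 0 <= G2 x.
  by rewrite mulr_ge0 ?expR_ge0 // mulr_ge0 ?oppr_ge0 // mulr_ge0 // mulr_ge0.
have cs j : continuous (fun x => sigma (W x) j).
  by move=> x; exact: smooth_continuous (smooth_sigma su j) x.
have cst (b : R) : continuous (fun _ : 'rV[R]_m.+1 => b) by exact: cst_continuous.
have cG1 : continuous G1 by do 2?apply: continuous_mul => //.
have cG2 : continuous G2.
  apply: continuous_mul => //; apply: continuous_mul; last first.
    by apply: (@continuous_after _ _ (fun t : R => - t)); [exact: opp_continuous|exact: cs].
  by apply: continuous_mul => // x; exact: smooth_continuous (smooth_grad_sq su) x.
have -> : (\int[lebesgue_tuple m.+1]_t (flux_div u k (row_of_tuple t))%:E =
    \int[lebesgue_tuple m.+1]_t ((G1 (row_of_tuple t))%:E + (G2 (row_of_tuple t))%:E))%E.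
  apply: eq_integral => t _; rewrite -EFinD /flux_div /G1 /G2 -/(W _) -/a -mulrDr mulrN.
  by congr (_ * (_ - _))%:E.
rewrite ge0_integralD //; last 4 first.
- by move=> t _; rewrite lee_fin.
- by apply/measurable_EFinP; exact: measurable_row_continuous.
- by move=> t _; rewrite lee_fin.
- by apply/measurable_EFinP; exact: measurable_row_continuous.
apply: lte_add_pinfty.
  have : (lebesgue_tuple m.+1).-integrable setT (fun t => (G1 (row_of_tuple t))%:E).
    apply: (@le_integrable _ _ _ _ _ measurableT _ _ _ _
      (integrableZl measurableT (k.+1%:R / g * expR B) iL)).
      by apply/measurable_EFinP; exact: measurable_row_continuous.
    move=> t _ /=; move: (row_of_tuple t) => x; rewrite lee_fin ger0_norm // gauss_bonnetE // volume_densityE.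
    rewrite -/g -expRM_natl; apply: le_trans (ler_norm _).
    have -> : G1 x = k.+1%:R / g * expR (- u x) * (g * expR (k.+1%:R * (2 * u x)) * sigma (W x) k.+1 * expR (- (m.+1%:R * u x))).
      have -> : k.+1%:R / g * expR (- u x) * (g * expR (k.+1%:R * (2 * u x)) * sigma (W x) k.+1 * expR (- (m.+1%:R * u x)))
          = (expR (- u x) * expR (k.+1%:R * (2 * u x)) * expR (- (m.+1%:R * u x))) * (k.+1%:R * sigma (W x) k.+1).
        by move: (expR (- u x)) (expR _) (expR _) (sigma _ _) => X Y Z S; field; rewrite gt_eqF.
      rewrite -!expRD /G1; congr (expR _ * _).
      by rewrite /a /flux_exponent -!natr1 -muln2 natrM; ring.
    apply: ler_wpM2r.
      apply: mulr_ge0; last exact: expR_ge0.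
      apply: mulr_ge0; last exact: s1.
      by apply: mulr_ge0; [exact: ltW|exact: expR_ge0].
    apply: ler_wpM2l; first by rewrite divr_ge0 // (ltW g0).
    by rewrite ler_expR (le_trans (ler_norm _)) // normrN.
  move=> /integrableP[_]; apply: le_lt_trans; apply: ge0_le_integral => //.
  - by move=> t _; rewrite lee_fin.
  - by apply/measurable_EFinP; exact: measurable_row_continuous.
  - by apply/measurable_EFinP; apply: measurableT_comp => //; exact: measurable_row_continuous.
  by move=> t _; rewrite lee_fin ler_norm.
have [C [r0 [C0 r01 H]]] := AF_curvature k tau_gt0 u_AF.
pose K := expR (`|a| * B) * (2^-1 * (m.+1%:R - k%:R) * C * C).
have K0 : 0 <= K by rewrite mulr_ge0 ?expR_ge0 // !mulr_ge0.
apply: (integral_decay cG2 G2_ge0 K0 r01 p_gt) => x rx; have [_ _ gx sx _] := H x rx.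
have xp : 0 < eucl_norm x by apply: lt_le_trans rx; exact: lt_le_trans r01.
rewrite -(decay_rate_powR tau k xp) -mulrA; apply: ler_pM; rewrite ?expR_ge0 //.
- by rewrite !mulr_ge0 ?oppr_ge0.
- by rewrite ler_expR (le_trans (ler_norm _)) // normrM ler_wpM2l.
apply: prod_bound => //; [by rewrite mulr_ge0|by rewrite oppr_ge0|].
by apply: le_trans sx; rewrite -normrN ler_norm.
Qed.

End mass_flux.

(** * Interior maxima *)

Section rigidity.
Context {R : realType}.

Lemma sigma_newton_opp n (W : 'M[R]_n) k :
  sigma (- W) k = (-1) ^+ k * sigma W k /\ newton (- W) k = (-1) ^+ k *: newton W k.
Proof.
elim: k => [|k [_ IH]]; first by rewrite expr0 mul1r scale1r.
have s : sigma (- W) k.+1 = (-1) ^+ k.+1 * sigma W k.+1.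
  apply: (mulfI (_ : k.+1%:R != 0 :> R)); first by rewrite pnatr_eq0.
  rewrite sigmaS IH mulrCA sigmaS mulmxN -scalemxAl linearN /= linearZ /= exprS mulN1r mulNr.
  by [].
split=> //; rewrite !newtonS s IH scalerBr scale_scalar_mx; congr (_ + _).
by rewrite exprS mulN1r scaleNr opprK -scalemxAl mulmxN scalerN opprK.
Qed.

Lemma compact_eucl_ball n (r : R) : compact [set x : 'rV[R]_n | eucl_norm x <= r].
Proof.
apply: bounded_closed_compact.
  exists r; split; first exact: num_real.
  move=> C rC x /= xr; exact: le_trans (norm_le_eucl_norm x) (le_trans xr (ltW rC)).
apply: (@closed_comp _ _ (@eucl_norm R n) [set y | y <= r]); last exact: closed_le.
by move=> x _; exact: eucl_norm_continuous.
Qed.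

(** At a positive value of a function vanishing at infinity, adding a small multiple of
    [|x|^2] still leaves an interior maximum, where the Hessian is then strictly negative. *)
Lemma interior_max n (v : 'rV[R]_n -> R) x1 : smooth v -> 0 < v x1 ->
  (forall e, 0 < e -> exists r, forall x, r <= eucl_norm x -> v x <= e) ->
  exists e x0, [/\ 0 < e, e * eucl_norm x0 ^+ 2 < 1,
    forall i, pderiv i v x0 = - (2 * e * x0 0 i) &
    forall d : 'rV[R]_n, \sum_j d 0 j * (\sum_i d 0 i * pderiv j (pderiv i v) x0)
      <= - (2 * e * \sum_i d 0 i ^+ 2)].
Proof.
move=> sv v1 vinf; have [r1 Hr1] := vinf (v x1 / 2) (divr_gt0 v1 (ltr0n _ 2)).
pose r := Num.max 1 (Num.max r1 (eucl_norm x1)).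
have r_ge1 : 1 <= r by rewrite le_max lexx.
have r_gt0 : 0 < r by exact: lt_le_trans r_ge1.
have rr1 : r1 <= r by rewrite /r !le_max lexx orbT.
have rx1 : eucl_norm x1 <= r by rewrite /r !le_max lexx !orbT.
(* The value of [e |x|^2] on the sphere of radius [r]: below [v x1 / 2], so that the maximum over
   the ball is not on its boundary, and below 1. *)
pose t := Num.min (v x1 / 2) 1 / 2.
have t0 : 0 < t by rewrite divr_gt0 // lt_min ltr01 divr_gt0.
have tv : t < v x1 / 2.
  have : Num.min (v x1 / 2) 1 <= v x1 / 2 by rewrite ge_min lexx.
  rewrite /t; lra.
have t1 : t < 1.
  have : Num.min (v x1 / 2) 1 <= 1 by rewrite ge_min lexx orbT.
  rewrite /t; lra.
pose e := t / r ^+ 2; have r2 : 0 < r ^+ 2 by rewrite exprn_gt0.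
have e0 : 0 < e by rewrite divr_gt0.
have er : e * r ^+ 2 = t by rewrite divfK // gt_eqF.
pose w x := v x + e * \sum_i x 0 i ^+ 2.
have cw : continuous w.
  apply: continuous_add; first by move=> x; exact: smooth_continuous sv x.
  by apply: continuous_mul; [exact: cst_continuous|exact: sumsq_continuous].
have [x0 x0r x0max] : exists2 c, eucl_norm c <= r & forall x, eucl_norm x <= r -> w x <= w c.
  have [||c cr cmax] := EVT_max_rV (f := w) _ (@compact_eucl_ball n r).
  - by exists x1.
  - exact: continuous_subspaceT.
  exists c; first by move: cr; rewrite inE.
  by move=> x xr; apply: cmax; rewrite inE.
have x0_lt : eucl_norm x0 < r.
  rewrite lt_neqAle x0r andbT; apply/eqP => x0E.
  have := x0max x1 rx1; rewrite /w -!sqr_eucl_norm x0E er.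
  have := Hr1 x0; rewrite x0E => /(_ rr1) H1.
  have : 0 <= e * eucl_norm x1 ^+ 2 by rewrite mulr_ge0 ?sqr_ge0 // ltW.
  lra.
have ex0 : e * eucl_norm x0 ^+ 2 < 1.
  apply: le_lt_trans t1; rewrite -er ler_pM2l // lerXn2r ?nnegrE ?eucl_norm_ge0 // ltW //.
have test (d : 'rV[R]_n) :
    \sum_i d 0 i * pderiv i v x0 = - (2 * e * \sum_i d 0 i * x0 0 i) /\
    \sum_j d 0 j * (\sum_i d 0 i * pderiv j (pderiv i v) x0) <= - (2 * e * \sum_i d 0 i ^+ 2).
  pose L := 2 * e * \sum_i d 0 i * x0 0 i; pose A := e * \sum_i d 0 i ^+ 2.
  pose D x := \sum_i d 0 i * pderiv i v x.
  have sD : smooth D by apply: smooth_sum => i; apply: smoothZ; exact: smooth_pderiv.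
  pose g (s : R) := v (s *: d + x0) + (A * (s * s) + L * s).
  pose g' (s : R) := D (s *: d + x0) + (A * (s + s) + L).
  pose g'' (s : R) := \sum_j d 0 j * pderiv j D (s *: d + x0) + (A + A).
  have dg s : is_derive s (1 : R) g (g' s).
    have d1 := is_derive_line (is_derive_gradient (s *: d + x0) d sv).
    have d2 := is_deriveD (is_deriveZ A (is_deriveM (is_derive_id s (1 : R)) (is_derive_id s (1 : R))))
      (is_deriveZ L (is_derive_id s (1 : R))).
    apply: (is_derive_eq (is_deriveD d1 d2)); rewrite /g' /GRing.scale /=; congr (_ + _); ring.
  have dg' s : is_derive s (1 : R) g' (g'' s).
    have d1 := is_derive_line (is_derive_gradient (s *: d + x0) d sD).
    have d2 := is_deriveD (is_deriveZ A (is_deriveD (is_derive_id s (1 : R)) (is_derive_id s (1 : R))))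
      (is_derive_cst L s (1 : R)).
    apply: (is_derive_eq (is_deriveD d1 d2)); rewrite /g'' /GRing.scale /=; congr (_ + _); ring.
  have cline : continuous (fun s : R => s *: d + x0).
    by move=> s; apply: cvgD; [exact: scalel_continuous|exact: cvg_cst].
  have cg'' : {for 0, continuous g''}.
    suff : continuous g'' by exact.
    apply: continuous_add; last exact: cst_continuous.
    apply: continuous_bigsum => j; apply: continuous_mul; first exact: cst_continuous.
    move=> s; apply: (@continuous_comp _ _ _ (fun s : R => s *: d + x0) (pderiv j D)); first exact: cline.
    exact: smooth_continuous (smooth_pderiv j sD) _.
  have gw s : w (s *: d + x0) = g s + e * \sum_i x0 0 i ^+ 2.
    rewrite /w /g /A /L -addrA; congr (_ + _).
    rewrite [LHS](_ : _ = e * \sum_i (d 0 i ^+ 2 * (s * s) + d 0 i * x0 0 i * (2 * s) + x0 0 i ^+ 2)).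
      by rewrite !big_split /= -!mulr_suml; ring.
    by congr (_ * _); apply: eq_bigr => i _; rewrite !mxE; ring.
  have [b /= b0 bP] : exists2 b : R, 0 < b & forall s, `|s| < b -> eucl_norm (s *: d + x0) < r.
    have cn : {for 0, continuous (fun s : R => eucl_norm (s *: d + x0))}.
      by apply: continuous_comp; [exact: cline|exact: eucl_norm_continuous].
    have : \forall s \near (0 : R), eucl_norm (s *: d + x0) < r.
      by apply: (cvgr_lt _ cn); rewrite scale0r add0r.
    move=> /nbhs_ballP[b /= b0 bP]; exists b => // s sb; apply: bP.
    by rewrite -ball_normE /ball_ /= sub0r normrN.
  have gmax s : `|s| < b -> g s <= g 0.
    move=> /bP /ltW /x0max; rewrite gw.
    have := gw 0; rewrite scale0r add0r => ->; rewrite lerD2r; exact.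
  have [] := second_derivative_test b0 dg dg' cg'' gmax.
  rewrite /g' /g'' scale0r add0r !addr0 mulr0 add0r => H1 H2; split; first by rewrite -/L -[LHS]/(D x0); lra.
  rewrite (eq_bigr (fun j => d 0 j * pderiv j D x0)) => [|j _].
    by move: H2; rewrite /A; lra.
  congr (_ * _); rewrite /D pderiv_sum => [|i]; last by apply: smoothZ; exact: smooth_pderiv.
  by apply: eq_bigr => i _; rewrite pderivZ //; exact: smooth_pderiv.
exists e, x0; split=> // [i|d]; last by have [] := test d.
have [H _] := test 'e_i; move: H.
have pick (f : 'I_n -> R) : \sum_j ('e_i : 'rV[R]_n) 0 j * f j = f i.
  rewrite (bigD1 i) //= mxE !eqxx mul1r big1 ?addr0 // => j ji.
  by rewrite mxE (negPf ji) andbF mul0r.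
by rewrite !pick mulrA.
Qed.

End rigidity.

(** * The sign of u from the symmetric functions of its Schouten matrix *)

Section sign_of_u.
Context {R : realType} {m : nat}.
Variable u : 'rV[R]_m.+1 -> R.
Hypothesis su : smooth u.
Hypothesis u_vanish : forall e, 0 < e -> exists r, forall x, r <= eucl_norm x -> `|u x| <= e.

(** Lagrange's identity. *)
Lemma cauchy_schwarz n (d y : 'rV[R]_n) :
  (\sum_i d 0 i * y 0 i) ^+ 2 <= (\sum_i d 0 i ^+ 2) * (\sum_i y 0 i ^+ 2).
Proof.
set D := \sum_i d 0 i ^+ 2; set Y := \sum_i y 0 i ^+ 2; set b := \sum_i d 0 i * y 0 i.
have : 0 <= \sum_i \sum_j (d 0 i * y 0 j - d 0 j * y 0 i) ^+ 2.
  by apply: sumr_ge0 => i _; apply: sumr_ge0 => j _; exact: sqr_ge0.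
have -> : \sum_i \sum_j (d 0 i * y 0 j - d 0 j * y 0 i) ^+ 2 =
    \sum_i (d 0 i ^+ 2 * Y - 2 * (d 0 i * y 0 i) * b + y 0 i ^+ 2 * D).
  apply: eq_bigr => i _; rewrite /Y /b /D !mulr_sumr -sumrB -big_split /=.
  by apply: eq_bigr => j _; ring.
rewrite big_split sumrB /= -!mulr_suml -mulr_sumr -/D -/Y -/b; lra.
Qed.

Lemma quadratic_form n (M : 'M[R]_n) (d : 'rV[R]_n) :
  (d *m M *m d^T) 0 0 = \sum_i d 0 i * (\sum_j d 0 j * M i j).
Proof.
rewrite mxE; transitivity (\sum_j \sum_i d 0 i * (d 0 j * M i j)).
  apply: eq_bigr => j _; rewrite [(d *m M) 0 j]mxE [d^T j 0]mxE mulr_suml.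
  by apply: eq_bigr => i _; ring.
by rewrite exchange_big; apply: eq_bigr => i _; rewrite mulr_sumr.
Qed.

Lemma schouten_quadratic_form (x d : 'rV[R]_m.+1) :
  \sum_i d 0 i * (\sum_j d 0 j * schouten u x i j) =
  \sum_i d 0 i * (\sum_j d 0 j * pderiv i (pderiv j u) x) + (\sum_i d 0 i * pderiv i u x) ^+ 2
  - 2^-1 * grad_sq u x * \sum_i d 0 i ^+ 2.
Proof.
rewrite expr2 [in X in _ + X - _]mulr_suml mulr_sumr -big_split -sumrB /=; apply: eq_bigr => i _.
rewrite (eq_bigr (fun j => d 0 j * pderiv i (pderiv j u) x + pderiv i u x * (d 0 j * pderiv j u x)
  - 2^-1 * grad_sq u x * (d 0 j * (i == j)%:R))); last first.
  move=> j _; rewrite [schouten u x i j]mxE.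
  move: (pderiv i (pderiv j u) x) (pderiv i u x) (pderiv j u x) (grad_sq u x) ((i == j)%:R) => ? ? ? ? ?.
  by ring.
have K : \sum_(j < m.+1) d 0 j * (i == j)%:R = d 0 i.
  rewrite (bigD1 i) //= eqxx mulr1 big1 ?addr0 // => j ji.
  by rewrite eq_sym (negPf ji) mulr0.
rewrite sumrB big_split /= -!mulr_sumr K.
move: (\sum_j _) (\sum_j _) (pderiv i u x) (grad_sq u x) => ? ? ? ?; ring.
Qed.

(** Where [u + e |x|^2] is maximal the Hessian is at most [- 2 e], and the gradient is too
    small to restore the sign: the Schouten matrix is negative definite there. *)
Lemma sigma_eq0_nonpos k : (k <= m.+1)%N ->
  (forall x, sigma (schouten u x) k = 0) -> forall x, u x <= 0.
Proof.
move=> kn s0 x1; rewrite leNgt; apply/negP => ux1.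
have [|e [x0 [e0 ex0 g1 h1]]] := interior_max su ux1.
  by move=> e e0; have [r H] := u_vanish e0; exists r => x /H; apply: le_trans; exact: ler_norm.
have P : posdef (- schouten u x0).
  move=> d d0; rewrite quadratic_form.
  have -> : \sum_i d 0 i * (\sum_j d 0 j * (- schouten u x0) i j) =
      - \sum_i d 0 i * (\sum_j d 0 j * schouten u x0 i j).
    rewrite -sumrN; apply: eq_bigr => i _; rewrite -mulrN -sumrN; congr (_ * _).
    by apply: eq_bigr => j _; rewrite [(- schouten u x0) i j]mxE mulrN.
  rewrite schouten_quadratic_form; have := h1 d; set H := \sum_i d 0 i * _ => Hd.
  have E1 : \sum_i d 0 i * pderiv i u x0 = - (2 * e) * \sum_i d 0 i * x0 0 i.
    by rewrite mulr_sumr; apply: eq_bigr => i _; rewrite g1; ring.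
  have E2 : grad_sq u x0 = (2 * e) ^+ 2 * \sum_i x0 0 i ^+ 2.
    by rewrite /grad_sq mulr_sumr; apply: eq_bigr => i _; rewrite g1; ring.
  have CS := cauchy_schwarz d x0.
  have D0 : 0 < \sum_i d 0 i ^+ 2.
    by have := row_sq_gt0 d0; rewrite mxE (eq_bigr (fun i => d 0 i ^+ 2)) // => i _; rewrite [d^T i 0]mxE expr2.
  move: ex0 Hd CS D0; rewrite E1 E2 sqr_eucl_norm; move: e0; clear.
  move: H (\sum_i d 0 i * x0 0 i) (\sum_i d 0 i ^+ 2) (\sum_i x0 0 i ^+ 2) => H b D X e0 eX HD bDX D0.
  have F : 0 < 2 * e * D * (1 - e * X) by rewrite !mulr_gt0 // subr_gt0.
  have G : 0 <= (2 * e) ^+ 2 * (D * X - b ^+ 2) by rewrite mulr_ge0 ?sqr_ge0 // subr_ge0.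
  nra.
have := mixed_disc_posdef kn P; rewrite mixed_disc_const; have [-> _] := sigma_newton_opp (schouten u x0) k.
by rewrite s0 !mulr0 ltxx.
Qed.

(** Where [u - e |x|^2] is minimal the trace of the Schouten matrix is positive. *)
Lemma sigma1_le0_nonneg : (forall x, sigma (schouten u x) 1 <= 0) -> forall x, 0 <= u x.
Proof.
move=> s1 x1; rewrite leNgt; apply/negP => ux1.
have nux1 : 0 < - u x1 by rewrite oppr_gt0.
have [|e [x0 [e0 ex0 g1 h1]]] := interior_max (smoothN su) nux1.
  move=> e e0; have [r H] := u_vanish e0; exists r => x /H; apply: le_trans; rewrite -normrN; exact: ler_norm.
have G i : pderiv i u x0 = 2 * e * x0 0 i.
  by have := g1 i; rewrite (pderivN _ su) => /oppr_inj.
have Hi i : 2 * e <= pderiv i (pderiv i u) x0.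
  have := h1 'e_i.
  have pick (f : 'I_m.+1 -> R) : \sum_j ('e_i : 'rV[R]_m.+1) 0 j * f j = f i.
    rewrite (bigD1 i) //= mxE !eqxx mul1r big1 ?addr0 // => j ji.
    by rewrite mxE (negPf ji) andbF mul0r.
  rewrite !pick.
  rewrite mxE !eqxx mulr1 (pderivN _ su) (pderivN _ (smooth_pderiv i su)) lerN2; exact.
have gs : grad_sq u x0 = (2 * e) ^+ 2 * eucl_norm x0 ^+ 2.
  by rewrite sqr_eucl_norm /grad_sq mulr_sumr; apply: eq_bigr => i _; rewrite G; ring.
have := s1 x0; rewrite leNgt => /negP; apply.
have -> : sigma (schouten u x0) 1 = \tr (schouten u x0).
  by rewrite -[LHS]mul1r (sigmaS (schouten u x0) 0) mul1mx.
apply: (@lt_le_trans _ _ (\sum_(i < m.+1) (2 * e * (1 - e * eucl_norm x0 ^+ 2)))).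
  rewrite sumr_const card_ord pmulrn_rgt0 // !mulr_gt0 //; lra.
apply: ler_sum => i _; rewrite [schouten u x0 i i]mxE eqxx mulr1 gs.
have := Hi i; have := sqr_ge0 (pderiv i u x0).
move: (pderiv i (pderiv i u) x0) (pderiv i u x0) (eucl_norm x0 ^+ 2) => H g X; clear.
by rewrite expr2 => g2 H2; lra.
Qed.

End sign_of_u.

(** * Nonnegativity and rigidity of the mass *)

Lemma AF_vanish (R : realType) n (u : 'rV[R]_n -> R) tau : 0 < tau -> asymptotically_flat_CF tau u ->
  forall e, 0 < e -> exists r, forall x, r <= eucl_norm x -> `|u x| <= e.
Proof.
move=> tau0 /(AF_decay tau0)[C [r0 [C0 _ H]]] e e0.
have : C * r `^ (- tau) @[r --> +oo] --> (0 : R).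
  by rewrite -(mulr0 C); apply: cvgM; [exact: cvg_cst|exact: powR_cvg_pinfty].
move=> /cvgrPdist_le/(_ e e0)[M [_ HM]].
exists (Num.max r0 (M + 1)) => x; rewrite ge_max => /andP[x0 xM].
have [_ ux _ _] := H x x0; apply: le_trans ux _.
have := HM (eucl_norm x); rewrite sub0r normrN => /(_ _)/(le_trans (ler_norm _)); apply.
by apply: lt_le_trans xM; rewrite ltrDl ltr01.
Qed.

(** The decay order is exactly what makes the gradient term of the divergence integrable. *)
Lemma decay_exponent (R : realType) (n k : nat) (tau : R) :
  (n%:R - k.+1.*2%:R) / k.+2%:R < tau -> n%:R < k.+2%:R * tau + k.*2.+2%:R.
Proof. by rewrite ltr_pdivrMr ?ltr0n // ltrBlDr mulrC. Qed.

Theorem theorem1p2 (R : realType) (k n : nat) (tau : R) (u : 'rV[R]_n -> R)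
    (k_ge2 : (2 <= k)%N) (k_even : ~~ odd k) (k_lt : (k.*2 < n)%N)
    (u_smooth : smooth u)
    (tau_gt : (n%:R - k.*2%:R) / k.+1%:R < tau)
    (u_AF : asymptotically_flat_CF tau u)
    (Lk_int : integrable_gauss_bonnet (conformally_flat u) k)
    (L_sign : forall (j : nat) (x : 'rV[R]_n), (1 <= j <= k)%N ->
      0 <= (-1) ^+ j * gauss_bonnet (conformally_flat u) j x) :
  [/\ cvg (gbc_flux (conformally_flat u) k r @[r --> +oo]),
      0 <= gbc_mass (conformally_flat u) k
    & gbc_mass (conformally_flat u) k = 0 <-> forall x, u x = 0].
Proof.
(* From here on [k] is one less than the order of the mass, and [n = m.+1]. *)
case: n k k_ge2 k_even k_lt u u_smooth tau_gt u_AF Lk_int L_sign => [//|m] [//|k] k_ge2 k_even k_lt u su tau_gt u_AF Lk_int L_sign.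
have kn : (k.+1.*2 <= m.+1)%N by exact: ltnW.
have k_odd : odd k by move: k_even; rewrite /= negbK.
have k_le : (k.+1 <= m.+1)%N by apply: leq_trans kn; rewrite -addnn leq_addr.
have tau0 : 0 < tau.
  by apply: le_lt_trans tau_gt; rewrite divr_ge0 // subr_ge0 ler_nat.
have p_gt := decay_exponent tau_gt.
have sign j x : (1 <= j <= k.+1)%N -> 0 <= (-1) ^+ j * sigma (schouten u x) j.
  move=> jk; have := L_sign j x jk; rewrite gauss_bonnetE // mulrCA pmulr_rge0 //.
  rewrite mulr_gt0 ?exprn_gt0 ?expR_gt0 // gb_coef_gt0 // (leq_trans _ kn) // leq_double.
  by case/andP: jk.
have s_top x : 0 <= sigma (schouten u x) k.+1.
  by have := sign k.+1 x; rewrite -signr_odd /= k_odd expr0 mul1r; apply; rewrite leqnn.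
have s_low x : sigma (schouten u x) k <= 0.
  have := sign k x; rewrite -signr_odd k_odd expr1 mulN1r oppr_ge0; apply.
  by rewrite leqnSn andbT; case: (k) k_odd.
have s_one x : sigma (schouten u x) 1 <= 0.
  by have := sign 1%N x; rewrite expr1 mulN1r oppr_ge0; apply.
pose F := flux_field u k; pose dF i := pderiv i (F i).
have sF i : smooth (F i) by exact: smooth_flux_field.
have F_derive i x : is_derive x 'e_i (F i) (dF i x) by exact: is_pderiv.
have cF i : continuous (F i) by move=> x; exact: smooth_continuous (sF i) x.
have cdF i : continuous (dF i) by move=> x; exact: smooth_continuous (smooth_pderiv i (sF i)) x.
have divE x : divergence dF x = flux_div u k x by exact: div_flux_field.
have nk : 0 <= m.+1%:R - k%:R :> R by rewrite subr_ge0 ler_nat ltnW.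
have low_ge0 x : 0 <= - (2^-1 * (m.+1%:R - k%:R) * grad_sq u x * sigma (schouten u x) k).
  rewrite -mulrN mulr_ge0 ?oppr_ge0 // mulr_ge0 ?mulr_ge0 //.
  by apply: sumr_ge0 => i _; exact: sqr_ge0.
have div_ge0 x : 0 <= divergence dF x.
  by rewrite divE /flux_div mulr_ge0 ?expR_ge0 // addr_ge0 // mulr_ge0.
have fin : (\int[lebesgue_tuple m.+1]_t (divergence dF (row_of_tuple t))%:E < +oo)%E.
  rewrite (eq_integral (fun t => (flux_div u k (row_of_tuple t))%:E)) => [|t _]; last by rewrite divE.
  exact: (flux_div_finite su tau0 u_AF p_gt kn Lk_int s_top s_low).
have [L [cvgL L0 L_eq0]] := ball_flux_cvg F_derive cF cdF div_ge0 fin.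
pose c : R := @flux_coef R m.+1 k; have c0 : 0 < c by exact: flux_coef_gt0.
have cvg_gbc : gbc_flux (conformally_flat u) k.+1 r @[r --> +oo] --> c * L.
  rewrite -[c * L]add0r.
  rewrite (_ : gbc_flux _ _ = fun r => (gbc_flux (conformally_flat u) k.+1 r - c * ball_flux F r)
    + c * ball_flux F r); last by apply/funext => r; rewrite subrK.
  apply: cvgD; first exact: (flux_defect su tau0 u_AF p_gt).
  by apply: cvgM => //; exact: cvg_cst.
have lim_gbc : lim (gbc_flux (conformally_flat u) k.+1 r @[r --> +oo]) = c * L by exact: cvg_lim.
set b : R := (m.+1 - k.+1.*2)`!%:R / (2 ^+ k.+1.-1 * m.+1.-1`!%:R *
  sphere_integral 1 (fun _ : 'rV[R]_m.+1 => 1)).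
have b0 : 0 < b.
  apply: divr_gt0; first by rewrite ltr0n fact_gt0.
  apply: mulr_gt0; last exact: sphere_integral1_gt0.
  by apply: mulr_gt0; [rewrite exprn_gt0|rewrite ltr0n fact_gt0].
have massE : gbc_mass (conformally_flat u) k.+1 = b * (c * L) by rewrite -lim_gbc.
split.
- by apply/cvg_ex; exists (c * L).
- by rewrite massE; apply: mulr_ge0; [exact: ltW|apply: mulr_ge0; [exact: ltW|]].
split=> [mass0 x|u0].
  have {}L_eq0 : forall x, divergence dF x = 0.
    apply: L_eq0; apply/eqP; move/eqP: mass0.
    by rewrite massE mulf_eq0 (gt_eqF b0) /= mulf_eq0 (gt_eqF c0).
  have s0 y : sigma (schouten u y) k.+1 = 0.
    have := L_eq0 y; rewrite divE => /eqP; rewrite mulf_eq0 gt_eqF ?expR_gt0 //=.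
    rewrite (paddr_eq0 (mulr_ge0 (ler0n _ _) (s_top y)) (low_ge0 y)) => /andP[+ _].
    by rewrite mulf_eq0 pnatr_eq0 => /eqP.
  have van := AF_vanish tau0 u_AF.
  by apply/eqP; rewrite eq_le (sigma_eq0_nonpos su van k_le s0) (sigma1_le0_nonneg su van s_one).
have grad0 x : grad u x = 0.
  by apply/colP => i; rewrite !mxE (_ : u = fun=> 0) ?pderiv_cst //; exact/funext.
have flux0 r : 0 < r -> gbc_flux (conformally_flat u) k.+1 r = 0.
  move=> r0; rewrite (gbc_fluxE _ su r0) -[RHS](mul0r (r ^+ m * sphere_integral 1 (fun _ : 'rV[R]_m.+1 => 1))).
  rewrite -(sphere_integral_cst _ r0); apply: eq_sphere_integral => z _.
  by rewrite big1 ?mulr0 // => i _; rewrite grad0 mulmx0 mxE mul0r.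
have cvg0 : gbc_flux (conformally_flat u) k.+1 r @[r --> +oo] --> 0.
  apply: cvg_near_cst; near=> r; apply: flux0; near: r.
  by apply: nbhs_pinfty_gt; exact: num_real.
by rewrite massE (cvg_unique _ cvg_gbc cvg0) // mulr0.
Unshelve. all: by end_near. Qed.
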